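(* Let $\mathbf Y=\mathbf H(z,\mathbf Y)$ be a well-founded system of dimension $m$ that is not irreducible and splits into two sub-systems $\mathbf Y_{1:i}=\mathbf H_{1:i}(z,\mathbf Y_{1:i})$ and $\mathbf Y_{i+1:m}=\mathbf H_{i+1:m}(z,\mathbf Y_{1:i},\mathbf Y_{i+1:m})$, where the second one is an irreducible component. Assume that the radius of convergence $\rho$ of the generating function solution $\mathbf Y$ is smaller than that of $\mathbf Y_{1:i}$ and that $(\rho,\mathbf Y(\rho))$ lies inside the domain of convergence of $\mathbf H$. Then there exists a neighborhood of $(\mathbf Y(\rho),\rho)$ such that Newton's iteration for the characteristic system $\mathbf Y-\mathbf H(z,\mathbf Y)=\mathbf 0$, $\det(\mathrm{Id}-\frac{\partial\mathbf H}{\partial\mathbf Y}(z,\mathbf Y))=0$ (of the whole system, in the unknowns $(\mathbf Y,z)$) converges quadratically to $(\mathbf Y(\rho),\rho)$ when started in that neighborhood.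
   Context: Let $\mathbf H=(H_1,\dots,H_m)$, written $\mathbf H(z,\mathbf Y)$, be analytic near $\mathbf 0\in\mathbb C^{m+1}$; its domain of convergence is that of its Taylor series at $\mathbf 0$. The system is well founded when (i) each $H_i$ has nonnegative real Taylor coefficients at $\mathbf 0$; (ii) with $\mathbf U^{[0]}=\mathbf 0$, for $k=0,\dots,m$, $(0,\mathbf U^{[k]})$ lies in the domain of convergence, so that $\mathbf U^{[k+1]}=\mathbf H(0,\mathbf U^{[k]})$ is defined; (iii) $\partial\mathbf H/\partial\mathbf Y$ at $(0,\mathbf U^{[m]})$ is nilpotent. The generating function solution is the unique solution analytic near $0$ with value $\mathbf U^{[m]}$ at $0$. A system is irreducible if it is well founded, zero-free (no coordinate of the solution identically zero), recursive ($\partial\mathbf H/\partial\mathbf Y$ not nilpotent) and its dependency graph (edge $i\to j$ when $H_i$ depends on $Y_j$) is strongly connected. The sub-system $\mathbf Y_{i+1:m}=\mathbf H_{i+1:m}(z,\mathbf Y_{1:i},\mathbf Y_{i+1:m})$ is an irreducible component when $\mathbf H_{1:i}$ does not depend on $\mathbf Y_{i+1:m}$ and the restriction of the dependency graph to the vertices $i+1,\dots,m$ is strongly connected and the block $\partial\mathbf H_{i+1:m}/\partial\mathbf Y_{i+1:m}$ is not nilpotent (i.e., the block is not a single nonrecursive equation).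
   Formalization: The formal theorem also assumes the system is zero-free (no coordinate of the solution Y is identically zero); without this the claim fails, e.g. Y1=z, Y2=zY1+Y2^2+Y2Y3, Y3=2Y2Y3, where the characteristic system has a singular Jacobian at (Y(ρ),ρ). *)

(* Defs.v *)
From HB Require Import structures.
From mathcomp Require Import all_boot all_order all_algebra.
From mathcomp Require Import complex.
From mathcomp Require Import all_classical all_reals all_analysis.

Set Implicit Arguments.
Unset Strict Implicit.
Unset Printing Implicit Defensive.

Import Order.TTheory GRing.Theory Num.Theory.
Import numFieldNormedType.Exports.

Local Open Scope classical_set_scope.
Local Open Scope ring_scope.
Local Open Scope complex_scope.

(* R[i] under a name whose carrier is a projection of [numClosedFieldType]:
   this is what lets the topological and normed structures that
   MathComp-Analysis puts on every [numFieldType] be found.  In this ring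
   [0 <= z] means that z is a nonnegative real. *)
Definition Cplx (R : realType) : numClosedFieldType := R[i].

Definition ps (R : realType) (n : nat) : Type :=
  {ffun 'I_n -> nat} -> Cplx R.

Definition monomial (R : realType) n (x : 'rV[Cplx R]_n)
    (e : {ffun 'I_n -> nat}) : Cplx R :=
  \prod_(j < n) x 0 j ^+ e j.

(* Multiple series are summed over the boxes {0, ..., N-1}^n.  This is only
   used where the series converges absolutely, so the order is immaterial. *)
Definition box_sum (R : realType) n (u : {ffun 'I_n -> nat} -> Cplx R)
    (N : nat) : Cplx R :=
  \sum_(b : {ffun 'I_n -> 'I_N}) u [ffun j => nat_of_ord (b j)].

Definition ps_cvg_abs (R : realType) n (c : ps R n) (x : 'rV[Cplx R]_n) : Prop :=
  cvgn (box_sum (fun e => `|c e * monomial x e|)).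

Definition ps_eval (R : realType) n (c : ps R n) (x : 'rV[Cplx R]_n) : Cplx R :=
  limn (box_sum (fun e => c e * monomial x e)).

(* The right-hand side H of a system of dimension m is given by its Taylor
   coefficients at the origin.  The unknowns Y_1, ..., Y_m come first and z is
   the last variable. *)
Definition system (R : realType) (m : nat) : Type := 'I_m -> ps R (m + 1).

Definition zY_point (R : realType) m (z : Cplx R) (Y : 'rV[Cplx R]_m) :
    'rV[Cplx R]_(m + 1) :=
  row_mx Y z%:M.

Definition cvg_domain (R : realType) m (H : system R m) : set 'rV[Cplx R]_(m + 1) :=
  [set x | forall k, ps_cvg_abs (H k) x]°.

Definition analytic_near0 (R : realType) m (H : system R m) : Prop :=
  cvg_domain H (zY_point 0 0).

Definition sys_eval (R : realType) m (H : system R m)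
    (z : Cplx R) (Y : 'rV[Cplx R]_m) : 'rV[Cplx R]_m :=
  \row_k ps_eval (H k) (zY_point z Y).

(* [jacobian] acts on row vectors from the right, hence the transpose: the
   (a, b) entry is the partial derivative of H_a with respect to Y_b. *)
Definition dHdY (R : realType) m (H : system R m)
    (z : Cplx R) (Y : 'rV[Cplx R]_m) : 'M[Cplx R]_m :=
  (jacobian (sys_eval H z) Y)^T.

Definition U_iter (R : realType) m (H : system R m) (k : nat) : 'rV[Cplx R]_m :=
  iter k (sys_eval H 0) 0.

Definition nilpotent_mx (R : realType) m (A : 'M[Cplx R]_m) : Prop :=
  exists k : nat, A ^+ k = 0.

(* Nilpotency of a matrix whose entries are functions on the domain of
   convergence of H. *)
Definition nilpotent_on_domain (R : realType) m p (H : system R m)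
    (A : Cplx R -> 'rV[Cplx R]_m -> 'M[Cplx R]_p) : Prop :=
  exists k : nat, forall z Y, cvg_domain H (zY_point z Y) -> A z Y ^+ k = 0.

Definition wellfounded (R : realType) m (H : system R m) : Prop :=
  [/\ forall k e, 0 <= H k e,
      forall k, (k <= m)%N -> cvg_domain H (zY_point 0 (U_iter H k)) &
      nilpotent_mx (dHdY H 0 (U_iter H m))].

Definition cvg_radius (R : realType) (a : nat -> Cplx R) : \bar R :=
  ereal_sup [set r%:E | r in
    [set r : R | 0 <= r /\ cvgn [series `|a n| * r%:C ^+ n]_n]].

Definition sys_radius (R : realType) m (y : 'I_m -> nat -> Cplx R) : \bar R :=
  \big[mine/+oo%E]_(j < m) cvg_radius (y j).

Definition gf_cvg (R : realType) m (y : 'I_m -> nat -> Cplx R) (z : Cplx R) : Prop :=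
  forall j, cvgn [series y j n * z ^+ n]_n.

Definition gf_eval (R : realType) m (y : 'I_m -> nat -> Cplx R) (z : Cplx R) :
    'rV[Cplx R]_m :=
  \row_j limn [series y j n * z ^+ n]_n.

Definition gf_solution (R : realType) m (H : system R m)
    (y : 'I_m -> nat -> Cplx R) : Prop :=
  [/\ (0 < sys_radius y)%E,
      \row_j y j 0%N = U_iter H m &
      \forall z \near (0 : Cplx R),
        cvg_domain H (zY_point z (gf_eval y z)) /\
        gf_eval y z = sys_eval H z (gf_eval y z)].

Definition zero_free (R : realType) m (y : 'I_m -> nat -> Cplx R) : Prop :=
  forall j, exists n, y j n != 0.

Definition recursive (R : realType) m (H : system R m) : Prop :=
  ~ nilpotent_on_domain H (dHdY H).

Definition depends (R : realType) m (H : system R m) (a b : 'I_m) : Prop :=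
  exists e, H a e != 0 /\ (0 < e (lshift 1 b))%N.

Definition strongly_connected (T : finType) (edge : T -> T -> Prop) : Prop :=
  forall a b : T, connect (fun a b => `[< edge a b >]) a b.

Definition irreducible_sys (R : realType) m (H : system R m) : Prop :=
  [/\ wellfounded H,
      exists2 y, gf_solution H y & zero_free y,
      recursive H &
      strongly_connected (depends H)].

(* The dimension is m = i + p: [lshift p] enumerates the first i coordinates
   and [rshift i] the last p ones. *)
Definition irreducible_component (R : realType) (i p : nat)
    (H : system R (i + p)) : Prop :=
  [/\ forall (a : 'I_i) (b : 'I_p), ~ depends H (lshift p a) (rshift i b),
      strongly_connected
        (fun a b : 'I_p => depends H (rshift i a) (rshift i b)) &
      ~ nilpotent_on_domain H (fun z Y => drsubmx (dHdY H z Y))].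

Definition char_system (R : realType) m (H : system R m)
    (x : 'rV[Cplx R]_(m + 1)) : 'rV[Cplx R]_(m + 1) :=
  let Y := lsubmx x in let z := rsubmx x 0 0 in
  row_mx (Y - sys_eval H z Y) (\det (1%:M - dHdY H z Y))%:M.

(* Again in row-vector form: the step h solves h *m jacobian F x = - F x. *)
Definition newton (R : realType) n (F : 'rV[Cplx R]_n -> 'rV[Cplx R]_n)
    (x : 'rV[Cplx R]_n) : 'rV[Cplx R]_n :=
  x - F x *m invmx (jacobian F x).

(* As [invmx] and [F] are total, being well defined is part of the claim: every
   iterate lies in the set D where F is meaningful, with invertible Jacobian. *)
Definition newton_cvg_quadratic (R : realType) n (D : set 'rV[Cplx R]_n)
    (F : 'rV[Cplx R]_n -> 'rV[Cplx R]_n) (a : 'rV[Cplx R]_n)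
    (V : set 'rV[Cplx R]_n) : Prop :=
  exists K : R, forall x0, V x0 ->
    let x := fun k : nat => iter k (newton F) x0 in
    [/\ forall k, D (x k) /\ jacobian F (x k) \in unitmx,
        x k @[k --> \oo] --> a &
        forall k, `|x k.+1 - a| <= K%:C * `|x k - a| ^+ 2].

(* Main.v *)
(* Write A = (rho, Y(rho)) and J for the Jacobian dH/dY at A, which is
   nonnegative.  For x >= 0 the solution value Y(x) is the least nonnegative
   supersolution H(x, Z) <= Z, and the existence of a supersolution at some
   x > rho would push the radius of convergence beyond rho.  This minimality is
   the only tool needed for the four facts below; each would otherwise yield a
   smaller supersolution at rho or one beyond rho.
   - det(1 - J) = 0, so A solves the characteristic system.
   - The kernels of 1 - J are lines.  The right one is spanned by a vector q
     that vanishes on the first block and is positive on the second; the left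
     one by a vector v positive on the second block.
   - v . dH/dz > 0, where Y(rho) > Y(0) must be seen through the first block
     if the second one does not involve z directly.
   - Some monomial of the second block has degree at least 2 in the unknowns of
     that block.
   By the last fact the derivative of det(1 - J) along (q, 0) is nonzero; with
   the third one this makes the Jacobian of the characteristic system at A
   invertible.  The system is C^1 with Lipschitz derivative near A, so Newton's
   iteration converges quadratically. *)

Require Import Defs.
From mathcomp Require Import all_boot all_order all_algebra.
From mathcomp Require Import complex ring lra.
From mathcomp Require Import all_classical all_reals all_analysis.
Import Order.TTheory GRing.Theory Num.Theory.
Import numFieldNormedType.Exports.
Local Open Scope classical_set_scope.
Local Open Scope ring_scope.
Local Open Scope complex_scope.

Set Implicit Arguments.
Unset Strict Implicit.
Unset Printing Implicit Defensive.

(** Minimality compares values, whereas the solution is given by coefficients at 0. The link: every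
    truncation of the solution is reached from 0 by finitely many steps Q -> Q' with Q' at most H(z,
    Q) coefficientwise. Indeed m steps build Y(0), and each later coefficient solves w = q + N w,
    where N is the Jacobian at (0, Y(0)); as N is nilpotent, iterating from 0 stops at the solution.
    A supersolution thus dominates all truncations, and convergence at its point comes as a
    conclusion. The same truncations carry the equation Y = H(z, Y) from a neighborhood of 0 to rho
    and, as an inequality, the first block beyond rho, where nothing places the point in the domain
    of convergence of H beforehand. Null vectors of 1 - J are complex a priori. Passing to moduli
    turns them into vectors with |u| <= J |u|, and it is on these that minimality acts. A null
    vector which cannot vanish at a coordinate of the second block spans the kernel, since a
    multiple of it cancels that coordinate of any other one. *)

(** * Limits and order in the complex field *)

Section ComplexLimits.
Variable R : realType.
Local Notation C := (Cplx R).

Lemma ge0_real (z : C) : 0 <= z -> exists2 r : R, 0 <= r & z = r%:C.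
Proof.
case: z => a b; rewrite lecE /= => /andP[/eqP b0 a0].
by exists a => //; rewrite b0.
Qed.

Lemma gt0_real (z : C) : 0 < z -> exists2 r : R, 0 < r & z = r%:C.
Proof.
case: z => a b; rewrite ltcE /= => /andP[/eqP b0 a0].
by exists a => //; rewrite b0.
Qed.

Lemma norm_complex_le (z : C) : `|z| <= (`|complex.Re z| + `|complex.Im z|)%:C.
Proof.
rewrite {1}[z]complexE.
apply: le_trans (ler_normD _ _) _; rewrite normrM !normc_def /= !expr0n /= expr1n.
by rewrite !(add0r, addr0) sqrtr1 mul1r !sqrtr_sqr -rmorphD.
Qed.

Lemma cvg_complex (u : nat -> C) (a b : R) :
  (fun n => complex.Re (u n)) @ \oo --> a ->
  (fun n => complex.Im (u n)) @ \oo --> b -> u @ \oo --> (a +i* b : C).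
Proof.
move=> ua ub; apply/cvgrPdist_le => e e0.
have [r r0 ->] := gt0_real e0.
have r2 : 0 < r / 2 by rewrite divr_gt0.
move/cvgrPdist_le : ua => /(_ _ r2) ua.
move/cvgrPdist_le : ub => /(_ _ r2) ub.
near=> n.
apply: le_trans (norm_complex_le _) _; rewrite lecR [leRHS]splitr lerD //.
  by rewrite raddfB; near: n.
by rewrite raddfB; near: n.
Unshelve. all: by end_near. Qed.

(** Reduces to monotone convergence in R. With f the real or the imaginary part, the increments of f
    u are at most those of v, so f u + Re v is nondecreasing and bounded, and f u is a difference of
    two bounded monotone sequences. *)
Lemma cvgn_dominated (u v : nat -> C) (B : C) :
  (forall M N, (M <= N)%N -> `|u N - u M| <= v N - v M) ->
  (forall N, v N <= B) -> cvgn u.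
Proof.
move=> uv vB.
have ub N : `|u N| <= `|u 0%N| + (B - v 0%N).
  rewrite -{1}[u N](subrK (u 0%N)) addrC; apply: le_trans (ler_normD _ _) _.
  by rewrite lerD2l; apply: le_trans (uv 0%N N isT) _; rewrite lerD2r.
have B0 : 0 <= `|u 0%N| + (B - v 0%N) by exact: le_trans (normr_ge0 (u 0%N)) (ub _).
have [b b0 Bb] := ge0_real B0.
have key (f : C -> R) : {morph f : x y / x - y} -> (forall z, `|f z|%:C <= `|z|) ->
    cvgn (fun n => f (u n)).
  move=> fB fn.
  have vR : cvgn (fun n => complex.Re (v n - v 0%N)).
    apply: nondecreasing_is_cvgn.
      move=> M N MN.
      have: 0 <= v N - v M by apply: le_trans (uv _ _ MN).
      by rewrite lecE => /andP[_]; rewrite !raddfB /= subr_ge0 => ?; rewrite lerD2r.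
    exists (complex.Re (B - v 0%N)) => _ [N _ <-].
    have: v N - v 0%N <= B - v 0%N by rewrite lerD2r.
    by rewrite lecE => /andP[].
  suff gR : cvgn (fun n => f (u n) + complex.Re (v n - v 0%N)).
    rewrite (_ : (fun n => f (u n)) = (fun n => f (u n) + complex.Re (v n - v 0%N))
      \- (fun n => complex.Re (v n - v 0%N))); first exact: is_cvgB.
    by apply/funext => n /=; rewrite addrK.
  apply: nondecreasing_is_cvgn.
    move=> M N MN; have := uv _ _ MN.
    move=> /(le_trans (fn _)); rewrite lecE => /andP[_ /=].
    rewrite fB ler_norml => /andP[+ _]; rewrite !raddfB /= => h.
    by lra.
  exists (b + complex.Re (B - v 0%N)) => _ [N _ <-].
  rewrite lerD //.
    apply: le_trans (ler_norm _) _.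
    by have := le_trans (fn _) (ub N); rewrite Bb lecR.
  have: v N - v 0%N <= B - v 0%N by rewrite lerD2r.
  by rewrite lecE => /andP[].
have /key : {morph (@complex.Re R : C -> R) : x y / x - y} by move=> x y; rewrite raddfB.
have /key : {morph (@complex.Im R : C -> R) : x y / x - y} by move=> x y; rewrite raddfB.
move=> hI hR; apply: cvgP; apply: cvg_complex.
- apply: hR => z; exact: normc_ge_Re.
- apply: hI => z; rewrite normc_def lecR -sqrtr_sqr ler_wsqrtr // lerDr; exact: sqr_ge0.
Qed.

(** A complex number is nonnegative exactly when it equals its norm, and this equation passes to the
    limit by continuity of the norm. *)
Lemma limn_ge0 (u : nat -> C) (l : C) : u @ \oo --> l ->
  (\forall n \near \oo, 0 <= u n) -> 0 <= l.
Proof.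
move=> ul u0.
suff -> : l = `|l| by [].
apply: (norm_cvg_unique ul).
apply: cvg_trans (cvg_norm ul); apply: near_eq_cvg.
by near=> n; rewrite ger0_norm //; near: n.
Unshelve. all: by end_near. Qed.

Lemma limn_le (u v : nat -> C) (k l : C) : u @ \oo --> k -> v @ \oo --> l ->
  (\forall n \near \oo, u n <= v n) -> k <= l.
Proof.
move=> uk vl uv; rewrite -subr_ge0; apply: (limn_ge0 (cvgB vl uk)).
by near=> n; rewrite /= subr_ge0; near: n.
Unshelve. all: by end_near. Qed.

End ComplexLimits.

(** A common interface for boxes of multi-indices and initial segments of nat, so that multiple and
    simple series share one theory of summation. *)
Record exhaustion (T : choiceType) := Exhaustion {
  chunk : nat -> seq T;
  chunk_uniq : forall N, uniq (chunk N);
  chunk_mono : forall M N, (M <= N)%N -> {subset chunk M <= chunk N};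
  chunk_exh : forall e, exists N, e \in chunk N }.

(** * Absolutely convergent families *)

Section Sums.
Variables (R : realType) (T : choiceType) (E : exhaustion T).
Local Notation C := (Cplx R).
Implicit Types u v : T -> C.

Definition psum u N : C := \sum_(e <- chunk E N) u e.
(** Absolute summability as a bound on finite sums, so that domination arguments involve no
    limit. *)
Definition summ u := exists B : C, forall N, psum (fun e => `|u e|) N <= B.
Definition Sum u : C := limn (psum u).

Lemma psum_subE u M N : (M <= N)%N ->
  psum u N = psum u M + \sum_(e <- chunk E N | e \notin chunk E M) u e.
Proof.
move=> MN; rewrite /psum (bigID (mem (chunk E M))) /=; congr (_ + _).
rewrite -big_filter; apply: perm_big; apply: uniq_perm.
- by rewrite filter_uniq ?chunk_uniq.
- exact: chunk_uniq.
- move=> e; rewrite mem_filter; apply: andb_idr; exact: chunk_mono.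
Qed.

Lemma psum_norm_sub u v M N : (M <= N)%N -> (forall e, `|u e| <= v e) ->
  `|psum u N - psum u M| <= psum v N - psum v M.
Proof.
move=> MN uv; rewrite !(psum_subE _ MN) !(addrC (psum _ M)) !addrK.
by apply: le_trans (ler_norm_sum _ _ _) _; apply: ler_sum.
Qed.

Lemma psum_mono u M N : (forall e, 0 <= u e) -> (M <= N)%N -> psum u M <= psum u N.
Proof.
by move=> u0 MN; rewrite (psum_subE _ MN) lerDl; apply: sumr_ge0.
Qed.

Lemma summ_dom u v : (forall e, `|u e| <= v e) -> summ v -> summ u.
Proof.
move=> uv [B vB]; exists B => N; apply: le_trans (vB N).
by apply: ler_sum => e _; apply: le_trans (uv e) _; exact: real_ler_norm (ger0_real (le_trans (normr_ge0 _) (uv e))).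
Qed.

Lemma summ_dom_norm u v : (forall e, `|u e| <= `|v e|) -> summ v -> summ u.
Proof.
by move=> uv [B vB]; exists B => N; apply: le_trans (vB N); apply: ler_sum => e _.
Qed.

Lemma summ_ge0P u : (forall e, 0 <= u e) ->
  summ u <-> exists B : C, forall N, psum u N <= B.
Proof.
move=> u0; have -> // : u = (fun e => `|u e|) by apply/funext => e; rewrite ger0_norm.
split=> -[B h]; exists B => N; have := h N; rewrite /psum.
  by under eq_bigr do rewrite normr_id.
by under [X in _ -> X <= _]eq_bigr do rewrite normr_id.
Qed.

Lemma summ_is_cvg u : summ u -> cvgn (psum u).
Proof.
move=> [B uB]; apply: (@cvgn_dominated _ _ (psum (fun e => `|u e|)) B) => // M N MN.
exact: psum_norm_sub.
Qed.

Lemma Sum_cvg u : summ u -> psum u @ \oo --> Sum u.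
Proof. by move=> /summ_is_cvg. Qed.

Lemma Sum_unique u (l : C) : psum u @ \oo --> l -> Sum u = l.
Proof. exact: norm_cvg_lim. Qed.

Lemma psum_le_cvg u (l : C) N : (forall e, 0 <= u e) -> psum u @ \oo --> l ->
  psum u N <= l.
Proof.
move=> u0 ul; apply: (limn_le (cvg_cst _ : (fun=> psum u N) @ \oo --> psum u N) ul).
by exists N => // M /= NM; exact: psum_mono.
Qed.

Lemma cvg_summ u : (forall e, 0 <= u e) -> cvgn (psum u) -> summ u.
Proof.
by move=> u0 cu; apply/(summ_ge0P u0); exists (limn (psum u)) => N; exact: psum_le_cvg.
Qed.

Lemma summP u : cvgn (psum (fun e => `|u e|)) <-> summ u.
Proof.
split=> [cu|[B uB]].
  by exists (limn (psum (fun e => `|u e|))) => N; apply: psum_le_cvg => // e.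
apply: summ_is_cvg; apply/summ_ge0P; [by []|by exists B].
Qed.

Lemma summD u v : summ u -> summ v -> summ (fun e => u e + v e).
Proof.
move=> [B uB] [B' vB]; exists (B + B') => N; apply: le_trans (lerD (uB N) (vB N)).
rewrite /psum -big_split /=; apply: ler_sum => e _; exact: ler_normD.
Qed.

Lemma summZ (k : C) u : summ u -> summ (fun e => k * u e).
Proof.
move=> [B uB]; exists (`|k| * B) => N; rewrite /psum.
under eq_bigr do rewrite normrM.
by rewrite -mulr_sumr; apply: ler_wpM2l => //; exact: uB.
Qed.

Lemma summN u : summ u -> summ (fun e => - u e).
Proof. by move=> [B uB]; exists B => N; apply: le_trans (uB N); apply: ler_sum => e _; rewrite normrN. Qed.

Lemma summB u v : summ u -> summ v -> summ (fun e => u e - v e).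
Proof. by move=> su sv; apply: summD => //; exact: summN. Qed.

Lemma summ0 : summ (fun=> 0).
Proof. by exists 0 => N; rewrite /psum big1 // => e _; rewrite normr0. Qed.

Lemma summ_sum (I : Type) (r : seq I) (P : pred I) (f : I -> T -> C) :
  (forall i, summ (f i)) -> summ (fun e => \sum_(i <- r | P i) f i e).
Proof.
move=> fs; elim: r => [|i r IH].
  by rewrite (_ : (fun _ => _) = (fun=> 0)); [exact: summ0|apply/funext => e; rewrite big_nil].
have [Pi|Pi] := boolP (P i).
  rewrite (_ : (fun _ => _) = (fun e => f i e + \sum_(i <- r | P i) f i e)).
    exact: summD.
  by apply/funext => e; rewrite big_cons Pi.
rewrite (_ : (fun _ => _) = (fun e => \sum_(i <- r | P i) f i e)) //.
by apply/funext => e; rewrite big_cons (negbTE Pi).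
Qed.

Lemma SumD u v : summ u -> summ v -> Sum (fun e => u e + v e) = Sum u + Sum v.
Proof.
move=> su sv; apply: Sum_unique.
rewrite (_ : psum _ = (fun N => psum u N + psum v N)); first by apply: cvgD; exact: Sum_cvg.
by apply/funext => N; rewrite /psum big_split.
Qed.

Lemma SumZ (k : C) u : summ u -> Sum (fun e => k * u e) = k * Sum u.
Proof.
move=> su; apply: Sum_unique.
rewrite (_ : psum _ = (fun N => k * psum u N)); first by apply: cvgMr; exact: Sum_cvg.
by apply/funext => N; rewrite /psum mulr_sumr.
Qed.

Lemma SumB u v : summ u -> summ v -> Sum (fun e => u e - v e) = Sum u - Sum v.
Proof.
move=> su sv; rewrite SumD //; last exact: summN.
congr (_ + _); rewrite -mulN1r -SumZ //; congr Sum.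
by apply/funext => e; rewrite mulN1r.
Qed.

Lemma Sum0 u : (forall e, u e = 0) -> Sum u = 0.
Proof.
move=> u0; apply: Sum_unique; rewrite (_ : psum u = (fun=> 0)); first exact: cvg_cst.
by apply/funext => N; rewrite /psum big1.
Qed.

Lemma Sum_sum (I : Type) (r : seq I) (P : pred I) (f : I -> T -> C) :
  (forall i, summ (f i)) ->
  Sum (fun e => \sum_(i <- r | P i) f i e) = \sum_(i <- r | P i) Sum (f i).
Proof.
move=> fs; elim: r => [|i r IH].
  by rewrite big_nil Sum0 // => e; rewrite big_nil.
rewrite big_cons -IH; have [Pi|Pi] := boolP (P i).
  rewrite -SumD //; last exact: summ_sum.
  by congr Sum; apply/funext => e; rewrite big_cons Pi.
by congr Sum; apply/funext => e; rewrite big_cons (negbTE Pi).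
Qed.

Lemma Sum_le u v : summ u -> summ v -> (forall e, u e <= v e) -> Sum u <= Sum v.
Proof.
move=> su sv uv; apply: (limn_le (Sum_cvg su) (Sum_cvg sv)).
by near=> N; apply: ler_sum.
Unshelve. all: by end_near. Qed.

Lemma Sum_norm_le u v : summ v -> (forall e, `|u e| <= v e) -> `|Sum u| <= Sum v.
Proof.
move=> sv uv; have su := summ_dom uv sv.
apply: (limn_le (cvg_norm (Sum_cvg su)) (Sum_cvg sv)).
near=> N; apply: le_trans (ler_norm_sum _ _ _) _; exact: ler_sum.
Unshelve. all: by end_near. Qed.

Lemma psum_le_Sum u N : (forall e, 0 <= u e) -> summ u -> psum u N <= Sum u.
Proof. by move=> u0 su; apply: psum_le_cvg => //; exact: Sum_cvg. Qed.

Lemma Sum_ge0 u : (forall e, 0 <= u e) -> summ u -> 0 <= Sum u.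
Proof. by move=> u0 su; apply: le_trans (psum_le_Sum 0 u0 su); apply: sumr_ge0. Qed.

Lemma Sum_ge1 u e : (forall e, 0 <= u e) -> summ u -> u e <= Sum u.
Proof.
move=> u0 su; have [N eN] := chunk_exh E e.
apply: le_trans (psum_le_Sum N u0 su); rewrite /psum (bigD1_seq e) ?chunk_uniq //=.
by rewrite lerDl; apply: sumr_ge0.
Qed.

Lemma Sum_le_bound u (B : C) : summ u -> (forall N, psum u N <= B) -> Sum u <= B.
Proof.
move=> su uB; apply: (limn_le (Sum_cvg su) (cvg_cst _ : (fun=> B) @ \oo --> B)).
by near=> N.
Unshelve. all: by end_near. Qed.

Lemma Sum_lt u v e : summ u -> summ v -> (forall e, u e <= v e) -> u e < v e ->
  Sum u < Sum v.
Proof.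
move=> su sv uv ltuv; rewrite -subr_gt0 -SumB //.
apply: lt_le_trans (Sum_ge1 e _ (summB sv su)) => [|x] /=; first by rewrite subr_gt0.
by rewrite subr_ge0.
Qed.

Lemma Sum_eq0 u e : (forall e, 0 <= u e) -> summ u -> Sum u = 0 -> u e = 0.
Proof. by move=> u0 su s0; apply/eqP; rewrite eq_le u0 -s0 Sum_ge1. Qed.

End Sums.

(** * Boxes of multi-indices and initial segments of nat *)

Section Boxes.
Variable n : nat.

Definition box (N : nat) : seq {ffun 'I_n -> nat} :=
  [seq [ffun j => nat_of_ord (b j)] | b : {ffun 'I_n -> 'I_N} <- enum {ffun 'I_n -> 'I_N}].

Lemma box_map_inj N :
  injective (fun b : {ffun 'I_n -> 'I_N} => [ffun j => nat_of_ord (b j)]).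
Proof.
by move=> b b' /ffunP bb'; apply/ffunP => j; apply: val_inj; have := bb' j; rewrite !ffunE.
Qed.

Lemma mem_box N e : (e \in box N) = [forall j, (e j < N)%N].
Proof.
apply/mapP/forallP => [[b _ -> j]|eN]; first by rewrite ffunE.
exists [ffun j => Ordinal (eN j)]; first by rewrite mem_enum.
by apply/ffunP => j; rewrite !ffunE.
Qed.

Lemma box_uniq N : uniq (box N).
Proof. by rewrite map_inj_uniq ?enum_uniq //; exact: box_map_inj. Qed.

Lemma box_mono M N : (M <= N)%N -> {subset box M <= box N}.
Proof.
move=> MN e; rewrite !mem_box => /forallP eM; apply/forallP => j.
exact: leq_trans (eM j) MN.
Qed.

Lemma box_exh e : exists N, e \in box N.
Proof.
exists (\max_j e j).+1; rewrite mem_box; apply/forallP => j.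
by rewrite ltnS; exact: leq_bigmax.
Qed.

Definition boxes := Exhaustion box_uniq box_mono box_exh.

Lemma box_sumE (R : realType) (u : {ffun 'I_n -> nat} -> Cplx R) :
  box_sum u = psum boxes u.
Proof. by apply/funext => N; rewrite /box_sum /psum /= big_map big_enum. Qed.

End Boxes.

Lemma iota_mono M N : (M <= N)%N -> {subset iota 0 M <= iota 0 N}.
Proof. by move=> MN k; rewrite !mem_iota /= => /leq_trans; apply. Qed.

Lemma iota_exh k : exists N, k \in iota 0 N.
Proof. by exists k.+1; rewrite mem_iota /=. Qed.

Definition initial_segments := Exhaustion (iota_uniq 0) iota_mono iota_exh.

Lemma series_psum (R : realType) (u : nat -> Cplx R) :
  [series u k]_k = psum initial_segments u.
Proof. by apply/funext => N; rewrite /series /psum /= /index_iota subn0. Qed.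

(** * The sup norm on row vectors *)

Section RowNorm.
Variables (R : realType) (n : nat).
Local Notation C := (Cplx R).

Lemma rv_norm_le (x : 'rV[C]_n) (b : C) : 0 <= b ->
  (forall j, `|x 0 j| <= b) -> `|x| <= b.
Proof.
move=> b0 xb; have -> : `|x| = mx_norm x by [].
rewrite mx_normE.
have [b' bE] : exists b' : {nonneg C}, b = b'%:num by exists (NngNum b0).
rewrite bE in b0 xb *.
rewrite num_le; apply/bigmax_leP; split=> [|[i j] _]; first by rewrite -num_le /=.
by rewrite -num_le /= (ord1 i) xb.
Qed.

Lemma coord_le_norm (x : 'rV[C]_n) j : `|x 0 j| <= `|x|.
Proof.
have -> : `|x| = mx_norm x by [].
rewrite mx_normE.
pose i : 'I_1 * 'I_n := (ord0, j).
have -> : `|x 0 j| = (`|x i.1 i.2|%:nng)%:num by [].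
rewrite num_le.
exact: (le_bigmax _ (fun i : 'I_1 * 'I_n => `|x i.1 i.2|%:nng : {nonneg C}) i).
Qed.

End RowNorm.

(** * First-order Taylor estimates for monomials *)

Section Jets.
Variables (R : realType) (n : nat).
Local Notation C := (Cplx R).
Local Notation idx := {ffun 'I_n -> nat}.
Implicit Types (x h a : 'rV[C]_n) (e : idx).

(** The predecessor is truncated: when [e j = 0] this is [e] itself, and the factor [(e j)%:R] of
    [dmon] cancels the term. *)
Definition dec (j : 'I_n) e : idx := [ffun k => if k == j then (e k).-1 else e k].

Definition dmon (j : 'I_n) x e : C := (e j)%:R * monomial x (dec j e).

Lemma dmonE j x e : dmon j x e =
  (e j)%:R * x 0 j ^+ (e j).-1 * \prod_(k < n | k != j) x 0 k ^+ e k.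
Proof.
rewrite /dmon /monomial (bigD1 j) //= ffunE eqxx mulrA; congr (_ * _).
by apply: eq_bigr => k /negbTE kj; rewrite ffunE kj.
Qed.

Section JetMonomial.
(** Any relation on first-order jets that is stable under the Leibniz product passes from the
    coordinates to the monomials. It is instantiated twice: by majorants, for Taylor estimates, and
    by sign conditions, for convexity. *)
Variable J : C -> C -> C -> C -> Prop.
Hypothesis J1 : J 1 1 0 1.
Hypothesis JM : forall A f0 f1 f2 B g0 g1 g2, J A f0 f1 f2 -> J B g0 g1 g2 ->
  J (A * B) (f0 * g0) (f1 * g0 + f0 * g1) (f2 * g2).

Lemma jet_exp A u v k : J A u v (u + v) ->
  J (A ^+ k) (u ^+ k) (k%:R * u ^+ k.-1 * v) ((u + v) ^+ k).
Proof.
move=> Juv; elim: k => [|k IH]; first by rewrite !expr0 !mul0r.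
have := JM Juv IH; rewrite -!exprS; congr (J _ _ _ _) => /=.
by rewrite -natr1; case: k {IH} => [|k] /=; rewrite ?mulr0n ?exprS; ring.
Qed.

Lemma jet_prod (I : eqType) (r : seq I) (A f0 f1 f2 : I -> C) : uniq r ->
  (forall i, J (A i) (f0 i) (f1 i) (f2 i)) ->
  J (\prod_(i <- r) A i) (\prod_(i <- r) f0 i)
    (\sum_(i <- r) f1 i * \prod_(k <- r | k != i) f0 k) (\prod_(i <- r) f2 i).
Proof.
move=> + Jf; elim: r => [|i r IH] /=; first by rewrite !big_nil.
move=> /andP[ir /IH{}IH].
have := JM (Jf i) IH; congr (J _ _ _ _); try by rewrite big_cons.
rewrite big_cons; congr (_ * _ + _).
  rewrite big_cons eqxx /= [LHS]big_seq_cond [RHS]big_seq_cond.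
  apply: eq_bigl => k; case: eqVneq => [->|] //=.
  by rewrite (negbTE ir).
rewrite mulr_sumr [LHS]big_seq [RHS]big_seq; apply: eq_bigr => k kr.
rewrite big_cons ifT 1?mulrCA //.
by apply: contraNneq ir => ->.
Qed.

Lemma jet_monomial a x h e : (forall j, J (a 0 j) (x 0 j) (h 0 j) (x 0 j + h 0 j)) ->
  J (monomial a e) (monomial x e) (\sum_j dmon j x e * h 0 j) (monomial (x + h) e).
Proof.
move=> Jx.
have := jet_prod (index_enum_uniq _) (fun j => jet_exp (e j) (Jx j)).
congr (J _ _ _ _).
- by apply: eq_bigr => j _; rewrite dmonE mulrAC.
- by apply: eq_bigr => j _; rewrite mxE.
Qed.

End JetMonomial.

(* Majorised jets: [f0] is a value, [f1] a first-order increment and [f2] the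
   value after the increment, whose Taylor remainder is O(s^2); the total mass
   of the majorants is multiplicative. *)
Definition maj (s A f0 f1 f2 : C) := exists a : C * C * C,
  [/\ 0 <= a.1.1 /\ `|f0| <= a.1.1, 0 <= a.1.2 /\ `|f1| <= s * a.1.2,
      0 <= a.2 /\ `|f2 - f0 - f1| <= s ^+ 2 * a.2 & a.1.1 + a.1.2 + a.2 = A].

Lemma maj1 s : 0 <= s -> maj s 1 1 0 1.
Proof.
move=> s0; exists (1, 0, 0) => /=; split; rewrite ?addr0 //; split => //.
- by rewrite normr1.
- by rewrite normr0 mulr0.
- by rewrite subrr subr0 normr0 mulr0.
Qed.

(** The nine products in (a0 + a1 + a2)(b0 + b1 + b2) are sorted by their order in s. Those of order
    three and four join the quadratic slot, which uses s <= 1. *)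
Lemma majM s A f0 f1 f2 B g0 g1 g2 : 0 <= s <= 1 -> maj s A f0 f1 f2 -> maj s B g0 g1 g2 ->
  maj s (A * B) (f0 * g0) (f1 * g0 + f0 * g1) (f2 * g2).
Proof.
move=> /andP[s0 s1] [[[a0 a1] a2] /= [[a00 fa0] [a10 fa1] [a20 fa2] <-]].
move=> [[[b0 b1] b2] /= [[b00 gb0] [b10 gb1] [b20 gb2] <-]].
exists (a0 * b0, a1 * b0 + a0 * b1, a0 * b2 + a1 * b1 + a1 * b2 + a2 * (b0 + b1 + b2)) => /=.
split; last by ring.
- by split; [rewrite mulr_ge0|rewrite normrM ler_pM].
- split; first by rewrite addr_ge0 ?mulr_ge0.
  apply: le_trans (ler_normD _ _) _; rewrite !normrM.
  rewrite (_ : s * _ = (s * a1) * b0 + a0 * (s * b1)); last by ring.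
  by rewrite lerD // ler_pM.
- split; first by rewrite !addr_ge0 ?mulr_ge0 ?addr_ge0.
  set p := f2 - f0 - f1 in fa2 *; set q := g2 - g0 - g1 in gb2 *.
  have -> : f2 * g2 - f0 * g0 - (f1 * g0 + f0 * g1) =
    f0 * q + f1 * g1 + f1 * q + p * (g0 + g1 + q).
    by rewrite /p /q; ring.
  have s2 : s ^+ 2 <= s by rewrite expr2 ler_piMl.
  have s20 : 0 <= s ^+ 2 by exact: exprn_ge0.
  have hq : `|q| <= b2 by apply: le_trans gb2 _; rewrite ler_piMl // exprn_ile1.
  have hq1 : `|q| <= s * b2 by apply: le_trans gb2 _; apply: ler_wpM2r.
  have hg1 : `|g1| <= b1 by apply: le_trans gb1 _; exact: ler_piMl.
  apply: le_trans (ler_normD _ _) _; apply: le_trans (lerD (ler_normD _ _) (lexx _)) _.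
  apply: le_trans (lerD (lerD (ler_normD _ _) (lexx _)) (lexx _)) _; rewrite !normrM.
  rewrite (_ : s ^+ 2 * _ = a0 * (s ^+ 2 * b2) + (s * a1) * (s * b1) +
     (s * a1) * (s * b2) + (s ^+ 2 * a2) * (b0 + b1 + b2)); last by ring.
  rewrite !lerD // ler_pM //.
  apply: le_trans (ler_normD _ _) _; rewrite lerD //.
  by apply: le_trans (ler_normD _ _) _; rewrite lerD.
Qed.

Lemma maj_var s r d u v : 0 <= s -> 0 <= d -> `|u| <= r -> `|v| <= s * d ->
  maj s (r + d) u v (u + v).
Proof.
move=> s0 d0 ur vd; exists (r, d, 0) => /=; split; rewrite ?addr0 //; split => //.
- exact: le_trans ur.
- by rewrite [u + v]addrC addrK subrr normr0 mulr0.
Qed.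

(** A variable has mass [a + d] and masses multiply, so the majorant is the monomial itself at
    enlarged radii. No factor depending on the degree appears, hence the estimate can be summed over
    all exponents. *)
Lemma maj_monomial s (d : C) a x h e : 0 <= s <= 1 -> 0 <= d ->
  (forall j, `|x 0 j| <= a 0 j) -> (forall j, `|h 0 j| <= s * d) ->
  maj s (monomial (a + const_mx d) e) (monomial x e) (\sum_j dmon j x e * h 0 j)
    (monomial (x + h) e).
Proof.
move=> s01 d0 xa hd; have /andP[s0 s1] := s01.
apply: (jet_monomial (J := maj s) (maj1 s0) (fun A f0 f1 f2 B g0 g1 g2 => majM s01)).
by move=> j; rewrite !mxE; exact: maj_var.
Qed.

Lemma monomial_ge0 x e : (forall j, 0 <= x 0 j) -> 0 <= monomial x e.
Proof. by move=> x0; apply: prodr_ge0 => j _; exact: exprn_ge0. Qed.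

Lemma monomial_gt0 x e : (forall j, 0 < x 0 j) -> 0 < monomial x e.
Proof. by move=> x0; apply: prodr_gt0 => j _; exact: exprn_gt0. Qed.

Lemma monomial_le x a e : (forall j, 0 <= x 0 j <= a 0 j) -> monomial x e <= monomial a e.
Proof.
move=> xa; apply: ler_prod => j _; have /andP[x0 xj] := xa j.
by rewrite exprn_ge0 //= lerXn2r // nnegrE // (le_trans x0).
Qed.

Lemma norm_monomial x e : `|monomial x e| = monomial (map_mx Num.norm x) e.
Proof.
by rewrite /monomial normr_prod; apply: eq_bigr => j _; rewrite mxE normrX.
Qed.

Lemma dmon_ge0 j x e : (forall k, 0 <= x 0 k) -> 0 <= dmon j x e.
Proof. by move=> x0; rewrite mulr_ge0 ?ler0n // monomial_ge0. Qed.

Lemma dmon_le j x a e : (forall k, 0 <= x 0 k <= a 0 k) -> dmon j x e <= dmon j a e.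
Proof. by move=> xa; rewrite ler_wpM2l ?ler0n // monomial_le. Qed.

(* The remainder of a product of jets is (f2 - f0)(g2 - g0) + r g0 + t f0 with r
   and t the remainders of the factors; it is nonnegative when all increments
   have the same sign [(-1) ^+ b]. *)
Definition cvx_jet (b : bool) (_ f0 f1 f2 : C) :=
  [/\ 0 <= f0, 0 <= f2, 0 <= (-1) ^+ b * (f2 - f0) & 0 <= f2 - f0 - f1].

Lemma cvx_jetM b A f0 f1 f2 B g0 g1 g2 : cvx_jet b A f0 f1 f2 -> cvx_jet b B g0 g1 g2 ->
  cvx_jet b (A * B) (f0 * g0) (f1 * g0 + f0 * g1) (f2 * g2).
Proof.
move=> [f00 f20 fb fr] [g00 g20 gb gr]; split; [exact: mulr_ge0|exact: mulr_ge0| |].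
  rewrite (_ : _ * _ = ((-1) ^+ b * (f2 - f0)) * g2 + f0 * ((-1) ^+ b * (g2 - g0))); last by ring.
  by apply: addr_ge0; apply: mulr_ge0.
rewrite (_ : _ - _ = ((-1) ^+ b * (f2 - f0)) * ((-1) ^+ b * (g2 - g0)) +
   (f2 - f0 - f1) * g0 + (g2 - g0 - g1) * f0).
  by apply: addr_ge0; first apply: addr_ge0; apply: mulr_ge0.
by case: b {fb gb}; rewrite ?expr0 ?expr1; ring.
Qed.

(** A product such as x y is not convex, but it is along increments of one sign. Upward increments
    serve for the first block beyond rho, downward ones for the passage from the critical point to
    the origin. *)
Lemma monomial_cvx (b : bool) x h e : (forall j, 0 <= x 0 j) ->
  (forall j, 0 <= x 0 j + h 0 j) -> (forall j, 0 <= (-1) ^+ b * h 0 j) ->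
  \sum_j dmon j x e * h 0 j <= monomial (x + h) e - monomial x e.
Proof.
move=> x0 xh0 h0.
have [] := @jet_monomial (cvx_jet b) _ (@cvx_jetM b) x x h e.
- by split; rewrite ?ler01 // !subrr ?mulr0 ?subr0.
- by move=> j; split; rewrite // [x 0 j + _]addrC addrK // subrr.
- by move=> _ _ _ rem0; rewrite -subr_ge0.
Qed.

End Jets.

(** * Power series are C^1 with Lipschitz gradient *)

Section GeneralSeries.
Variables (R : realType) (n : nat).
Local Notation C := (Cplx R).
Local Notation idx := {ffun 'I_n -> nat}.
Local Notation sm := (summ (boxes n)).
Local Notation SM := (Sum (boxes n)).
Implicit Types (x h a : 'rV[C]_n) (e : idx) (c : idx -> C) (sh : idx -> idx).

(* Power series with re-indexed monomials: unlike [ps_eval], this class of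
   functions is closed under termwise differentiation without shifting the
   summation index. *)
Definition gs c sh x : C := SM (fun e => c e * monomial x (sh e)).

Definition gsum c sh x := sm (fun e => c e * monomial x (sh e)).

Definition gc c sh (j : 'I_n) e : C := c e * (sh e j)%:R.
Definition gsh sh (j : 'I_n) e : idx := dec j (sh e).

Lemma gc_dmon c sh j x e :
  gc c sh j e * monomial x (gsh sh j e) = c e * dmon j x (sh e).
Proof. by rewrite /gc /gsh /dmon mulrA. Qed.

Lemma gsum_le c sh x a : (forall j, `|x 0 j| <= `|a 0 j|) -> gsum c sh a -> gsum c sh x.
Proof.
move=> xa [B aB]; exists B => N; apply: le_trans (aB N); apply: ler_sum => e _.
rewrite !normrM ler_wpM2l // !norm_monomial; apply: monomial_le => j.
by rewrite !mxE normr_ge0 xa.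
Qed.

Lemma gsum_norm c sh a : (forall j, 0 <= a 0 j) -> gsum c sh a ->
  sm (fun e => `|c e| * monomial a (sh e)).
Proof.
move=> a0 [B aB]; exists B => N; apply: le_trans (aB N); apply: ler_sum => e _.
by rewrite !normrM normr_id.
Qed.

(** A Cauchy estimate: with s = 1 and the increment d along the j-th axis, the first-order term d *
    [dmon j a e] is at most the full mass, the monomial at a + d. *)
Lemma gsum_grad c sh a (d : C) j : (forall j, 0 <= a 0 j) -> 0 < d ->
  gsum c sh (a + const_mx d) -> gsum (gc c sh j) (gsh sh j) a.
Proof.
move=> a0 d0 H.
have ad0 k : 0 <= (a + const_mx d) 0 k by rewrite !mxE addr_ge0 // ltW.
suff: sm (fun e => d^-1 * (`|c e| * monomial (a + const_mx d) (sh e))).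
  apply: summ_dom => e; rewrite gc_dmon normrM mulrCA ler_wpM2l // mulrC ler_pdivlMr //.
  have [] := @maj_monomial _ _ 1 d a a (d *: delta_mx 0 j) (sh e) _ (ltW d0).
  - by rewrite ler01 lexx.
  - by move=> k; rewrite ger0_norm.
  - move=> k; rewrite !mxE mul1r eqxx /=; case: eqP => _.
      by rewrite mulr1 ger0_norm // ltW.
    by rewrite mulr0 normr0 ltW.
  move=> [[a0' a1] a2] /= [[a00 _] [a10 ha1] [a20 _] <-].
  have sE : \sum_k dmon k a (sh e) * (d *: delta_mx 0 j : 'rV_n) 0 k = dmon j a (sh e) * d.
    rewrite (bigD1 j) //= big1 ?addr0 => [|k /negbTE kj].
      by rewrite mxE [X in _ * (_ * X)]mxE !eqxx mulr1.
    by rewrite mxE [X in _ * (_ * X)]mxE kj andbF !mulr0.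
  have dj0 := dmon_ge0 j (sh e) a0.
  rewrite (ger0_norm dj0); move: ha1; rewrite sE mul1r.
  rewrite (ger0_norm (mulr_ge0 dj0 (ltW d0))) => /le_trans; apply.
  by rewrite -addrA addrCA lerDl addr_ge0.
exact/summZ/gsum_norm.
Qed.

(** [maj_monomial] summed over the exponents. The majorant does not involve s, so one K serves for
    the value, the increment and the remainder. *)
Lemma gs_taylor c sh a (d : C) x h (s : C) : (forall j, `|x 0 j| <= a 0 j) -> 0 < d ->
  gsum c sh (a + const_mx d) -> 0 <= s <= 1 -> (forall j, `|h 0 j| <= s * d) ->
  let K := SM (fun e => `|c e| * monomial (a + const_mx d) (sh e)) in
  [/\ `|gs c sh x| <= K, `|gs c sh (x + h) - gs c sh x| <= s * K &
   `|gs c sh (x + h) - gs c sh x - \sum_j h 0 j * gs (gc c sh j) (gsh sh j) x| <= s ^+ 2 * K].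
Proof.
move=> xa d0 H s01 hd K; have /andP[s0 s1] := s01.
have a0 j : 0 <= a 0 j by apply: le_trans (xa j).
have ad0 k : 0 <= (a + const_mx d) 0 k by rewrite !mxE addr_ge0 // ltW.
have HK := gsum_norm ad0 H.
have sx : gsum c sh x.
  apply: gsum_le H => j; rewrite [leRHS]ger0_norm // !mxE; apply: le_trans (xa j) _.
  by rewrite lerDl ltW.
have sxh : gsum c sh (x + h).
  apply: gsum_le H => j; rewrite [leRHS]ger0_norm // !mxE; apply: le_trans (ler_normD _ _) _.
  by rewrite lerD // (le_trans (hd j)) // ler_piMl // ltW.
have sg j : gsum (gc c sh j) (gsh sh j) x.
  apply: (@gsum_le _ _ x a) => [k|]; first by rewrite (ger0_norm (a0 k)).
  exact: gsum_grad d0 H.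
have M e := maj_monomial (sh e) s01 (ltW d0) xa hd.
have gE : \sum_j h 0 j * gs (gc c sh j) (gsh sh j) x =
    SM (fun e => c e * \sum_j dmon j x (sh e) * h 0 j).
  rewrite (_ : (fun e => _) =
      (fun e => \sum_j h 0 j * (gc c sh j e * monomial x (gsh sh j e)))).
    rewrite Sum_sum; last by move=> j; exact: (summZ _ (sg j)).
    by apply: eq_bigr => j _; rewrite (SumZ _ (sg j)).
  apply/funext => e; rewrite mulr_sumr; apply: eq_bigr => j _.
  by rewrite gc_dmon mulrA mulrC.
have sG : sm (fun e => c e * \sum_j dmon j x (sh e) * h 0 j).
  rewrite (_ : (fun e => _) =
      (fun e => \sum_j h 0 j * (gc c sh j e * monomial x (gsh sh j e)))).
    by apply: summ_sum => j; exact: (summZ _ (sg j)).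
  apply/funext => e; rewrite mulr_sumr; apply: eq_bigr => j _.
  by rewrite gc_dmon mulrA mulrC.
split.
- apply: Sum_norm_le => // e; rewrite normrM ler_wpM2l //.
  have [[[A0 A1] A2] /= [[A00 H0] [A10 H1] [A20 H2] <-]] := M e.
  by apply: le_trans H0 _; rewrite -addrA lerDl addr_ge0.
- rewrite -SumB // /K -SumZ //; apply: Sum_norm_le; first exact: summZ.
  move=> e; rewrite -mulrBr normrM mulrCA ler_wpM2l //.
  have [[[A0 A1] A2] /= [[A00 H0] [A10 H1] [A20 H2] <-]] := M e.
  rewrite -[X in `|X|](subrK (\sum_j dmon j x (sh e) * h 0 j)).
  apply: le_trans (ler_normD _ _) _; apply: le_trans (lerD H2 H1) _.
  have s2 : s ^+ 2 * A2 <= s * A2 by rewrite ler_wpM2r // expr2 ler_piMl.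
  apply: le_trans (lerD s2 (lexx _)) _; rewrite -mulrDr ler_wpM2l //.
  by rewrite addrC -addrA lerDr.
- rewrite gE -SumB // -SumB //; last exact: summB.
  rewrite /K -SumZ //; apply: Sum_norm_le; first exact: summZ.
  move=> e; rewrite -!mulrBr normrM mulrCA ler_wpM2l //.
  have [[[A0 A1] A2] /= [[A00 H0] [A10 H1] [A20 H2] <-]] := M e.
  apply: le_trans H2 _; rewrite ler_wpM2l ?exprn_ge0 //.
  by rewrite lerDr addr_ge0.
Qed.

(* [C11 f g a]: near [a], [f] has gradient [g], with a quadratic Taylor
   remainder that is uniform in the base point, and [g] is Lipschitz. *)
Definition C11 (f : 'rV[C]_n -> C) (g : 'rV[C]_n -> 'I_n -> C) a :=
  exists (d : R) (K : C), [/\ 0 < d, 0 <= K & forall x x', `|x - a| <= d%:C -> `|x' - a| <= d%:C ->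
   [/\ `|f x| <= K, forall j, `|g x j| <= K,
       `|f x' - f x - \sum_j (x' - x) 0 j * g x j| <= K * `|x' - x| ^+ 2 &
       forall j, `|g x' j - g x j| <= K * `|x' - x| ]].

Lemma gs_C11 c sh a (d : C) : 0 < d ->
  gsum c sh (map_mx Num.norm a + const_mx d) ->
  C11 (gs c sh) (fun x j => gs (gc c sh j) (gsh sh j) x) a.
Proof.
move=> d0 H; have [r r0 dE] := gt0_real d0; subst d.
(* The margin is cut in four: one quarter bounds the base points by [b], one leaves room for the
   increment, and two pay for the convergence of the derivative series. *)
pose q := r / 4; have q0 : 0 < q by rewrite divr_gt0.
have q0C : 0 < q%:C :> C by rewrite ltcR.
pose b : 'rV[C]_n := map_mx Num.norm a + const_mx q%:C.
have b0 j : 0 <= b 0 j by rewrite !mxE addr_ge0 // ltW.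
have rE : r%:C = q%:C + q%:C + q%:C + q%:C :> C by rewrite -!rmorphD /q; congr _%:C; field.
have H2 : gsum c sh ((b + const_mx q%:C) + const_mx (q%:C + q%:C)).
  congr gsum: H; apply/matrixP => i j; rewrite !mxE rE; ring.
have bq0 j : 0 <= (b + const_mx q%:C) 0 j by rewrite mxE [X in _ + X]mxE addr_ge0 // ltW.
have Hf : gsum c sh (b + const_mx q%:C).
  apply: gsum_le H2 => j; rewrite !ger0_norm //.
    by rewrite [leRHS]mxE lerDl mxE addr_ge0 // ltW.
  by rewrite mxE addr_ge0 // mxE addr_ge0 // ltW.
have Hg j : gsum (gc c sh j) (gsh sh j) (b + const_mx q%:C).
  by apply: gsum_grad H2 => //; rewrite addr_gt0.
pose K0 := SM (fun e => `|c e| * monomial (b + const_mx q%:C) (sh e)).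
pose Kg j := SM (fun e => `|gc c sh j e| * monomial (b + const_mx q%:C) (gsh sh j e)).
have K00 : 0 <= K0.
  apply: Sum_ge0 => [e|]; first by rewrite mulr_ge0 // monomial_ge0.
  exact: gsum_norm.
have Kg0 j : 0 <= Kg j.
  apply: Sum_ge0 => [e|]; first by rewrite mulr_ge0 // monomial_ge0.
  exact: gsum_norm.
pose L := K0 + \sum_j Kg j.
have LK0 : K0 <= L by rewrite lerDl sumr_ge0.
have LKg j : Kg j <= L.
  by rewrite /L (bigD1 j) //= addrCA lerDl addr_ge0 // sumr_ge0.
have L0 : 0 <= L by exact: le_trans LK0.
(* Two points within q / 2 of a differ by at most q. The three summands of the constant come from s
   = |h| / q, which enters with the powers 0, 1 and 2. *)
exists (q / 2), (L * (1 + q%:C^-1 + q%:C^-1 ^+ 2)); split.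
- by rewrite divr_gt0.
- by rewrite mulr_ge0 // !addr_ge0 // ?exprn_ge0 // invr_ge0 ltW.
move=> x x' xa x'a.
have q2 : (q / 2)%:C + (q / 2)%:C = q%:C :> C by rewrite -rmorphD /=; congr _%:C; field.
have q2q : (q / 2)%:C <= q%:C :> C.
  by rewrite -q2 lerDl lecR divr_ge0 // ltW.
have xb j : `|x 0 j| <= b 0 j.
  have -> : b 0 j = `|a 0 j| + q%:C by rewrite !mxE.
  rewrite -[x 0 j](subrK (a 0 j)) addrC.
  apply: le_trans (ler_normD _ _) _; rewrite lerD2l.
  have := coord_le_norm (x - a) j; rewrite !mxE => /le_trans; apply.
  exact: le_trans xa q2q.
set h := x' - x.
have hq : `|h| <= q%:C.
  have -> : h = (x' - a) - (x - a) by rewrite /h opprB addrA subrK.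
  by apply: le_trans (ler_normB _ _) _; rewrite -q2 lerD.
have x'E : x' = x + h by rewrite /h addrC subrK.
pose s := `|h| / q%:C.
have s01 : 0 <= s <= 1.
  by rewrite /s divr_ge0 ?(ltW q0C) //= ler_pdivrMr // mul1r.
have hs j : `|h 0 j| <= s * q%:C.
  by rewrite /s divfK ?gt_eqF //; exact: coord_le_norm.
have [f1 f2 f3] := gs_taylor xb q0C Hf s01 hs.
have key (k : C) : k <= L ->
   [/\ k <= L * (1 + q%:C^-1 + q%:C^-1 ^+ 2),
       s * k <= L * (1 + q%:C^-1 + q%:C^-1 ^+ 2) * `|h| &
       s ^+ 2 * k <= L * (1 + q%:C^-1 + q%:C^-1 ^+ 2) * `|h| ^+ 2].
  move=> kL; have qi0 : 0 <= q%:C^-1 :> C by rewrite invr_ge0 ltW.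
  have [s0 _] := andP s01; split.
  - apply: le_trans kL _; rewrite ler_peMr // -addrA lerDl addr_ge0 // exprn_ge0 //.
  - apply: le_trans (ler_wpM2l s0 kL) _.
    rewrite /s (_ : `|h| / q%:C * L = L * q%:C^-1 * `|h|); last by ring.
    rewrite ler_wpM2r // ler_wpM2l // addrAC lerDr addr_ge0 // exprn_ge0 //.
  - apply: le_trans (ler_wpM2l (exprn_ge0 2 s0) kL) _.
    rewrite /s (_ : (`|h| / q%:C) ^+ 2 * L = L * q%:C^-1 ^+ 2 * `|h| ^+ 2); last by ring.
    by rewrite ler_wpM2r ?exprn_ge0 // ler_wpM2l // lerDr addr_ge0.
have [k1 k2 k3] := key _ LK0.
split.
- exact: le_trans f1 k1.
- move=> j; have [g1 _ _] := gs_taylor xb q0C (Hg j) s01 hs.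
  by apply: le_trans g1 _; have [] := key _ (LKg j).
- by rewrite x'E; apply: le_trans f3 k3.
- move=> j; have [_ g1 _] := gs_taylor xb q0C (Hg j) s01 hs.
  by rewrite x'E; apply: le_trans g1 _; have [] := key _ (LKg j).
Qed.

End GeneralSeries.

(** * Sums, products, determinants and uniqueness of gradients *)

Section C11Calculus.
Variables (R : realType) (n : nat).
Local Notation C := (Cplx R).
Implicit Types (f : 'rV[C]_n -> C) (g : 'rV[C]_n -> 'I_n -> C) (a : 'rV[C]_n).

Lemma C11_cst (k : C) a : C11 (fun=> k) (fun _ _ => 0) a.
Proof.
exists 1, `|k|; split => // x x' _ _; split => //.
- by move=> j; rewrite normr0.
- by rewrite subrr big1 ?subrr ?normr0 ?mulr_ge0 ?exprn_ge0 // => j _; rewrite mulr0.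
- by move=> j; rewrite subrr normr0 mulr_ge0.
Qed.

Lemma C11_coord (i : 'I_n) a : C11 (fun x => x 0 i) (fun _ j => (j == i)%:R) a.
Proof.
exists 1, (`|a| + 1); split; rewrite ?addr_ge0 // => x x' xa x'a; split.
- rewrite -[x 0 i](subrK (a 0 i)) addrC; apply: le_trans (ler_normD _ _) _.
  rewrite lerD ?coord_le_norm //; apply: le_trans xa.
  by have := coord_le_norm (x - a) i; rewrite !mxE.
- by move=> j; apply: le_trans (_ : 1 <= _); [case: eqP => _; rewrite ?normr1 ?normr0|rewrite lerDr].
- rewrite (bigD1 i) //= big1 => [|j /negbTE ->]; last by rewrite mulr0.
  by rewrite eqxx mulr1 addr0 !mxE subrr normr0 mulr_ge0 ?exprn_ge0 ?addr_ge0.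
- by move=> j; rewrite subrr normr0 mulr_ge0 ?addr_ge0.
Qed.

Lemma C11_near_eq f f' g a (d : R) : 0 < d ->
  (forall x, `|x - a| <= d%:C -> f' x = f x) -> C11 f g a -> C11 f' g a.
Proof.
move=> d0 ff' [r [K [r0 K0 H]]]; exists (Num.min d r), K; split=> //.
  by rewrite lt_min d0.
have md : (Num.min d r)%:C <= d%:C by rewrite lecR ge_min lexx.
have mr : (Num.min d r)%:C <= r%:C by rewrite lecR ge_min lexx orbT.
move=> x x' xa x'a; rewrite (ff' x) ?(ff' x') ?(le_trans xa) ?(le_trans x'a) //.
by apply: H; [exact: le_trans xa _|exact: le_trans x'a _].
Qed.

Lemma C11_lip f g a : C11 f g a -> exists (d : R) (K : C), [/\ 0 < d, 0 <= K &
  forall x x', `|x - a| <= d%:C -> `|x' - a| <= d%:C -> `|f x' - f x| <= K * `|x' - x|].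
Proof.
move=> [d [K [d0 K0 H]]]; exists d, (K * (d%:C + d%:C) + n%:R * K); split=> //.
  by rewrite addr_ge0 ?mulr_ge0 ?addr_ge0 ?ler0n // ler0c ltW.
move=> x x' xa x'a; have [_ gK fT _] := H _ _ xa x'a.
rewrite -[X in `|X|](subrK (\sum_j (x' - x) 0 j * g x j)).
apply: le_trans (ler_normD _ _) _; rewrite mulrDl lerD //.
  apply: le_trans fT _; rewrite expr2 mulrA ler_wpM2r // ler_wpM2l //.
  rewrite (_ : x' - x = (x' - a) - (x - a)); last by rewrite opprB addrA subrK.
  by apply: le_trans (ler_normB _ _) _; rewrite lerD.
apply: le_trans (ler_norm_sum _ _ _) _; rewrite -mulrA -[n in n%:R]card_ord.
rewrite mulr_natl -sumr_const; apply: ler_sum => j _.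
by rewrite normrM mulrC ler_pM // coord_le_norm.
Qed.

Lemma C11D f g f' g' a : C11 f g a -> C11 f' g' a ->
  C11 (fun x => f x + f' x) (fun x j => g x j + g' x j) a.
Proof.
move=> [d [K [d0 K0 H]]] [d' [K' [d'0 K'0 H']]].
exists (Num.min d d'), (K + K'); split.
- by rewrite lt_min d0.
- exact: addr_ge0.
move=> x x' xa x'a.
have md : (Num.min d d')%:C <= d%:C by rewrite lecR ge_min lexx.
have md' : (Num.min d d')%:C <= d'%:C by rewrite lecR ge_min lexx orbT.
have [h1 h2 h3 h4] := H _ _ (le_trans xa md) (le_trans x'a md).
have [k1 k2 k3 k4] := H' _ _ (le_trans xa md') (le_trans x'a md').
split.
- by apply: le_trans (ler_normD _ _) _; rewrite lerD.
- by move=> j; apply: le_trans (ler_normD _ _) _; rewrite lerD.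
- under eq_bigr do rewrite mulrDr.
  rewrite big_split /= mulrDl; apply: le_trans (lerD h3 k3); rewrite -[leRHS]ger0_norm ?addr_ge0 //.
  rewrite [leRHS]ger0_norm ?addr_ge0 //; apply: le_trans (ler_normD _ _).
  by rewrite le_eqVlt; apply/orP; left; apply/eqP; congr `|_|; ring.
- move=> j; rewrite mulrDl; apply: le_trans (lerD (h4 j) (k4 j)).
  apply: le_trans (ler_normD _ _).
  by rewrite le_eqVlt; apply/orP; left; apply/eqP; congr `|_|; ring.
Qed.

Lemma C11M f g f' g' a : C11 f g a -> C11 f' g' a ->
  C11 (fun x => f x * f' x) (fun x j => g x j * f' x + f x * g' x j) a.
Proof.
move=> Cf Cf'; have [e [L [e0 L0 HL]]] := C11_lip Cf; have [e' [L' [e'0 L'0 HL']]] := C11_lip Cf'.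
move: Cf Cf' => [d [K [d0 K0 H]]] [d' [K' [d'0 K'0 H']]].
(* The four summands of the constant bound, in this order, the value, the gradient, the Taylor
   remainder and the variation of the gradient of the product. *)
exists (Num.min (Num.min d d') (Num.min e e')),
  (K * K' + (K * K' + K * K') + (K * K' + K * K' + L * L') + (K * K' + K * L' + (L * K' + K * K'))); split.
- by rewrite !lt_min d0 d'0 e0.
- by rewrite !addr_ge0 ?mulr_ge0.
move=> x x'; set m := (Num.min _ _)%:C => xa x'a.
have md : m <= d%:C by rewrite lecR !ge_min lexx.
have md' : m <= d'%:C by rewrite lecR !ge_min lexx !orbT.
have me : m <= e%:C by rewrite lecR !ge_min lexx !orbT.
have me' : m <= e'%:C by rewrite lecR !ge_min lexx !orbT.
have [h1 h2 h3 h4] := H _ _ (le_trans xa md) (le_trans x'a md).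
have [k1 k2 k3 k4] := H' _ _ (le_trans xa md') (le_trans x'a md').
have [h1' h2' _ _] := H _ _ (le_trans x'a md) (le_trans xa md).
have [k1' _ _ _] := H' _ _ (le_trans x'a md') (le_trans xa md').
have l1 := HL _ _ (le_trans xa me) (le_trans x'a me).
have l2 := HL' _ _ (le_trans xa me') (le_trans x'a me').
have KK0 : 0 <= K * K' by rewrite mulr_ge0.
have LL0 : 0 <= L * L' by rewrite mulr_ge0.
have KL0 : 0 <= K * L' by rewrite mulr_ge0.
have LK0 : 0 <= L * K' by rewrite mulr_ge0.
have pos (A B D E : C) : 0 <= A -> 0 <= B -> 0 <= D -> 0 <= E ->
   [/\ A <= A + B + D + E, B <= A + B + D + E, D <= A + B + D + E & E <= A + B + D + E].
  move=> A0 B0 D0 E0; split.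
  - by rewrite -!addrA lerDl !addr_ge0.
  - by rewrite [A + B]addrC -!addrA lerDl !addr_ge0.
  - by rewrite [A + B + D]addrC -!addrA lerDl !addr_ge0.
  - by rewrite lerDr !addr_ge0.
have [||||p1 p2 p3 p4] := pos (K * K') (K * K' + K * K') (K * K' + K * K' + L * L')
   (K * K' + K * L' + (L * K' + K * K')); rewrite ?addr_ge0 //.
split.
- by apply: le_trans p1; rewrite normrM ler_pM.
- move=> j; apply: le_trans p2; apply: le_trans (ler_normD _ _) _.
  by rewrite !normrM lerD // ler_pM.
- apply: le_trans (_ : _ <= (K * K' + K * K' + L * L') * `|x' - x| ^+ 2) _; last first.
    by rewrite ler_wpM2r ?exprn_ge0.
  set D := f x' - f x in h3 l1; set D' := f' x' - f' x in k3 l2.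
  set S := \sum_j _ in h3; set S' := \sum_j _ in k3.
  have -> : \sum_j (x' - x) 0 j * (g x j * f' x + f x * g' x j) = S * f' x + f x * S'.
    rewrite /S /S' mulr_suml mulr_sumr -big_split /=; apply: eq_bigr => j _; ring.
  have -> : f x' * f' x' - f x * f' x - (S * f' x + f x * S') =
    (D - S) * f' x + f x * (D' - S') + D * D' by rewrite /D /D'; ring.
  apply: le_trans (ler_normD _ _) _; rewrite [leRHS]mulrDl; apply: lerD; last first.
    by rewrite normrM (_ : L * L' * _ = (L * `|x' - x|) * (L' * `|x' - x|)) ?ler_pM //; ring.
  apply: le_trans (ler_normD _ _) _; rewrite [leRHS]mulrDl !normrM; apply: lerD.
    by rewrite [leRHS]mulrAC ler_pM.
  by rewrite -[leRHS]mulrA ler_pM.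
- move=> j; apply: le_trans (_ : _ <= (K * K' + K * L' + (L * K' + K * K')) * `|x' - x|) _; last first.
    by rewrite ler_wpM2r.
  have -> : g x' j * f' x' + f x' * g' x' j - (g x j * f' x + f x * g' x j) =
    (g x' j - g x j) * f' x + g x' j * (f' x' - f' x) + ((f x' - f x) * g' x j + f x' * (g' x' j - g' x j)) by ring.
  apply: le_trans (ler_normD _ _) _; rewrite [leRHS]mulrDl; apply: lerD.
    apply: le_trans (ler_normD _ _) _; rewrite [leRHS]mulrDl !normrM; apply: lerD.
      by rewrite [leRHS]mulrAC ler_pM.
    by rewrite -[leRHS]mulrA ler_pM.
  apply: le_trans (ler_normD _ _) _; rewrite [leRHS]mulrDl !normrM; apply: lerD.
    by rewrite [leRHS]mulrAC ler_pM.
  by rewrite -[leRHS]mulrA ler_pM.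
Qed.

Lemma C11Z (k : C) f g a : C11 f g a -> C11 (fun x => k * f x) (fun x j => k * g x j) a.
Proof.
move=> Cf; have := C11M (C11_cst k a) Cf.
by congr C11; apply/funext => x; apply/funext => j; rewrite mul0r add0r.
Qed.

Lemma C11_sum (I : Type) (r : seq I) (F : I -> 'rV[C]_n -> C)
    (G : I -> 'rV[C]_n -> 'I_n -> C) a : (forall i, C11 (F i) (G i) a) ->
  C11 (fun x => \sum_(i <- r) F i x) (fun x j => \sum_(i <- r) G i x j) a.
Proof.
move=> H; elim: r => [|i r IH].
  have := C11_cst 0 a; congr C11; first by apply/funext => x; rewrite big_nil.
  by apply/funext => x; apply/funext => j; rewrite big_nil.
have := C11D (H i) IH; congr C11; first by apply/funext => x; rewrite big_cons.
by apply/funext => x; apply/funext => j; rewrite big_cons.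
Qed.

(** The gradient is left unspecified: for determinants and cofactors its existence is enough, and
    the one directional derivative that matters is computed by [det_direction]. *)
Definition smooth f a := exists g, C11 f g a.

Lemma smooth_cst k a : smooth (fun=> k) a.
Proof. by eexists; exact: C11_cst. Qed.

Lemma smoothM f f' a : smooth f a -> smooth f' a -> smooth (fun x => f x * f' x) a.
Proof. by move=> [g H] [g' H']; eexists; exact: C11M H H'. Qed.

Lemma smooth_sum (I : Type) (r : seq I) (F : I -> 'rV[C]_n -> C) a :
  (forall i, smooth (F i) a) -> smooth (fun x => \sum_(i <- r) F i x) a.
Proof.
move=> /(_ _)/cid H; have [G HG] : {G | forall i, C11 (F i) (G i) a}.
  by exists (fun i => sval (H i)) => i; exact: svalP (H i).
by eexists; exact: C11_sum HG.
Qed.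

Lemma smooth_prod (I : Type) (r : seq I) (F : I -> 'rV[C]_n -> C) a :
  (forall i, smooth (F i) a) -> smooth (fun x => \prod_(i <- r) F i x) a.
Proof.
move=> H; elim: r => [|i r IH].
  by have := smooth_cst 1 a; congr smooth; apply/funext => x; rewrite big_nil.
by have := smoothM (H i) IH; congr smooth; apply/funext => x; rewrite big_cons.
Qed.

Lemma smooth_det k (M : 'rV[C]_n -> 'M[C]_k) a :
  (forall i j, smooth (fun x => M x i j) a) -> smooth (fun x => \det (M x)) a.
Proof.
move=> H; apply: smooth_sum => s; apply: smoothM; first exact: smooth_cst.
by apply: smooth_prod => i.
Qed.

Lemma smooth_cofactor k (M : 'rV[C]_n -> 'M[C]_k) (i j : 'I_k) a :
  (forall i j, smooth (fun x => M x i j) a) -> smooth (fun x => cofactor (M x) i j) a.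
Proof.
move=> H; apply: smoothM; first exact: smooth_cst.
apply: smooth_det => i' j'; have := H (lift i i') (lift j j').
by congr smooth; apply/funext => x; rewrite !mxE.
Qed.

(** The zero function f - f has gradient g - g', so its first-order term along t times a unit vector
    is O(t^2). This converts an identity between functions into one between gradients. *)
Lemma C11_unique f g g' a : C11 f g a -> C11 f g' a -> g a = g' a.
Proof.
move=> Cf Cf'; have := C11D Cf (C11Z (-1) Cf') => -[d [K [d0 K0 H]]].
apply/funext => j; apply/eqP; rewrite -subr_eq0; apply/eqP.
have [k k0 KE] := ge0_real K0.
set l := g a j - g' a j.
have key (t : R) : 0 < t -> t <= d -> `|l| <= (k * t)%:C.
  move=> t0 td; pose h : 'rV[C]_n := t%:C *: delta_mx 0 j.
  have hn : `|h| <= t%:C.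
    apply: rv_norm_le => [|i]; first by rewrite ler0c ltW.
    rewrite !mxE eqxx /=; case: eqP => _; rewrite ?mulr1 ?mulr0 ?normr0 ?ler0c ?(ltW t0) //.
    by rewrite ger0_norm // ler0c ltW.
  have [||_ _ T _] := H a (a + h).
  - by rewrite subrr normr0 ler0c ltW.
  - by rewrite addrC addKr; apply: le_trans hn _; rewrite lecR.
  move: T; rewrite [a + h]addrC addrK !mulN1r !subrr sub0r normrN (bigD1 j) //= big1.
    rewrite mulN1r addr0 /h mxE [X in (_ * X) * _]mxE !eqxx mulr1 normrM -/h -/l => T.
    have t0C : 0 < t%:C :> C by rewrite ltcR.
    rewrite -(ler_pM2l t0C) -{1}(gtr0_norm t0C); apply: le_trans T _.
    have -> : t%:C * (k * t)%:C = k%:C * t%:C ^+ 2 :> C by rewrite rmorphM /=; ring.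
    by rewrite KE ler_wpM2l ?ler0c // lerXn2r // nnegrE // ltW.
  by move=> i /negbTE ij; rewrite /h mxE [X in (_ * X) * _]mxE ij andbF mulr0 mul0r.
have [r r0 rE] := ge0_real (normr_ge0 l).
apply/eqP; rewrite -normr_le0 rE lecR; apply/ler_addgt0Pr => e e0; rewrite add0r.
pose t := Num.min d (e / (k + 1)).
have k1 : 0 < k + 1 by rewrite ltr_wpDl.
have t0 : 0 < t by rewrite lt_min d0 divr_gt0.
have := key t t0; rewrite ge_min lexx rE lecR => /(_ isT) /le_trans; apply.
apply: (@le_trans _ _ (k * (e / (k + 1)))); first by rewrite ler_wpM2l // ge_min lexx orbT.
by rewrite mulrCA ler_piMr ?(ltW e0) // ler_pdivrMr // mul1r lerDl.
Qed.

End C11Calculus.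

(** * Newton's iteration *)

Section Newton.
Variables (R : realType).
Local Notation C := (Cplx R).

Lemma norm_mulmx_le n k (h : 'rV[C]_n) (M : 'M[C]_(n, k)) :
  `|h *m M| <= (\sum_j \sum_l `|M j l|) * `|h|.
Proof.
apply: rv_norm_le => [|l].
  by rewrite mulr_ge0 // !sumr_ge0 // => j _; rewrite sumr_ge0.
rewrite mxE mulr_suml; apply: le_trans (ler_norm_sum _ _ _) _; apply: ler_sum => j _.
rewrite normrM mulrC ler_pM // ?coord_le_norm // (bigD1 l) //= lerDl.
by rewrite sumr_ge0.
Qed.

Lemma jacobian_eq n k (F : 'rV[C]_n -> 'rV[C]_k) (G : 'M[C]_(n, k)) (x : 'rV[C]_n) (d : R) (K : C) :
  0 < d -> 0 <= K ->
  (forall h : 'rV[C]_n, `|h| <= d%:C -> `|F (x + h) - F x - h *m G| <= K * `|h| ^+ 2) ->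
  jacobian F x = G.
Proof.
move=> d0 K0 H; have [k0 k00 KE] := ge0_real K0.
have cont : continuous (mulmxr G : 'rV[C]_n -> 'rV[C]_k).
  apply: bounded_linear_continuous; apply/linear_boundedP.
  have S0 : 0 <= \sum_j \sum_l `|G j l| by rewrite !sumr_ge0 // => j _; rewrite sumr_ge0.
  exists (\sum_j \sum_l `|G j l|); split; first exact: ger0_real.
  move=> r Sr h; apply: le_trans (norm_mulmx_le h G) _.
  by rewrite ler_wpM2r // ltW.
have dE : 'd F x = mulmxr G :> ('rV[C]_n -> 'rV[C]_k).
  apply: diff_unique => //; apply/eqaddoP => e e0.
  have [r r0 rE] := gt0_real e0.
  have k1 : 0 < k0 + 1 by rewrite ltr_wpDl.
  pose t := Num.min d (r / (k0 + 1)).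
  have t0 : 0 < t by rewrite lt_min d0 divr_gt0.
  have t0C : 0 < t%:C :> C by rewrite ltcR.
  near=> h.
  have ht : `|h| <= t%:C by near: h; exact: (@nbhs0_le C 'rV[C]_n t%:C t0C).
  have hd : `|h| <= d%:C by apply: le_trans ht _; rewrite lecR ge_min lexx.
  rewrite !fctE /= opprD addrA [h + x]addrC.
  apply: le_trans (H h hd) _; rewrite expr2 mulrA ler_wpM2r //.
  apply: le_trans (ler_wpM2l K0 ht) _; rewrite KE rE -rmorphM lecR.
  apply: (@le_trans _ _ (k0 * (r / (k0 + 1)))); first by rewrite ler_wpM2l // ge_min lexx orbT.
  by rewrite mulrCA ler_piMr ?(ltW r0) // ler_pdivrMr // mul1r lerDl.
by apply/matrixP => i j; rewrite /jacobian mxE dE /= -rowE mxE.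
Unshelve. all: by end_near. Qed.

Lemma C11_family n k (f : 'I_k -> 'rV[C]_n -> C) (g : 'I_k -> 'rV[C]_n -> 'I_n -> C) a :
  (forall i, C11 (f i) (g i) a) ->
  exists (d : R) (K : C), [/\ 0 < d, 0 <= K & forall i x x', `|x - a| <= d%:C -> `|x' - a| <= d%:C ->
   `|f i x' - f i x - \sum_j (x' - x) 0 j * g i x j| <= K * `|x' - x| ^+ 2 /\
       forall j, `|g i x' j - g i x j| <= K * `|x' - x| ].
Proof.
elim: k f g => [|k IH] f g H; first by exists 1, 0; split=> // -[].
have [d [K [d0 K0 HK]]] := IH _ _ (fun i => H (lift ord0 i)).
have [e [L [e0 L0 HL]]] := H ord0.
exists (Num.min d e), (K + L); split; [by rewrite lt_min d0|exact: addr_ge0|].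
move=> i x x'; set m := (Num.min d e)%:C => xa x'a.
have md : m <= d%:C by rewrite lecR ge_min lexx.
have me : m <= e%:C by rewrite lecR ge_min lexx orbT.
have KK : K <= K + L by rewrite lerDl.
have LL : L <= K + L by rewrite lerDr.
case: (unliftP ord0 i) => [i' ->|->].
  have [h1 h2] := HK i' _ _ (le_trans xa md) (le_trans x'a md); split=> [|j].
    by apply: le_trans h1 _; rewrite ler_wpM2r ?exprn_ge0.
  by apply: le_trans (h2 j) _; rewrite ler_wpM2r.
have [_ _ h1 h2] := HL _ _ (le_trans xa me) (le_trans x'a me); split=> [|j].
  by apply: le_trans h1 _; rewrite ler_wpM2r ?exprn_ge0.
by apply: le_trans (h2 j) _; rewrite ler_wpM2r.
Qed.

(** Rows are variables and columns are components, matching the row-vector convention of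
    [jacobian]. *)
Definition grad_mx n k (g : 'I_k -> 'rV[C]_n -> 'I_n -> C) (x : 'rV[C]_n) : 'M[C]_(n, k) :=
  \matrix_(j, i) g i x j.

Lemma C11_family_mx n k (F : 'rV[C]_n -> 'rV[C]_k) (g : 'I_k -> 'rV[C]_n -> 'I_n -> C) a :
  (forall i, C11 (fun x => F x 0 i) (g i) a) ->
  exists (d : R) (K : C), [/\ 0 < d, 0 <= K & forall x x', `|x - a| <= d%:C -> `|x' - a| <= d%:C ->
   `|F x' - F x - (x' - x) *m grad_mx g x| <= K * `|x' - x| ^+ 2 /\
     \sum_j \sum_i `|(grad_mx g x' - grad_mx g x) j i| <= K * `|x' - x| ].
Proof.
move=> H; have [d [K [d0 K0 HK]]] := C11_family H.
exists d, (K + \sum_(j < n) \sum_(i < k) K); split=> //.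
  by rewrite addr_ge0 // !sumr_ge0 // => j _; rewrite sumr_ge0.
move=> x x' xa x'a; split.
  apply: (@le_trans _ _ (K * `|x' - x| ^+ 2)); last first.
    rewrite ler_wpM2r ?exprn_ge0 // lerDl.
    by rewrite !sumr_ge0 // => j _; rewrite sumr_ge0.
  apply: rv_norm_le => [|i]; first by rewrite mulr_ge0 ?exprn_ge0.
  have [h _] := HK i _ _ xa x'a; move: h; rewrite !mxE; congr (`| _ - _ | <= _).
  by apply: eq_bigr => j _; rewrite !mxE.
rewrite mulrDl ler_wpDl ?mulr_ge0 // mulr_suml; apply: ler_sum => j _.
rewrite mulr_suml; apply: ler_sum => i _.
by have [_ h] := HK i _ _ xa x'a; rewrite !mxE.
Qed.

Lemma C11_jacobian n k (F : 'rV[C]_n -> 'rV[C]_k) (g : 'I_k -> 'rV[C]_n -> 'I_n -> C) a :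
  (forall i, C11 (fun x => F x 0 i) (g i) a) ->
  exists2 d : R, 0 < d & forall x, `|x - a| <= d%:C -> jacobian F x = grad_mx g x.
Proof.
move=> H; have [d [K [d0 K0 HK]]] := C11_family_mx H.
exists (d / 2); first by rewrite divr_gt0.
have d2 : (d / 2)%:C + (d / 2)%:C = d%:C :> C by rewrite -rmorphD /=; congr _%:C; field.
have d2d : (d / 2)%:C <= d%:C :> C by rewrite -d2 lerDl ler0c divr_ge0 // ltW.
move=> x xa; apply: (@jacobian_eq _ _ _ _ _ (d / 2) K) => //; first by rewrite divr_gt0.
move=> h hd; have [||+ _] := HK x (x + h).
- exact: le_trans xa d2d.
- by rewrite addrAC -d2; apply: le_trans (ler_normD _ _) _; rewrite lerD.
- by rewrite [x + h]addrC addrK.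
Qed.

(** With G the gradient matrix, (newton x - a) G(x) = F(a) - F(x) - (a - x) G(x), a Taylor remainder
    based at the moving point x; this is why remainders must be uniform in the base point. A lower
    bound on G(x), uniform near a, turns this into the quadratic estimate. *)
Theorem newton_converges n (D : set 'rV[C]_n) (F : 'rV[C]_n -> 'rV[C]_n)
    (g : 'I_n -> 'rV[C]_n -> 'I_n -> C) a :
  nbhs a D -> F a = 0 -> (forall i, C11 (fun x => F x 0 i) (g i) a) ->
  grad_mx g a \in unitmx ->
  exists2 V : set 'rV[C]_n, nbhs a V & newton_cvg_quadratic D F a V.
Proof.
move=> /nbhs_normP[_ /gt0_real[e e0 ->] eD] Fa0 H Gu.
have [d1 [K [d10 K0 HK]]] := C11_family_mx H.
have [d2 d20 HJ] := C11_jacobian H.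
set G := grad_mx g in Gu HK HJ.
pose c0 := \sum_j \sum_l `|invmx (G a) j l|.
have c00 : 0 <= c0 by rewrite !sumr_ge0 // => j _; rewrite sumr_ge0.
have [c c_0 cE] := ge0_real c00.
have [k k_0 kE] := ge0_real K0.
pose L := 2 * c * k.
have L0 : 0 <= L by rewrite !mulr_ge0.
have L1 : 0 < 2 * (L + 1) by rewrite mulr_gt0 // ltr_wpDl.
(* The bounds d1 and d2 make the Taylor estimates and the formula for the Jacobian available, e / 2
   keeps the ball inside D, and the last bound turns the quadratic estimate into a halving of the
   error; L + 1 guards against L = 0. *)
pose r := Num.min (Num.min d1 d2) (Num.min (e / 2) (2 * (L + 1))^-1).
have r0 : 0 < r by rewrite !lt_min d10 d20 divr_gt0 // invr_gt0.
have rd1 : r%:C <= d1%:C :> C by rewrite lecR !ge_min lexx.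
have rd2 : r%:C <= d2%:C :> C by rewrite lecR !ge_min lexx !orbT.
have re : r%:C < e%:C :> C.
  rewrite ltcR; apply: le_lt_trans (_ : e / 2 < e); first by rewrite !ge_min lexx !orbT.
  by rewrite ltr_pdivrMr // ltr_pMr // ltr1n.
have rL : L%:C * r%:C <= (2^-1)%:C :> C.
  rewrite -rmorphM lecR; apply: (@le_trans _ _ (L * (2 * (L + 1))^-1)).
    by rewrite ler_wpM2l // !ge_min lexx !orbT.
  by rewrite ler_pdivrMr //; lra.
have aa : `|a - a| <= d1%:C :> C by rewrite subrr normr0 ler0c ltW.
(* On the ball, h G(x) and h G(a) differ by at most K r |h|, and c times this is at most half of
   |h|. The bound gives both the invertibility of G(x) and the estimate of a Newton step. *)
have est (x h : 'rV[C]_n) : `|x - a| <= r%:C -> `|h| <= (2 * c)%:C * `|h *m G x|.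
  move=> xa.
  have hE : h = (h *m G x - h *m (G x - G a)) *m invmx (G a).
    by rewrite mulmxBr opprB addrCA subrr addr0 mulmxK.
  have h1 : `|h| <= c%:C * (`|h *m G x| + K * r%:C * `|h|).
    rewrite {1}hE; apply: le_trans (norm_mulmx_le _ _) _; rewrite -/c0 cE.
    rewrite ler_wpM2l ?ler0c //; apply: le_trans (ler_normB _ _) _; rewrite lerD2l.
    apply: le_trans (norm_mulmx_le _ _) _; rewrite ler_wpM2r //.
    have [_ h2] := HK a x aa (le_trans xa rd1).
    by apply: le_trans h2 _; rewrite ler_wpM2l.
  have hE2 : c%:C * (K * r%:C * `|h|) <= (2^-1)%:C / 2 * `|h| + (2^-1)%:C / 2 * `|h|.
    rewrite -mulrDl -splitr !mulrA ler_wpM2r //.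
    apply: le_trans rL; rewrite kE -!rmorphM lecR ler_wpM2r ?(ltW r0) // /L.
    rewrite -mulrA ler_peMl ?mulr_ge0 //; lra.
  move: h1; rewrite mulrDr => /le_trans /(_ (lerD (lexx _) hE2)).
  rewrite -mulrDl -splitr -lerBlDr -{1}[`|h|]mul1r -mulrBl => h1.
  have E : (1 - (2^-1)%:C) = (2^-1)%:C :> C by rewrite -[1]/(1%:C) -rmorphB; congr _%:C; field.
  move: h1; rewrite E => h1; rewrite rmorphM /= -mulrA.
  rewrite (_ : `|h| = 2%:C * ((2^-1)%:C * `|h|)); last first.
    by rewrite mulrA -rmorphM /= divff ?mul1r // pnatr_eq0.
  by rewrite ler_wpM2l // ler0c.
have Gxu (x : 'rV[C]_n) : `|x - a| <= r%:C -> G x \in unitmx.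
  move=> xa; rewrite unitmxE unitfE; apply/negP => /det0P[h h0 hG].
  have := est x h xa; rewrite hG normr0 mulr0 normr_le0 => /eqP hz.
  by rewrite hz eqxx in h0.
have step (x : 'rV[C]_n) : `|x - a| <= r%:C -> `|newton F x - a| <= L%:C * `|x - a| ^+ 2.
  move=> xa; apply: le_trans (est x _ xa) _.
  have [h _] := HK x a (le_trans xa rd1) aa.
  rewrite /newton HJ ?(le_trans xa) // mulmxBl mulmxBl mulmxKV ?Gxu //.
  rewrite /L !rmorphM /= -[X in _ <= X]mulrA ler_wpM2l ?mulr_ge0 ?ler0c //.
  rewrite -kE -(distrC a).
  by move: h; rewrite Fa0 sub0r mulmxBl opprB addrCA addrA.
have LrC (x : 'rV[C]_n) : `|x - a| <= r%:C -> L%:C * `|x - a| ^+ 2 <= (2^-1)%:C * `|x - a|.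
  move=> xa; rewrite expr2 mulrA ler_wpM2r //; apply: le_trans rL.
  by rewrite ler_wpM2l // ler0c.
have half1 : (2^-1)%:C <= 1 :> C by rewrite (_ : 1 = 1%:C) // lecR invf_le1 // ler1n.
have iter_in (x0 : 'rV[C]_n) : `|x0 - a| <= r%:C -> forall j,
   `|iter j (newton F) x0 - a| <= ((2^-1) ^+ j)%:C * r%:C /\ `|iter j (newton F) x0 - a| <= r%:C.
  move=> x0a; elim => [|j [IH1 IH2]]; first by rewrite expr0 mul1r.
  have h := le_trans (step _ IH2) (LrC _ IH2); split.
    apply: le_trans h _; rewrite exprS rmorphM /= -mulrA ler_wpM2l // ler0c invr_ge0 //.
  by apply: le_trans h _; apply: le_trans IH2; rewrite ler_piMl.
exists [set x | `|x - a| <= r%:C].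
  apply: (iffRL (@nbhs_normP C 'rV[C]_n a _)); exists r%:C => /=; first by rewrite ltcR.
  by move=> x; rewrite /= distrC => /ltW.
exists L => x0 x0a /=; split.
- move=> j; have [_ xa] := iter_in x0 x0a j; split.
    by apply: eD; rewrite /= distrC; apply: le_lt_trans xa re.
  by rewrite HJ ?Gxu // (le_trans xa).
- apply/cvgrPdist_le => _ /gt0_real[t t0 ->].
  have := @cvg_geometric R r (2^-1); rewrite ger0_norm ?invr_ge0 // invf_lt1 // ltr1n => /(_ isT).
  move/cvgrPdist_le => /(_ t t0); apply: filterS => j /=.
  rewrite sub0r normrN ger0_norm ?mulr_ge0 ?(ltW r0) ?exprn_ge0 ?invr_ge0 // => rt.
  rewrite distrC; have [h _] := iter_in x0 x0a j; apply: le_trans h _.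
  by rewrite -rmorphM lecR mulrC.
- by move=> j; have [_ xa] := iter_in x0 x0a j; exact: step.
Qed.

End Newton.

(** * Derivative of a determinant at a singular matrix *)

Section DetDirection.
Variables (R : realType) (n k : nat).
Local Notation C := (Cplx R).

(* Since [adj M * (M u) = det M * u], the derivative of [det M] at a singular
   matrix, in a direction moving [M u] by [w], is governed by the determinant
   of [M] with one column replaced by [w]. *)
Lemma det_direction (M : 'rV[C]_n -> 'M[C]_k)
    (gM : 'I_k -> 'I_k -> 'rV[C]_n -> 'I_n -> C) (gd : 'rV[C]_n -> 'I_n -> C)
    (a d : 'rV[C]_n) (u w : 'cV[C]_k) (v : 'rV[C]_k) (j0 : 'I_k) :
  (forall i j, C11 (fun x => M x i j) (gM i j) a) ->
  C11 (fun x => \det (M x)) gd a ->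
  M a *m u = 0 -> u j0 0 != 0 ->
  (forall i, w i 0 = \sum_b (\sum_j d 0 j * gM i b a j) * u b 0) ->
  v *m M a = 0 -> (forall x, x *m M a = 0 -> exists c, x = c *: v) ->
  v *m w != 0 ->
  \sum_j d 0 j * gd a j != 0.
Proof.
move=> HM Hd Mu uj0 wE vM vker vw.
(* The gradients of the cofactors remain unknown: at a they are multiplied by the entries of M a *m
   u, which vanish. *)
have [gc Hc] : exists gc, forall i, C11 (fun x => cofactor (M x) i j0) (gc i) a.
  have Hs i : smooth (fun x => cofactor (M x) i j0) a.
    by apply: smooth_cofactor => i' j'; exists (gM i' j').
  by exists (fun i => sval (cid (Hs i))) => i; exact: svalP (cid (Hs i)).
have L := C11Z (u j0 0) Hd.
have Rt := C11_sum (index_enum 'I_k) (fun i => C11M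
  (C11_sum (index_enum 'I_k) (fun b => C11Z (u b 0) (HM i b))) (Hc i)).
have E : (fun x => u j0 0 * \det (M x)) =
   (fun x => \sum_i (\sum_b u b 0 * M x i b) * cofactor (M x) i j0).
  apply/funext => x.
  have : (\adj (M x) *m (M x *m u)) j0 0 = u j0 0 * \det (M x).
    by rewrite mulmxA mul_adj_mx mul_scalar_mx mxE mulrC.
  move=> <-; rewrite mxE; apply: eq_bigr => i _; rewrite !mxE mulrC; congr (_ * _).
  by apply: eq_bigr => b _; rewrite mulrC.
rewrite E in L; have := C11_unique L Rt => {L Rt E} gE.
pose K := \matrix_(i, j) if j == j0 then w i 0 else M a i j.
have Kc i : cofactor K i j0 = cofactor (M a) i j0.
  rewrite /cofactor; congr (_ * \det _); apply/matrixP => i' j'; rewrite !mxE.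
  by rewrite ifN // eq_sym neq_lift.
have dE : u j0 0 * \sum_j d 0 j * gd a j = \det K.
  rewrite (expand_det_col K j0) mulr_sumr.
  transitivity (\sum_j d 0 j * \sum_i (\sum_b u b 0 * gM i b a j) * cofactor (M a) i j0).
    apply: eq_bigr => j _; rewrite mulrCA; congr (_ * _).
    have /= -> := congr1 (fun f => f j) gE; apply: eq_bigr => i _.
    have -> : \sum_b u b 0 * M a i b = (M a *m u) i 0.
      by rewrite mxE; apply: eq_bigr => b _; rewrite mulrC.
    by rewrite Mu mxE mul0r addr0.
  under eq_bigr do rewrite mulr_sumr.
  rewrite exchange_big /=; apply: eq_bigr => i _; rewrite Kc mxE eqxx wE mulr_suml.
  under [RHS]eq_bigr do rewrite mulr_suml mulr_suml.
  rewrite exchange_big /=; apply: eq_bigr => j _; rewrite mulr_suml mulr_sumr.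
  by apply: eq_bigr => b _; ring.
(* A left null vector x of K satisfies x w = 0 and kills the columns of M a other than j0. Since M a
   u = 0 with u nonzero at j0, it kills that column too, so x is a multiple of v, against v w !=
   0. *)
have K0 : \det K != 0.
  apply/negP => /det0P[x x0 xK].
  have xw : x *m w = 0.
    apply/matrixP => i1 j1; rewrite !ord1 [RHS]mxE.
    have h : (x *m K) 0 j0 = 0 by rewrite xK mxE.
    by rewrite -[RHS]h !mxE; apply: eq_bigr => i _; rewrite mxE eqxx.
  have xM j : j != j0 -> (x *m M a) 0 j = 0.
    move=> /negbTE jj0; have h : (x *m K) 0 j = 0 by rewrite xK mxE.
    by rewrite -[RHS]h !mxE; apply: eq_bigr => i _; rewrite mxE jj0.
  have xM0 : x *m M a = 0.
    apply/rowP => j; rewrite [RHS]mxE; case: (eqVneq j j0) => [->|]; last exact: xM.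
    have : (x *m M a *m u) 0 0 = 0 by rewrite -mulmxA Mu mulmx0 mxE.
    rewrite mxE (bigD1 j0) //= big1 ?addr0 => [/eqP|j' jj]; last by rewrite xM // mul0r.
    by rewrite mulf_eq0 (negbTE uj0) orbF => /eqP.
  have [c xc] := vker _ xM0; move: xw; rewrite xc -scalemxAl => /eqP.
  rewrite scaler_eq0 (negbTE vw) orbF => /eqP c0.
  by move: x0; rewrite xc c0 scale0r eqxx.
by apply: contraNneq K0 => d0; rewrite -dE d0 mulr0.
Qed.

End DetDirection.

(** * Reduction to a nondegeneracy condition *)

Section Systems.
Variables (R : realType) (m : nat) (H : system R m).
Local Notation C := (Cplx R).
Local Notation D := (cvg_domain H).
Implicit Types x a : 'rV[C]_(m + 1).

Lemma ps_cvg_absE (c : ps R (m + 1)) x : ps_cvg_abs c x <-> gsum c id x.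
Proof. by rewrite /ps_cvg_abs box_sumE; exact: summP. Qed.

Lemma ps_evalE (c : ps R (m + 1)) x : ps_eval c x = gs c id x.
Proof. by rewrite /ps_eval box_sumE. Qed.

Lemma nbhs_closed_ball n (a : 'rV[C]_n) (A : set 'rV[C]_n) (r : R) : 0 < r ->
  (forall x : 'rV[C]_n, `|x - a| <= r%:C -> A x) -> nbhs a A.
Proof.
move=> r0 rA; apply: (iffRL (@nbhs_normP C 'rV[C]_n a _)).
exists r%:C => /=; first by rewrite ltcR.
by move=> x; rewrite /= distrC => /ltW; exact: rA.
Qed.

Lemma nbhs_has_ball n (a : 'rV[C]_n) (A : set 'rV[C]_n) : nbhs a A ->
  exists2 r : R, 0 < r & forall x : 'rV[C]_n, `|x - a| <= r%:C -> A x.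
Proof.
move=> /(iffLR (@nbhs_normP C 'rV[C]_n a _))[_ /gt0_real[e e0 ->] eA].
exists (e / 2) => [|x xa]; first by rewrite divr_gt0.
apply: eA; rewrite /= distrC; apply: le_lt_trans xa _.
by rewrite ltcR ltr_pdivrMr // ltr_pMr // ltr1n.
Qed.

(** Absolute convergence depends on the moduli only, so membership in the interior amounts to
    convergence at the moduli enlarged by some d, the form in which the series estimates take it. *)
Lemma domP a : D a <-> exists2 d : R, 0 < d &
  forall k, gsum (H k) id (map_mx Num.norm a + const_mx d%:C).
Proof.
split=> [/nbhs_has_ball[d d0 dA]|[d d0 dH]].
  exists d => // k.
  (* Each coordinate is pushed outwards along its own phase, taken to be 1 at a zero coordinate, so
     that its modulus grows by exactly d. *)
  pose a' : 'rV[C]_(m + 1) :=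
    \row_j (a 0 j + d%:C * (if a 0 j == 0 then 1 else a 0 j / `|a 0 j|)).
  have aa : `|a' - a| <= d%:C.
    apply: rv_norm_le => [|j]; first by rewrite ler0c ltW.
    rewrite !mxE [a 0 j + _]addrC addrK normrM ger0_norm ?ler0c ?(ltW d0) //.
    case: eqP => [_|/eqP aj]; first by rewrite normr1 mulr1.
    by rewrite normrM normfV normr_id divff ?mulr1 // normr_eq0.
  have /ps_cvg_absE := dA _ aa k; apply: gsum_le => j.
  have -> : `|a' 0 j| = `|a 0 j| + d%:C.
    rewrite !mxE; case: eqP => [->|/eqP aj].
      by rewrite add0r normr0 add0r mulr1 ger0_norm // ler0c ltW.
    rewrite (_ : _ + _ = (a 0 j / `|a 0 j|) * (`|a 0 j| + d%:C)).
      rewrite normrM normrM normfV normr_id divff ?normr_eq0 // mul1r ger0_norm //.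
      by rewrite addr_ge0 // ler0c ltW.
    by rewrite mulrDr divfK ?normr_eq0 // [in RHS]mulrC.
  by rewrite !mxE ger0_norm // addr_ge0 // ler0c ltW.
apply: (nbhs_closed_ball d0) => x xa /= k; apply/ps_cvg_absE; apply: gsum_le (dH k) => j.
rewrite [leRHS]ger0_norm; last by rewrite !mxE addr_ge0 // ler0c ltW.
rewrite !mxE -[x 0 j](subrK (a 0 j)) addrC; apply: le_trans (ler_normD _ _) _.
rewrite lerD2r; apply: le_trans xa.
by have := coord_le_norm (x - a) j; rewrite !mxE.
Qed.

Definition pH (k : 'I_m) (j : 'I_(m + 1)) x : C := gs (gc (H k) id j) (gsh id j) x.

Definition ppH (k : 'I_m) (j l : 'I_(m + 1)) x : C :=
  gs (gc (gc (H k) id j) (gsh id j) l) (gsh (gsh id j) l) x.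

(** The series form of [dHdY]. The two agree on the domain of convergence, where the entries of this
    one are [C11]. *)
Definition JH x : 'M[C]_m := \matrix_(a, b) pH a (lshift 1 b) x.

Lemma dom_gsum a k : D a -> gsum (H k) id a.
Proof.
move=> /domP[d d0 dH]; apply: gsum_le (dH k) => j; rewrite [leRHS]ger0_norm !mxE.
  by rewrite lerDl ler0c ltW.
by rewrite addr_ge0 // ler0c ltW.
Qed.

Lemma dom_gsum_grad a k j : D a ->
  exists2 d : R, 0 < d & gsum (gc (H k) id j) (gsh id j) (map_mx Num.norm a + const_mx d%:C).
Proof.
move=> /domP[d d0 dH]; exists (d / 2); first by rewrite divr_gt0.
have d20 : 0 < (d / 2)%:C :> C by rewrite ltcR divr_gt0.
apply: (gsum_grad _ _ d20) => [l|]; first by rewrite !mxE addr_ge0 // ltW.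
have dE : d%:C = (d / 2)%:C + (d / 2)%:C :> C by rewrite -rmorphD; congr _%:C; field.
by have := dH k; congr gsum; apply/matrixP => i l; rewrite !mxE dE addrA.
Qed.

Lemma dom_gsum1 a k j : D a -> gsum (gc (H k) id j) (gsh id j) a.
Proof.
move=> /(dom_gsum_grad k j)[d d0]; apply: gsum_le => l; rewrite [leRHS]ger0_norm !mxE.
  by rewrite lerDl ler0c ltW.
by rewrite addr_ge0 // ler0c ltW.
Qed.

Lemma dom_gsum2 a k j l : D a ->
  gsum (gc (gc (H k) id j) (gsh id j) l) (gsh (gsh id j) l) a.
Proof.
move=> /(dom_gsum_grad k j)[d d0 dH].
have d0C : 0 < d%:C :> C by rewrite ltcR.
have a0 i : 0 <= (map_mx Num.norm a) 0 i :> C by rewrite mxE.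
apply: gsum_le (gsum_grad l a0 d0C dH) => i.
by rewrite mxE normr_id.
Qed.

Lemma C11_H a k : D a -> C11 (ps_eval (H k)) (fun x j => pH k j x) a.
Proof.
move=> /domP[d d0 dH].
rewrite (_ : ps_eval (H k) = gs (H k) id); last by apply/funext => x; exact: ps_evalE.
by apply: (gs_C11 _ (dH k)); rewrite ltcR.
Qed.

Lemma C11_pH a k j : D a -> C11 (pH k j) (fun x l => ppH k j l x) a.
Proof.
move=> /(dom_gsum_grad k j)[d d0 dH].
by apply: (gs_C11 _ dH); rewrite ltcR.
Qed.

Lemma zY_pointK x : zY_point (rsubmx x 0 0) (lsubmx x) = x.
Proof.
rewrite /zY_point -[RHS]hsubmxK; congr row_mx.
by apply/matrixP => i j; rewrite !ord1 !mxE eqxx mulr1n.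
Qed.

Lemma zY_pointB z Y z' Y' : zY_point z Y - zY_point z' Y' = zY_point (z - z') (Y - Y') :> 'rV[C]_(m + 1).
Proof. by rewrite /zY_point opp_row_mx add_row_mx raddfB. Qed.

Lemma zY_pointl z Y k : (zY_point z Y : 'rV[C]_(m + 1)) 0 (lshift 1 k) = Y 0 k.
Proof. by rewrite /zY_point row_mxEl. Qed.

Lemma zY_pointr z Y (k : 'I_1) : (zY_point z Y : 'rV[C]_(m + 1)) 0 (rshift m k) = z.
Proof. by rewrite /zY_point row_mxEr !ord1 mxE eqxx. Qed.

Lemma dHdY_JH z Y : D (zY_point z Y) -> dHdY H z Y = JH (zY_point z Y).
Proof.
move=> Da; rewrite /dHdY.
have [d [K [d0 K0 HK]]] := C11_family (fun k => C11_H k Da).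
rewrite (@jacobian_eq _ _ _ _ (\matrix_(b, k) pH k (lshift 1 b) (zY_point z Y)) _ d K) //.
  by apply/matrixP => i j; rewrite !mxE.
move=> h hd; apply: rv_norm_le => [|k]; first by rewrite mulr_ge0 ?exprn_ge0.
have dh : zY_point z (Y + h) - zY_point z Y = zY_point 0 h.
  by rewrite zY_pointB subrr addrAC subrr add0r.
have nh : `|zY_point 0 h : 'rV[C]_(m + 1)| <= `|h|.
  apply: rv_norm_le => // j; case: (splitP j) => j' jE.
    by rewrite (_ : j = lshift 1 j') ?zY_pointl ?coord_le_norm //; exact: val_inj.
  by rewrite (_ : j = rshift m j') ?zY_pointr ?normr0 //; exact: val_inj.
have [||h1 _] := HK k (zY_point z Y) (zY_point z (Y + h)).
- by rewrite subrr normr0 ler0c ltW.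
- by rewrite dh; apply: le_trans nh hd.
apply: le_trans (_ : K * `|zY_point 0 h : 'rV[C]_(m + 1)| ^+ 2 <= _).
  rewrite -dh; move: h1; congr (`|_| <= _); rewrite /sys_eval !mxE dh big_split_ord /=.
  rewrite [X in _ - (_ + X)]big1 ?addr0; last by move=> i _; rewrite zY_pointr mul0r.
  by congr (_ - _); apply: eq_bigr => b _; rewrite zY_pointl [X in _ = _ * X]mxE.
by rewrite ler_wpM2l // lerXn2r // nnegrE.
Qed.

Lemma C11_oneBJH a i j : D a ->
  C11 (fun x => (1%:M - JH x) i j) (fun x l => - ppH i (lshift 1 j) l x) a.
Proof.
move=> Da; have := C11D (C11_cst ((1%:M : 'M[C]_m) i j) a) (C11Z (-1) (C11_pH i (lshift 1 j) Da)).
congr C11; apply/funext => x; first by rewrite !mxE mulN1r.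
by apply/funext => l; rewrite add0r mulN1r.
Qed.

(** Invertibility of the Jacobian of the characteristic system is stated as triviality of its
    kernel: the two conditions on h say that it is killed by the differential of Y - H and by that
    of the determinant. *)
Theorem char_system_newton a gd : D a -> char_system H a = 0 ->
  C11 (fun x => \det (1%:M - JH x)) gd a ->
  (forall h : 'rV[C]_(m + 1),
     (forall k, h 0 (lshift 1 k) = \sum_j h 0 j * pH k j a) ->
     \sum_j h 0 j * gd a j = 0 -> h = 0) ->
  exists2 V : set 'rV[C]_(m + 1), nbhs a V & newton_cvg_quadratic D (char_system H) a V.
Proof.
move=> Da Fa Cd ker.
have nD : nbhs a D by move: Da; rewrite /cvg_domain => /nbhs_interior.
have [r r0 rD] := nbhs_has_ball nD.
pose g (i : 'I_(m + 1)) (x : 'rV[C]_(m + 1)) (j : 'I_(m + 1)) : C :=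
  match fintype.split i with
  | inl k => (j == lshift 1 k)%:R + -1 * pH k j x
  | inr _ => gd x j
  end.
have gl k x j : g (lshift 1 k) x j = (j == lshift 1 k)%:R + -1 * pH k j x.
  by rewrite /g (unsplitK (inl k)).
have gr k x j : g (rshift m k) x j = gd x j.
  by rewrite /g (unsplitK (inr k)).
apply: (newton_converges (g := g)) => //.
  move=> i; case: (split_ordP i) => k ->.
    have := C11D (C11_coord (lshift 1 k) a) (C11Z (-1) (C11_H k Da)).
    congr C11; last by apply/funext => x; apply/funext => j; rewrite gl.
    by apply/funext => x; rewrite /char_system row_mxEl [RHS]mxE [X in _ = X + _]mxE [X in _ = _ + X]mxE [X in _ = _ - X]mxE zY_pointK mulN1r.
  rewrite (_ : g (rshift m k) = gd); last by apply/funext => x; apply/funext => j; rewrite gr.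
  apply: C11_near_eq r0 _ Cd => x xa.
  have Dx : D (zY_point (rsubmx x 0 0) (lsubmx x)) by rewrite zY_pointK; exact: rD.
  by rewrite /char_system row_mxEr (dHdY_JH Dx) zY_pointK (ord1 k) mxE eqxx mulr1n.
rewrite unitmxE unitfE; apply/negP => /det0P[h h0 hG].
have hg i : \sum_j h 0 j * g i a j = 0.
  have h1 : (h *m grad_mx g a) 0 i = 0 by rewrite hG mxE.
  by rewrite -[RHS]h1 mxE; apply: eq_bigr => j _; rewrite mxE.
move: h0; rewrite (ker h) ?eqxx // => [k|].
  have := hg (lshift 1 k); under eq_bigr do rewrite gl mulrDr mulN1r mulrN.
  rewrite big_split /= (bigD1 (lshift 1 k)) //= big1 => [|j /negbTE ->]; last by rewrite mulr0.
  by rewrite eqxx mulr1 addr0 sumrN => /eqP; rewrite subr_eq0 => /eqP.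
by have := hg (rshift m 0); under eq_bigr do rewrite gr.
Qed.

End Systems.

(** * Nonnegativity of the solution and its minimality among supersolutions *)

Section BigO.
Variable R : realType.
Local Notation C := (Cplx R).
Implicit Types f g : R -> C.

(** f(x) = O(x^n) as x tends to 0 from the right. Taylor coefficients are compared through such
    asymptotics on the positive axis, which avoids forming composed series. *)
Definition Opow (n : nat) f :=
  exists2 K : C, 0 <= K & \forall x \near (0 : R)^'+, `|f x| <= K * x%:C ^+ n.

Lemma near0_pos : \forall x \near (0 : R)^'+, 0 < x.
Proof. exact: nbhs_right_gt. Qed.

Lemma near0_le (d : R) : 0 < d -> \forall x \near (0 : R)^'+, x <= d.
Proof. by move=> d0; apply: nbhs_right_le. Qed.

Lemma Opow_eq n f g : (\forall x \near (0 : R)^'+, f x = g x) -> Opow n f -> Opow n g.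
Proof.
move=> fg [K K0 H]; exists K => //.
by apply: filterS2 fg H => x ->.
Qed.

Lemma OpowD n f g : Opow n f -> Opow n g -> Opow n (fun x => f x + g x).
Proof.
move=> [K K0 fK] [L L0 gL]; exists (K + L); first exact: addr_ge0.
apply: filterS2 fK gL => x h1 h2; rewrite mulrDl.
by apply: le_trans (ler_normD _ _) _; exact: lerD.
Qed.

Lemma OpowN n f : Opow n f -> Opow n (fun x => - f x).
Proof. by move=> [K K0 H]; exists K => //; apply: filterS H => x; rewrite normrN. Qed.

Lemma OpowB n f g : Opow n f -> Opow n g -> Opow n (fun x => f x - g x).
Proof. by move=> hf hg; apply: OpowD => //; exact: OpowN. Qed.

Lemma OpowM n k f g : Opow n f -> Opow k g -> Opow (n + k) (fun x => f x * g x).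
Proof.
move=> [K K0 fK] [L L0 gL]; exists (K * L); first exact: mulr_ge0.
apply: filterS2 fK gL => x h1 h2; rewrite normrM exprD mulrACA.
exact: ler_pM.
Qed.

Lemma Opow_cst (k : C) : Opow 0 (fun=> k).
Proof. by exists `|k| => //; near=> x; rewrite mulr1. Unshelve. all: by end_near. Qed.

Lemma Opow_X n : Opow n (fun x => x%:C ^+ n).
Proof.
exists 1 => //; near=> x; rewrite mul1r ger0_norm // exprn_ge0 // ler0c ltW //.
Unshelve. all: by end_near. Qed.

Lemma Opow_weaken n k f : (n <= k)%N -> Opow k f -> Opow n f.
Proof.
move=> nk [K K0 H]; exists K => //; apply: filterS3 H near0_pos (near0_le ltr01) => x h x0 x1.
apply: le_trans h _; rewrite ler_wpM2l // ler_wiXn2l // ?ler0c ?(ltW x0) //.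
by rewrite (_ : 1 = 1%:C) // lecR.
Qed.

Lemma Opow_cstM n (k : C) f : Opow n f -> Opow n (fun x => k * f x).
Proof. by move=> hf; rewrite -[n]add0n; exact: OpowM (Opow_cst k) hf. Qed.

Lemma Opow_sum n (I : Type) (r : seq I) (F : I -> R -> C) :
  (forall i, Opow n (F i)) -> Opow n (fun x => \sum_(i <- r) F i x).
Proof.
move=> H; elim: r => [|i r IH].
  exists 0 => //; near=> x; by rewrite big_nil normr0 mul0r.
by apply: Opow_eq (OpowD (H i) IH); near=> x; rewrite big_cons.
Unshelve. all: by end_near. Qed.

Lemma Opow_norm_rv n k (h : R -> 'rV[C]_k) :
  (forall j, Opow n (fun x => h x 0 j)) -> Opow n (fun x => `|h x|).
Proof.
move=> H.
have [K K0 HK] : Opow n (fun x => \sum_j `|h x 0 j|).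
  apply: Opow_sum => j; have [K K0 HK] := H j.
  by exists K => //; apply: filterS HK => x; rewrite normr_id.
exists K => //; apply: filterS HK => x; apply: le_trans.
rewrite normr_id ger0_norm ?sumr_ge0 //; apply: rv_norm_le => [|j]; first exact: sumr_ge0.
by rewrite (bigD1 j) //= lerDl sumr_ge0.
Qed.

Lemma Opow_dom n f g : (\forall x \near (0 : R)^'+, `|f x| <= `|g x|) -> Opow n g -> Opow n f.
Proof.
by move=> fg [K K0 H]; exists K => //; apply: filterS2 fg H => x; exact: le_trans.
Qed.

Lemma Opow1_small f (e : R) : 0 < e -> Opow 1 f -> \forall x \near (0 : R)^'+, `|f x| <= e%:C.
Proof.
move=> e0 [K K0 H]; have [k k0 KE] := ge0_real K0.
have k1 : 0 < k + 1 by rewrite ltr_wpDl.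
have ek : 0 < e / (k + 1) by rewrite divr_gt0.
apply: filterS3 H near0_pos (near0_le ek) => x h x0 xe; apply: le_trans h _.
rewrite expr1 KE -rmorphM lecR; apply: le_trans (ler_wpM2l k0 xe) _.
by rewrite mulrCA ler_piMr ?(ltW e0) // ler_pdivrMr // mul1r lerDl.
Qed.

Lemma Opow1_cst0 (k : C) : Opow 1 (fun=> k) -> k = 0.
Proof.
move=> H; apply/eqP; rewrite -normr_eq0; have [r r0 rE] := ge0_real (normr_ge0 k).
apply/eqP; rewrite rE; suff -> : r = 0 by [].
apply/eqP; rewrite eq_le r0 andbT; apply/ler_addgt0Pr => e e0; rewrite add0r.
have [x] := @filter_ex _ _ (at_right_proper_filter 0) _ (Opow1_small e0 H).
by rewrite rE lecR.
Qed.

Lemma Opow_div n f : Opow n.+1 (fun x => x%:C * f x) -> Opow n f.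
Proof.
move=> [K K0 H]; exists K => //; apply: filterS2 H near0_pos => x h x0.
have x0C : 0 < x%:C :> C by rewrite ltcR.
by rewrite -(ler_pM2l x0C) -{1}(gtr0_norm x0C) -normrM mulrCA -exprS.
Qed.

(** The constant term is O(x), hence zero; dividing by x moves on to the next coefficient. *)
Lemma Opow_poly0 n (c : nat -> C) : Opow n (fun x => \sum_(k < n) c k * x%:C ^+ k) ->
  forall k, (k < n)%N -> c k = 0.
Proof.
elim: n c => [|n IH] c // H.
have c0 : c 0%N = 0.
  apply: Opow1_cst0.
  have H1 : Opow 1 (fun x => \sum_(k < n) c k.+1 * x%:C ^+ k.+1).
    apply: Opow_sum => k; apply: Opow_cstM; apply: Opow_weaken (Opow_X k.+1); exact: ltn0Sn.
  have := OpowB (Opow_weaken (ltn0Sn n) H) H1; apply: Opow_eq; near=> x.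
  by rewrite big_ord_recl /= expr0 mulr1 addrK.
have {}IH := IH (fun k => c k.+1) _.
case=> [|k] // kn; apply: IH => //; apply: Opow_div.
apply: Opow_eq H; near=> x; rewrite big_ord_recl c0 mul0r add0r mulr_sumr.
by apply: eq_bigr => i _; rewrite /= exprS mulrCA.
Unshelve. all: by end_near. Qed.

End BigO.

(** * Polynomials with nonnegative coefficients *)

Section NonnegPoly.
Variable R : realType.
Local Notation C := (Cplx R).
Implicit Types p q : {poly C}.

Definition pnn p := forall k, 0 <= p`_k.

Lemma pnnM p q : pnn p -> pnn q -> pnn (p * q).
Proof. by move=> hp hq k; rewrite coefM; apply: sumr_ge0 => i _; exact: mulr_ge0. Qed.

Lemma pnn1 : pnn 1.
Proof. by move=> k; rewrite coef1 ler0n. Qed.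

Lemma pnnX p n : pnn p -> pnn (p ^+ n).
Proof. by move=> hp; elim: n => [|n IH]; [exact: pnn1|rewrite exprS; exact: pnnM]. Qed.

Lemma pnn_prod (I : finType) (F : I -> {poly C}) : (forall i, pnn (F i)) -> pnn (\prod_i F i).
Proof. by move=> h; apply: big_ind => //; [exact: pnn1|exact: pnnM]. Qed.

Lemma pnn_horner p (x : C) : pnn p -> 0 <= x -> 0 <= p.[x].
Proof.
move=> hp x0; rewrite horner_coef; apply: sumr_ge0 => i _.
by rewrite mulr_ge0 // exprn_ge0.
Qed.

Lemma coefM_mono p q p' q' : pnn p -> pnn q ->
  (forall k, p`_k <= p'`_k) -> (forall k, q`_k <= q'`_k) ->
  forall k, (p * q)`_k <= (p' * q')`_k.
Proof.
by move=> p0 q0 pp qq k; rewrite !coefM; apply: ler_sum => i _; apply: ler_pM.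
Qed.

Lemma coefX_mono p p' n : pnn p -> (forall k, p`_k <= p'`_k) ->
  forall k, (p ^+ n)`_k <= (p' ^+ n)`_k.
Proof.
move=> p0 pp; elim: n => [|n IH] k; first by rewrite !expr0.
by rewrite !exprS; apply: coefM_mono => //; exact: pnnX.
Qed.

(** For k >= n, x^k is at most (x / x0)^n x0^k. The resulting bound ignores the degree of p, so it
    can be summed over infinitely many polynomials. *)
Lemma horner_tail p (x x0 : C) n : pnn p -> 0 <= x <= x0 -> 0 < x0 ->
  0 <= p.[x] - \sum_(k < n) p`_k * x ^+ k <= (x / x0) ^+ n * p.[x0].
Proof.
move=> p0 /andP[xge xle] x00; pose N := maxn (size p) n.
have nN : (n <= N)%N by rewrite leq_maxr.
have sN : (size p <= N)%N by rewrite leq_maxl.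
have q01 : 0 <= x / x0 <= 1.
  by rewrite divr_ge0 ?(ltW x00) //= ler_pdivrMr // mul1r.
have /andP[q0 q1] := q01.
have E z : p.[z] = \sum_(k < n) p`_k * z ^+ k +
    \sum_(k < N - n) p`_(n + k) * z ^+ (n + k).
  have sN' : (size p <= n + (N - n))%N by rewrite subnKC.
  by rewrite (horner_coef_wide _ sN') big_split_ord.
rewrite !E [X in X - _]addrC addrK.
apply/andP; split.
  by apply: sumr_ge0 => k _; rewrite mulr_ge0 // exprn_ge0.
rewrite mulrDr; apply: ler_wpDl.
  by rewrite mulr_ge0 ?exprn_ge0 // sumr_ge0 // => k _; rewrite mulr_ge0 // exprn_ge0 // ltW.
rewrite mulr_sumr; apply: ler_sum => k _; rewrite mulrCA ler_wpM2l //.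
rewrite !exprD mulrA -exprMn divfK ?gt_eqF // ler_wpM2l ?exprn_ge0 //.
by rewrite lerXn2r // nnegrE // ltW.
Qed.

Lemma horner_head p (x : C) n : pnn p -> 0 < x -> \sum_(k < n) p`_k * x ^+ k <= p.[x].
Proof.
move=> p0 x0; rewrite -subr_ge0.
by have /andP[] := @horner_tail p x x n p0 (introT andP (conj (ltW x0) (lexx _))) x0.
Qed.

Lemma coef_le_horner p (x : C) k : pnn p -> 0 < x -> p`_k <= x ^- k * p.[x].
Proof.
move=> p0 x0; rewrite mulrC ler_pdivlMr ?exprn_gt0 //.
apply: le_trans (horner_head k.+1 p0 x0); rewrite big_ord_recr /= lerDr.
by apply: sumr_ge0 => i _; rewrite mulr_ge0 // exprn_ge0 // ltW.
Qed.

End NonnegPoly.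

(** * Tails of power series and radius of convergence *)

Section SeriesTail.
Variable R : realType.
Local Notation C := (Cplx R).
Local Notation IS := initial_segments.

Lemma psum_init (u : nat -> C) n : psum IS u n = \sum_(k < n) u k.
Proof. by rewrite /psum /= -[n in LHS]subn0 big_mkord. Qed.

Lemma series_tail (c : nat -> C) (r x : C) n : 0 <= x <= r -> 0 < r ->
  summ IS (fun k => c k * r ^+ k) ->
  `|Sum IS (fun k => c k * x ^+ k) - \sum_(k < n) c k * x ^+ k| <=
  (x / r) ^+ n * Sum IS (fun k => `|c k| * r ^+ k).
Proof.
move=> /andP[x0 xr] r0 sr.
have sn : summ IS (fun k => `|c k| * r ^+ k).
  by apply: summ_dom_norm sr => e; rewrite !normrM normr_id.
have q01 : 0 <= x / r <= 1.
  by rewrite divr_ge0 ?(ltW r0) //= ler_pdivrMr // mul1r.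
have /andP[q0 q1] := q01.
have sx : summ IS (fun k => c k * x ^+ k).
  apply: summ_dom sn => k; rewrite normrM ler_wpM2l // normrX ger0_norm // lerXn2r //.
  by rewrite nnegrE ltW.
have lim1 : (fun N => `|psum IS (fun k => c k * x ^+ k) N - \sum_(k < n) c k * x ^+ k|) @ \oo -->
    `|Sum IS (fun k => c k * x ^+ k) - \sum_(k < n) c k * x ^+ k|.
  by apply: cvg_norm; apply: cvgB; [exact: Sum_cvg|exact: cvg_cst].
have Sn0 N : psum IS (fun k => `|c k| * r ^+ k) N <= Sum IS (fun k => `|c k| * r ^+ k).
  by apply: psum_le_Sum => // k; rewrite mulr_ge0 // exprn_ge0 // ltW.
apply: (limn_le lim1 (cvg_cst _ :
   (fun=> (x / r) ^+ n * Sum IS (fun k => `|c k| * r ^+ k)) @ \oo --> _)).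
exists n => // N /= nN; rewrite -(psum_init (fun k => c k * x ^+ k)).
rewrite (psum_subE _ _ nN) [X in X - _]addrC addrK.
apply: le_trans (ler_norm_sum _ _ _) _.
apply: (@le_trans _ _ ((x / r) ^+ n * psum IS (fun k => `|c k| * r ^+ k) N)); last first.
  by rewrite ler_wpM2l // exprn_ge0.
rewrite (psum_subE _ _ nN) mulrDr; apply: ler_wpDl.
  by rewrite mulr_ge0 ?exprn_ge0 // sumr_ge0 // => k _; rewrite mulr_ge0 // exprn_ge0 // ltW.
rewrite mulr_sumr; apply: ler_sum => k; rewrite mem_iota /= add0n -leqNgt => nk.
rewrite normrM mulrCA ler_wpM2l // normrX (ger0_norm x0) -(subnKC nk) !exprD mulrA -exprMn.
rewrite divfK ?gt_eqF // ler_wpM2l ?exprn_ge0 // lerXn2r // nnegrE ltW //.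
Qed.

Lemma gf_evalE m (y : 'I_m -> nat -> C) (z : C) j :
  gf_eval y z 0 j = Sum IS (fun k => y j k * z ^+ k).
Proof. by rewrite mxE series_psum. Qed.

Lemma norm_term (c : nat -> C) (t : R) : 0 <= t ->
  (fun k => `|c k * t%:C ^+ k|) = (fun k => `|c k| * t%:C ^+ k).
Proof.
move=> t0; apply/funext => k; rewrite normrM normrX.
by rewrite (ger0_norm (_ : 0 <= t%:C :> C)) // ler0c.
Qed.

Lemma cvg_radius_gt (c : nat -> C) (r : R) : (r%:E < cvg_radius c)%E ->
  exists2 t : R, r < t & 0 <= t /\ summ IS (fun k => c k * t%:C ^+ k).
Proof.
move=> /ereal_sup_gt[_ [t [t0 ct] <-]]; rewrite lte_fin => rt; exists t => //; split=> //.
by apply/summP; rewrite (norm_term c t0); rewrite series_psum in ct.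
Qed.

Lemma cvg_radius_ge (c : nat -> C) (t : R) : 0 <= t -> summ IS (fun k => c k * t%:C ^+ k) ->
  (t%:E <= cvg_radius c)%E.
Proof.
move=> t0 /summP ct; apply: ereal_sup_ubound; exists t; last by [].
split; first exact: t0.
by rewrite series_psum; move: ct; rewrite (norm_term c t0).
Qed.

Lemma near_complex (P : C -> Prop) : (\forall z \near (0 : C), P z) ->
  \forall x \near (0 : R)^'+, P x%:C.
Proof.
move=> /(iffLR (@nbhs_normP C C 0 P))[_ /gt0_real[e e0 ->] eP].
have e2 : 0 < e / 2 by rewrite divr_gt0.
apply: filterS2 (near0_pos R) (near0_le e2) => x x0 xe; apply: eP => /=.
rewrite sub0r normrN ger0_norm ?ler0c ?(ltW x0) // ltcR; apply: le_lt_trans xe _.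
by rewrite ltr_pdivrMr // ltr_pMr // ltr1n.
Qed.

End SeriesTail.

(** * Substitution of nonnegative polynomials into the system *)

Section Composition.
Variables (R : realType) (m : nat) (H : system R m).
Local Notation C := (Cplx R).
Local Notation idx := {ffun 'I_(m + 1) -> nat}.
Local Notation sm := (summ (boxes (m + 1))).
Local Notation SM := (Sum (boxes (m + 1))).
Local Notation zY x Z := (zY_point x Z : 'rV[C]_(m + 1)).
Hypothesis Hpos : forall k e, 0 <= H k e.
Implicit Types (Q : 'I_m -> {poly C}) (Z : 'rV[C]_m) (S : pred 'I_m).

Lemma zY_ind (P : 'I_(m + 1) -> Prop) :
  (forall k, P (lshift 1 k)) -> P (rshift m 0) -> forall j, P j.
Proof. by move=> hl hr j; case: (split_ordP j) => k ->; rewrite // (ord1 k). Qed.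

Lemma monomialE (x : C) Z (e : idx) :
  monomial (zY x Z) e = (\prod_b Z 0 b ^+ e (lshift 1 b)) * x ^+ e (rshift m 0).
Proof.
rewrite /monomial big_split_ord /= big_ord1 zY_pointr; congr (_ * _).
by apply: eq_bigr => b _; rewrite zY_pointl.
Qed.

Definition mono Q (e : idx) : {poly C} :=
  (\prod_b Q b ^+ e (lshift 1 b)) * 'X ^+ e (rshift m 0).

Definition Qv Q (x : C) : 'rV[C]_m := \row_b (Q b).[x].

Lemma mono_horner Q e x : (mono Q e).[x] = monomial (zY x (Qv Q x)) e.
Proof.
rewrite monomialE hornerM horner_prod horner_exp hornerX; congr (_ * _).
by apply: eq_bigr => b _; rewrite horner_exp mxE.
Qed.

Lemma pnn_X : pnn ('X : {poly C}).
Proof. by move=> k; rewrite coefX ler0n. Qed.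

Lemma pnn_mono Q e : (forall b, pnn (Q b)) -> pnn (mono Q e).
Proof.
move=> hQ; apply: pnnM; last by apply: pnnX; exact: pnn_X.
by apply: pnn_prod => b; exact: pnnX.
Qed.

Lemma mono_mono Q Q' e : (forall b, pnn (Q b)) -> (forall b k, (Q b)`_k <= (Q' b)`_k) ->
  forall k, (mono Q e)`_k <= (mono Q' e)`_k.
Proof.
move=> Q0 QQ'; apply: coefM_mono => //.
- by apply: pnn_prod => b; exact: pnnX.
- by apply: pnnX; exact: pnn_X.
rewrite /index_enum; elim: (Finite.enum _) => [|b r IH] k; first by rewrite !big_nil.
rewrite !big_cons; apply: coefM_mono => //.
- by apply: pnnX.
- by elim/big_ind: _ => //; [exact: pnn1|exact: pnnM|move=> *; exact: pnnX].
- exact: coefX_mono.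
Qed.

(** The coefficient of z^k in H_a(z, Q(z)), summed over the monomials of H_a. *)
Definition coefH Q a k : C := SM (fun e => H a e * (mono Q e)`_k).

Lemma gsum_ge0 a (X : 'rV[C]_(m + 1)) : (forall j, 0 <= X 0 j) ->
  forall e, 0 <= H a e * monomial X e.
Proof. by move=> X0 e; rewrite mulr_ge0 // monomial_ge0. Qed.

Lemma zY_ge0 (x : C) Z : 0 <= x -> (forall b, 0 <= Z 0 b) -> forall j, 0 <= zY x Z 0 j.
Proof. by move=> x0 Z0; apply: zY_ind => [k|]; rewrite ?zY_pointl ?zY_pointr. Qed.

Lemma coefH_summ Q a k x : (forall b, pnn (Q b)) -> 0 < x ->
  gsum (H a) id (zY x (Qv Q x)) -> sm (fun e => H a e * (mono Q e)`_k).
Proof.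
move=> Q0 x0 /(summZ (x ^- k)); apply: summ_dom_norm => e.
rewrite !normrM (ger0_norm (Hpos a e)) mulrCA ler_wpM2l // -mono_horner.
rewrite !ger0_norm ?coef_le_horner //; first exact: pnn_mono.
- by apply: pnn_horner (ltW x0); exact: pnn_mono.
- by rewrite invr_ge0 exprn_ge0 // ltW.
- exact: pnn_mono.
Qed.

Lemma coefH_ge0 Q a k x : (forall b, pnn (Q b)) -> 0 < x ->
  gsum (H a) id (zY x (Qv Q x)) -> 0 <= coefH Q a k.
Proof.
move=> Q0 x0 HQ; apply: Sum_ge0; last exact: coefH_summ HQ.
by move=> e; rewrite mulr_ge0 //; exact: pnn_mono.
Qed.

(** The coordinates in S form a system by themselves, so inequalities between points need only be
    known on S. It is applied to all coordinates and to the first block. *)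
Definition dep_closed S := forall a b, S a -> depends H a b -> S b.

Lemma monomial_dep S a e (x : C) Z Z' : dep_closed S -> S a -> H a e != 0 ->
  (forall b, S b -> Z 0 b = Z' 0 b) -> monomial (zY x Z) e = monomial (zY x Z') e.
Proof.
move=> cS Sa He ZZ; rewrite !monomialE; congr (_ * _); apply: eq_bigr => b _.
have [->|eb] := posnP (e (lshift 1 b)); first by rewrite !expr0.
by rewrite ZZ //; apply: cS Sa _; exists e.
Qed.

Lemma monomial_dep_le S a e (x : C) Z Z' : dep_closed S -> S a -> 0 <= x ->
  (forall b, S b -> 0 <= Z 0 b <= Z' 0 b) ->
  H a e * monomial (zY x Z) e <= H a e * monomial (zY x Z') e.
Proof.
move=> cS Sa x0 ZZ; have [->|He] := eqVneq (H a e) 0; first by rewrite !mul0r.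
(* Nothing is assumed outside S, where the two points may not even be comparable; those coordinates
   are set to 0, which the monomials present in H_a cannot see. *)
pose cut Z : 'rV[C]_m := \row_b if S b then Z 0 b else 0.
rewrite (@monomial_dep S a e x Z (cut Z)) // => [|b Sb]; last by rewrite mxE Sb.
rewrite (@monomial_dep S a e x Z' (cut Z')) // => [|b Sb]; last by rewrite mxE Sb.
apply: ler_wpM2l => //; apply: monomial_le; apply: zY_ind => [b|].
  by rewrite !zY_pointl !mxE; case: ifP => [/ZZ|]; rewrite ?lexx.
by rewrite !zY_pointr x0 lexx.
Qed.

Lemma gsum_dep_le S a (x : C) Z Z' : dep_closed S -> S a -> 0 <= x ->
  (forall b, S b -> 0 <= Z 0 b <= Z' 0 b) ->
  gsum (H a) id (zY x Z') -> gsum (H a) id (zY x Z).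
Proof.
move=> cS Sa x0 ZZ; apply: summ_dom_norm => e.
pose nr Z : 'rV[C]_m := \row_b `|Z 0 b|.
have E Z1 : `|H a e * monomial (zY x Z1) e| = H a e * monomial (zY x (nr Z1)) e.
  rewrite normrM (ger0_norm (Hpos a e)) norm_monomial; congr (_ * monomial _ _).
  apply/rowP; apply: zY_ind => [b|]; rewrite mxE; first by rewrite !zY_pointl mxE.
  by rewrite !zY_pointr ger0_norm.
rewrite !E; apply: (@monomial_dep_le S) => // b Sb; rewrite !mxE normr_ge0 /=.
have /andP[z0 zz] := ZZ b Sb; by rewrite !ger0_norm // (le_trans z0).
Qed.

(** By positivity, truncating the expansion of H_a(z, Q(z)) and replacing Q(x) by the larger Z both
    go in the same direction. Inequalities between values thereby bound sums of coefficients. *)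
Lemma coefH_sum_le S Q a (x : C) Z n : dep_closed S -> S a -> (forall b, pnn (Q b)) -> 0 < x ->
  (forall b, S b -> (Q b).[x] <= Z 0 b) -> gsum (H a) id (zY x Z) ->
  \sum_(k < n) coefH Q a k * x ^+ k <= ps_eval (H a) (zY x Z).
Proof.
move=> cS Sa Q0 x0 QZ sZ.
have QZ' b : S b -> 0 <= Qv Q x 0 b <= Z 0 b.
  by move=> Sb; rewrite mxE QZ // andbT; apply: pnn_horner (ltW x0).
have sQ : gsum (H a) id (zY x (Qv Q x)) by apply: (@gsum_dep_le S) QZ' sZ => //; exact: ltW.
have sk k : sm (fun e => x ^+ k * (H a e * (mono Q e)`_k)).
  by apply: summZ; exact: coefH_summ sQ.
have -> : \sum_(k < n) coefH Q a k * x ^+ k =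
    SM (fun e => \sum_(k < n) x ^+ k * (H a e * (mono Q e)`_k)).
  rewrite (Sum_sum _ _ (fun k : 'I_n => sk k)); apply: eq_bigr => k _.
  by rewrite SumZ 1?mulrC //; exact: coefH_summ sQ.
rewrite ps_evalE; apply: Sum_le => //; first exact: (summ_sum _ _ (fun k : 'I_n => sk k)).
move=> e; apply: le_trans (monomial_dep_le _ cS Sa (ltW x0) QZ').
rewrite -mono_horner; apply: le_trans (ler_wpM2l (Hpos a e) (horner_head n (pnn_mono e Q0) x0)).
by rewrite mulr_sumr; apply: ler_sum => k _; rewrite mulrCA [X in _ * X]mulrC.
Qed.

End Composition.

(** * The recursion satisfied by the coefficients of the solution *)

Section Recursion.
Variables (R : realType) (m : nat) (H : system R m) (y : 'I_m -> nat -> Cplx R).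
Local Notation C := (Cplx R).
Local Notation D := (cvg_domain H).
Local Notation zY x Z := (zY_point x Z : 'rV[C]_(m + 1)).
Hypothesis Hwf : wellfounded H.
Hypothesis ysol : gf_solution H y.
Implicit Types (Q : 'I_m -> {poly C}) (Z : 'rV[C]_m) (S : pred 'I_m).

Local Notation U := (U_iter H m).
Local Notation a0 := (zY (0 : C) U).
Local Notation N := (JH H a0).

Lemma Hpos k e : 0 <= H k e.
Proof. by have [h _ _] := Hwf. Qed.

Lemma U_dom k : (k <= m)%N -> D (zY 0 (U_iter H k)).
Proof. by have [_ h _] := Hwf; exact: h. Qed.

Lemma U_ge0 k : (k <= m)%N -> forall b, 0 <= U_iter H k 0 b.
Proof.
elim: k => [|k IH] km b; first by rewrite mxE.
rewrite /U_iter iterS mxE ps_evalE; apply: Sum_ge0.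
  move=> e; apply: (gsum_ge0 Hpos); apply: zY_ge0 => //; apply: IH; exact: ltnW.
exact: dom_gsum (U_dom (ltnW km)).
Qed.

Lemma y0E b : y b 0%N = U 0 b.
Proof. by have [_ <- _] := ysol; rewrite mxE. Qed.

Lemma N_ge0 a b : 0 <= N a b.
Proof.
rewrite mxE; apply: Sum_ge0; last exact: dom_gsum1 (U_dom (leqnn m)).
move=> e; rewrite gc_dmon mulr_ge0 ?Hpos // dmon_ge0 //.
by apply: zY_ge0 => //; exact: U_ge0.
Qed.

Lemma N_nilp : exists k, N ^+ k = 0.
Proof. by have [_ _ [k hk]] := Hwf; exists k; rewrite -(dHdY_JH (U_dom (leqnn m))). Qed.

Lemma Opow_poly_head (p : {poly C}) (n : nat) : pnn p ->
  Opow n (fun x : R => p.[x%:C] - \sum_(k < n) p`_k * x%:C ^+ k).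
Proof.
move=> p0; exists p.[1]; first exact: pnn_horner.
apply: filterS2 (near0_pos R) (near0_le (ltr01 : 0 < 1 :> R)) => x x0 x1.
have x01 : 0 <= (x%:C : C) <= 1 by rewrite ler0c (ltW x0) (_ : 1 = 1%:C) // lecR.
have /andP[h0 h1] := horner_tail n p0 x01 ltr01.
by rewrite ger0_norm //; move: h1; rewrite divr1 mulrC.
Qed.

Lemma Opow1_near (X : R -> 'rV[C]_(m + 1)) (a : 'rV[C]_(m + 1)) (d : R) : 0 < d ->
  (forall j, Opow 1 (fun x => X x 0 j - a 0 j)) ->
  \forall x \near (0 : R)^'+, `|X x - a| <= d%:C.
Proof.
move=> d0 HX; have : Opow 1 (fun x => `|X x - a|).
  apply: Opow_norm_rv => j; apply: Opow_eq (HX j); near=> x; by rewrite !mxE.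
by move=> /(Opow1_small d0); apply: filterS => x; rewrite normr_id.
Unshelve. all: by end_near. Qed.

Lemma Opow1_zY (Z : R -> 'rV[C]_m) (V : 'rV[C]_m) : (forall b, Opow 1 (fun x => Z x 0 b - V 0 b)) ->
  forall j, Opow 1 (fun x : R => zY x%:C (Z x) 0 j - zY 0 V 0 j).
Proof.
move=> HZ; apply: zY_ind => [b|].
  by apply: Opow_eq (HZ b); near=> x; rewrite !zY_pointl.
by apply: Opow_eq (Opow_X R 1); near=> x; rewrite !zY_pointr expr1 subr0.
Unshelve. all: by end_near. Qed.

Lemma Opow1_Qv Q : (forall b, pnn (Q b)) ->
  forall b, Opow 1 (fun x : R => Qv Q x%:C 0 b - (\row_b (Q b)`_0 : 'rV[C]_m) 0 b).
Proof.
move=> Q0 b; apply: Opow_eq (Opow_poly_head 1 (Q0 b)); near=> x.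
by rewrite !mxE big_ord1 expr0 mulr1.
Unshelve. all: by end_near. Qed.

Lemma Qv_dom Q : (forall b, pnn (Q b)) -> D (zY 0 (\row_b (Q b)`_0)) ->
  exists2 x : R, 0 < x & D (zY x%:C (Qv Q x%:C)).
Proof.
move=> Q0 DU; have [r r0 rD] : exists2 r : R, 0 < r &
    forall x : 'rV[C]_(m + 1), `|x - zY 0 (\row_b (Q b)`_0)| <= r%:C -> D x.
  apply: nbhs_has_ball; move: DU; rewrite /cvg_domain => /nbhs_interior; exact.
have h := Opow1_near r0 (Opow1_zY (Opow1_Qv Q0)).
have [x [x0 hx]] := @filter_ex _ _ (at_right_proper_filter 0) _ (filterI (near0_pos R) h).
exists x; [exact: x0|exact: rD hx].
Qed.

(** The tail bounds of [horner_tail] are summed against the coefficients of H_a, at a fixed x0 > 0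
    where the series still converges. *)
Lemma coefH_asymp Q a n : (forall b, pnn (Q b)) -> D (zY 0 (\row_b (Q b)`_0)) ->
  Opow n (fun x : R => ps_eval (H a) (zY x%:C (Qv Q x%:C)) -
                        \sum_(k < n) coefH H Q a k * x%:C ^+ k).
Proof.
move=> Q0 DU; have [x0 x00 Dx0] := Qv_dom Q0 DU.
have x00C : 0 < x0%:C :> C by rewrite ltcR.
have s0 := dom_gsum a Dx0.
have Hp := Hpos.
pose B := Sum (boxes (m + 1)) (fun e => H a e * (mono Q e).[x0%:C]).
have s0' : summ (boxes (m + 1)) (fun e => H a e * (mono Q e).[x0%:C]).
  by apply: summ_dom_norm s0 => e; rewrite mono_horner.
have pm e : pnn (mono Q e) by exact: pnn_mono.
exists (x0%:C ^- n * B).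
  rewrite mulr_ge0 ?invr_ge0 ?exprn_ge0 ?(ltW x00C) //; apply: Sum_ge0 => // e.
  by rewrite mulr_ge0 // pnn_horner // ltW.
apply: filterS2 (near0_pos R) (near0_le x00) => x xp xx0.
have xpC : 0 < x%:C :> C by rewrite ltcR.
have xx0C : 0 <= (x%:C : C) <= x0%:C by rewrite ler0c (ltW xp) lecR.
have sk k : summ (boxes (m + 1)) (fun e => x%:C ^+ k * (H a e * (mono Q e)`_k)).
  by apply: summZ; exact: coefH_summ s0.
have sx : summ (boxes (m + 1)) (fun e => H a e * (mono Q e).[x%:C]).
  apply: summ_dom_norm s0' => e; rewrite !normrM ler_wpM2l //.
  rewrite !ger0_norm ?pnn_horner ?(ltW xpC) ?(ltW x00C) //.
  by have /andP[_] := horner_tail 0 (pm e) xx0C x00C; rewrite big_ord0 subr0 expr0 mul1r.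
have -> : ps_eval (H a) (zY x%:C (Qv Q x%:C)) = Sum (boxes (m + 1)) (fun e => H a e * (mono Q e).[x%:C]).
  by rewrite ps_evalE /gs; congr Sum; apply/funext => e; rewrite mono_horner.
have -> : \sum_(k < n) coefH H Q a k * x%:C ^+ k =
    Sum (boxes (m + 1)) (fun e => \sum_(k < n) x%:C ^+ k * (H a e * (mono Q e)`_k)).
  rewrite (Sum_sum _ _ (fun k : 'I_n => sk k)); apply: eq_bigr => k _.
  by rewrite SumZ 1?mulrC //; exact: coefH_summ s0.
rewrite -SumB //; last exact: (summ_sum _ _ (fun k : 'I_n => sk k)).
have -> : x0%:C ^- n * B * x%:C ^+ n = (x%:C / x0%:C) ^+ n * B by rewrite expr_div_n; ring.
rewrite -SumZ //; apply: Sum_norm_le; first exact: summZ.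
move=> e; have /andP[h0 h1] := horner_tail n (pm e) xx0C x00C.
have -> : H a e * (mono Q e).[x%:C] - \sum_(k < n) x%:C ^+ k * (H a e * (mono Q e)`_k) =
   H a e * ((mono Q e).[x%:C] - \sum_(k < n) (mono Q e)`_k * x%:C ^+ k).
  rewrite mulrBr mulr_sumr; congr (_ - _); apply: eq_bigr => k _; ring.
by rewrite normrM (ger0_norm (Hp _ _)) (ger0_norm h0) mulrCA ler_wpM2l.
Qed.

Lemma zY_subl (x : C) Z Z' b : (zY x Z' - zY x Z) 0 (lshift 1 b) = Z' 0 b - Z 0 b.
Proof. by rewrite zY_pointB zY_pointl !mxE. Qed.

Lemma zY_subr (x : C) Z Z' k : (zY x Z' - zY x Z) 0 (rshift m k) = 0.
Proof. by rewrite zY_pointB zY_pointr subrr. Qed.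

(** An increment of order n acts through the Jacobian N at (0, U): the Taylor remainder is
    O(x^(2n)), and replacing the gradient at the moving point by the one at (0, U) costs a further
    factor O(x). *)
Lemma H_perturb a (Z Z' : R -> 'rV[C]_m) (w : 'I_m -> C) n : (0 < n)%N ->
  (forall b, Opow 1 (fun x => Z x 0 b - U 0 b)) ->
  (forall b, Opow n.+1 (fun x => Z' x 0 b - Z x 0 b - w b * x%:C ^+ n)) ->
  Opow n.+1 (fun x : R => ps_eval (H a) (zY x%:C (Z' x)) - ps_eval (H a) (zY x%:C (Z x)) -
     (\sum_b N a b * w b) * x%:C ^+ n).
Proof.
move=> n0 HZ HZ'.
have DZ b : Opow n (fun x => Z' x 0 b - Z x 0 b).
  have h1 : Opow n (fun x : R => w b * x%:C ^+ n) by apply: Opow_cstM; exact: Opow_X.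
  by apply: Opow_eq (OpowD (Opow_weaken (leqnSn n) (HZ' b)) h1); near=> x; rewrite subrK.
have HZ2 b : Opow 1 (fun x => Z' x 0 b - U 0 b).
  apply: Opow_eq (OpowD (Opow_weaken n0 (DZ b)) (HZ b)); near=> x; by rewrite addrA subrK.
have DU := U_dom (leqnn m).
have [d [K [d0 K0 HK]]] := C11_H a DU.
have X1 := Opow1_zY HZ; have X2 := Opow1_zY HZ2.
have DX : Opow n (fun x : R => `|zY x%:C (Z' x) - zY x%:C (Z x)|).
  apply: Opow_norm_rv; apply: zY_ind => [b|].
    by apply: Opow_eq (DZ b); near=> x; rewrite zY_subl.
  exists 0 => //; near=> x.
  by rewrite zY_subr normr0 mul0r.
have AX : Opow 1 (fun x : R => `|zY x%:C (Z x) - a0|).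
  apply: Opow_norm_rv => j; apply: Opow_eq (X1 j); near=> x.
  by rewrite [RHS]mxE [X in _ = _ + X]mxE.
have [KX KX0 hKX] := DX.
have n2 : (n.+1 <= n + n)%N by rewrite -addn1 leq_add2l.
pose F x := ps_eval (H a) (zY (x%:C : C) (Z' x)) - ps_eval (H a) (zY x%:C (Z x)) -
    \sum_b (Z' x 0 b - Z x 0 b) * pH H a (lshift 1 b) (zY x%:C (Z x)).
have T1 : Opow n.+1 F.
  apply: Opow_weaken n2 _.
  apply: (@Opow_dom _ _ _ (fun x : R => K * (`|zY x%:C (Z' x) - zY x%:C (Z x)| * `|zY x%:C (Z' x) - zY x%:C (Z x)|))).
    near=> x; have [||_ _ + _] := HK (zY x%:C (Z x)) (zY x%:C (Z' x)).
    - by near: x; exact: Opow1_near.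
    - by near: x; exact: Opow1_near.
    rewrite -expr2 => hh; rewrite [leRHS]ger0_norm ?mulr_ge0 ?exprn_ge0 //.
    move: hh; rewrite /F; congr (`|_ - _| <= _); rewrite big_split_ord /= big_ord1.
    rewrite zY_subr mul0r addr0.
    by apply: eq_bigr => b _; rewrite zY_subl.
  by apply: Opow_cstM; exact: OpowM.
have T2 b : Opow n.+1 (fun x => (Z' x 0 b - Z x 0 b) *
     (pH H a (lshift 1 b) (zY x%:C (Z x)) - pH H a (lshift 1 b) a0)).
  rewrite -[n.+1]addn1; apply: OpowM (DZ b) _.
  apply: (@Opow_dom _ _ _ (fun x : R => K * `|zY x%:C (Z x) - a0|)); last exact: Opow_cstM.
  near=> x; have [||_ _ _ h] := HK a0 (zY x%:C (Z x)).
  - by rewrite subrr normr0 ler0c ltW.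
  - by near: x; exact: Opow1_near.
  by rewrite [leRHS]ger0_norm ?mulr_ge0 //; exact: h.
have T3 b : Opow n.+1 (fun x => pH H a (lshift 1 b) a0 *
     (Z' x 0 b - Z x 0 b - w b * x%:C ^+ n)) by exact: Opow_cstM.
have := OpowD T1 (Opow_sum (index_enum 'I_m) (fun b => OpowD (T2 b) (T3 b))).
apply: Opow_eq; near=> x; rewrite /F -addrA; congr (_ + _).
rewrite mulr_suml -!sumrN -big_split /=; apply: eq_bigr => b _.
have -> : N a b = pH H a (lshift 1 b) a0 by rewrite mxE.
move: (Z' x 0 b) (Z x 0 b) (pH H a (lshift 1 b) (zY x%:C (Z x)))
  (pH H a (lshift 1 b) a0) (x%:C ^+ n : C) (w b) => p1 p2 p3 p4 p5 p6; ring.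
Unshelve. all: by end_near. Qed.

Definition partial n : 'I_m -> {poly C} := fun b => \poly_(k < n) y b k.

Lemma partial_pnn n : (forall k, (k < n)%N -> forall b, 0 <= y b k) ->
  forall b, pnn (partial n b).
Proof. by move=> h b k; rewrite coef_poly; case: ifP => // kn; exact: h. Qed.

Lemma partial0 n : (0 < n)%N -> \row_b (partial n b)`_0 = U.
Proof. by move=> n0; apply/rowP => b; rewrite mxE coef_poly n0 y0E. Qed.

Lemma y_radius_pos : exists2 r : R, 0 < r &
  forall b, summ initial_segments (fun k => y b k * r%:C ^+ k).
Proof.
have [+ _ _] := ysol; rewrite /sys_radius => r0.
have /(_ _)/cid2 rb b : exists2 t : R, 0 < t & 0 <= t /\ summ initial_segments (fun k => y b k * t%:C ^+ k).
  by apply: cvg_radius_gt; apply: lt_le_trans r0 _; exact: bigmin_le.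
pose r : R := \big[Num.min/1]_b sval (rb b).
have r_pos : 0 < r.
  by apply: lt_bigmin => // b _; case: (rb b).
exists r => // b; have := svalP (rb b); case: (rb b) => t /= _ _ _.
have [t0 [tt st]] := svalP (rb b).
apply: summ_dom_norm st => k; rewrite !normrM ler_wpM2l // !normrX lerXn2r ?nnegrE //.
by rewrite !ger0_norm ?ler0c ?(ltW r_pos) // lecR; exact: bigmin_le.
Qed.

Lemma gf_asymp n b :
  Opow n (fun x : R => gf_eval y x%:C 0 b - \sum_(k < n) y b k * x%:C ^+ k).
Proof.
have [r r0 sr] := y_radius_pos; have r0C : 0 < r%:C :> C by rewrite ltcR.
pose B := Sum initial_segments (fun k => `|y b k| * r%:C ^+ k).
have sB : summ initial_segments (fun k => `|y b k| * r%:C ^+ k).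
  by apply: summ_dom_norm (sr b) => k; rewrite !normrM normr_id.
exists (r%:C ^- n * B).
  rewrite mulr_ge0 ?invr_ge0 ?exprn_ge0 ?(ltW r0C) //; apply: Sum_ge0 => // k.
  by rewrite mulr_ge0 ?exprn_ge0 ?(ltW r0C).
apply: filterS2 (near0_pos R) (near0_le r0) => x xp xr.
have xr' : 0 <= (x%:C : C) <= r%:C by rewrite ler0c (ltW xp) lecR.
rewrite gf_evalE; apply: le_trans (series_tail n xr' r0C (sr b)) _.
by rewrite expr_div_n mulrAC mulrC mulrA mulrAC.
Qed.

Lemma gf_near_fix : \forall x \near (0 : R)^'+, forall a,
  gf_eval y x%:C 0 a = ps_eval (H a) (zY x%:C (gf_eval y x%:C)).
Proof.
have [_ _ /near_complex h] := ysol; apply: filterS h => x [_ E] a.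
by rewrite {1}E mxE.
Qed.

Lemma sum_if_last n (s x : C) :
  \sum_(k < n.+1) (if k == n :> nat then s else 0) * x ^+ k = s * x ^+ n.
Proof.
rewrite big_ord_recr /= eqxx big1 ?add0r // => k _.
by rewrite ltn_eqF ?mul0r.
Qed.

Lemma cancel_aux (A B P s Y : C) : A - Y - (B - P + (A - B - s)) = P + s - Y.
Proof. ring. Qed.

(** Both sides of y = H(z, y) are expanded up to order n. The n-th coefficient occurs on the right
    as well, through N. Nonnegativity of the lower coefficients is assumed because expansions are
    controlled for nonnegative polynomials; [y_ge0] discharges it by induction. *)
Lemma recursion n : (0 < n)%N -> (forall k, (k < n)%N -> forall b, 0 <= y b k) ->
  (forall a k, (k < n)%N -> coefH H (partial n) a k = y a k) /\
  (forall a, y a n = coefH H (partial n) a n + \sum_b N a b * y b n).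
Proof.
move=> n0 yk; have Q0 := partial_pnn yk.
have DU : D (zY 0 (\row_b (partial n b)`_0)) by rewrite partial0 //; exact: U_dom.
have PE x b : (partial n b).[x] = \sum_(k < n) y b k * x ^+ k.
  by rewrite horner_poly.
have key a : forall k, (k < n.+1)%N -> coefH H (partial n) a k +
    (if k == n then \sum_b N a b * y b n else 0) - y a k = 0.
  apply: (@Opow_poly0 R).
  have A1 := coefH_asymp a n.+1 Q0 DU.
  have A2 := @H_perturb a (fun x => Qv (partial n) x%:C) (fun x => gf_eval y x%:C)
    (fun b => y b n) n n0.
  have {}A2 := A2 _ _; have {A2} A2 : Opow n.+1 (fun x : R => ps_eval (H a) (zY x%:C (gf_eval y x%:C)) -
      ps_eval (H a) (zY x%:C (Qv (partial n) x%:C)) - (\sum_b N a b * y b n) * x%:C ^+ n).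
    apply: A2 => b.
      by have := Opow1_Qv Q0 b; rewrite partial0.
    apply: Opow_eq (gf_asymp n.+1 b); near=> x.
    by rewrite [Qv (partial n) x%:C 0 b]mxE PE big_ord_recr /= opprD addrA.
  have := OpowB (gf_asymp n.+1 a) (OpowD A1 A2); apply: Opow_eq; near=> x.
  have -> : gf_eval y x%:C 0 a = ps_eval (H a) (zY x%:C (gf_eval y x%:C)).
    by near: x; apply: filterS gf_near_fix => x; exact.
  under [in RHS]eq_bigr do rewrite mulrBl mulrDl.
  by rewrite sumrB big_split /= sum_if_last; exact: cancel_aux.
split=> a.
  move=> k kn; apply/eqP; rewrite -subr_eq0.
  by have := key a k (ltnW kn); rewrite ltn_eqF // addr0 => ->.
by apply/esym/eqP; rewrite -subr_eq0; have := key a n (ltnSn n); rewrite eqxx => ->.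
Unshelve. all: by end_near. Qed.

(** Adding w z^n to the truncation changes H(z, Q) from degree n on, and there by N w. So one step
    of the iteration w -> q + N w is realised by a substitution into H. *)
Lemma coefH_shift n w : (0 < n)%N -> (forall k, (k < n)%N -> forall b, 0 <= y b k) ->
  (forall b, 0 <= w b) ->
  let Q := fun b => partial n b + (w b)%:P * 'X^n in
  (forall a k, (k < n)%N -> coefH H Q a k = y a k) /\
  (forall a, coefH H Q a n = coefH H (partial n) a n + \sum_b N a b * w b).
Proof.
move=> n0 yk w0 Q; have P0 := partial_pnn yk.
have [rec _] := recursion n0 yk.
have Q0 b : pnn (Q b).
  by move=> k; rewrite coefD coefCM coefXn addr_ge0 ?mulr_ge0 ?ler0n //; exact: P0.
have E0 : \row_b (Q b)`_0 = \row_b (partial n b)`_0.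
  by apply/rowP => b; rewrite !mxE coefD coefCM coefXn eq_sym gtn_eqF // mulr0 addr0.
have DU : D (zY 0 (\row_b (partial n b)`_0)) by rewrite partial0 //; exact: U_dom.
have DQ : D (zY 0 (\row_b (Q b)`_0)) by rewrite E0.
have key a : forall k, (k < n.+1)%N -> coefH H (partial n) a k +
    (if k == n then \sum_b N a b * w b else 0) - coefH H Q a k = 0.
  apply: (@Opow_poly0 R).
  have A1 := coefH_asymp a n.+1 P0 DU; have A3 := coefH_asymp a n.+1 Q0 DQ.
  have A2 : Opow n.+1 (fun x : R => ps_eval (H a) (zY x%:C (Qv Q x%:C)) -
      ps_eval (H a) (zY x%:C (Qv (partial n) x%:C)) - (\sum_b N a b * w b) * x%:C ^+ n).
    apply: H_perturb => // b; first by have := Opow1_Qv P0 b; rewrite partial0.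
    exists 0 => //; near=> x.
    by rewrite !mxE hornerD hornerM hornerC hornerXn [X in X - _ - _]addrC addrK subrr normr0 mul0r.
  have := OpowB A3 (OpowD A1 A2); apply: Opow_eq; near=> x.
  under [in RHS]eq_bigr do rewrite mulrBl mulrDl.
  by rewrite sumrB big_split /= sum_if_last; exact: cancel_aux.
split=> a.
  move=> k kn; rewrite -rec //; apply/esym/eqP; rewrite -subr_eq0.
  by have := key a k (ltnW kn); rewrite ltn_eqF // addr0 => ->.
by apply/esym/eqP; rewrite -subr_eq0; have := key a n (ltnSn n); rewrite eqxx => ->.
Unshelve. all: by end_near. Qed.

End Recursion.

(** * Nonnegativity, and minimality among supersolutions *)

Section Minimality.
Variables (R : realType) (m : nat) (H : system R m) (y : 'I_m -> nat -> Cplx R).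
Local Notation C := (Cplx R).
Local Notation D := (cvg_domain H).
Local Notation zY x Z := (zY_point x Z : 'rV[C]_(m + 1)).
Local Notation IS := initial_segments.
Hypothesis Hwf : wellfounded H.
Hypothesis ysol : gf_solution H y.
Implicit Types (Q : 'I_m -> {poly C}) (Z : 'rV[C]_m) (S : pred 'I_m).

Local Notation U := (U_iter H m).
Local Notation a0 := (zY (0 : C) U).
Local Notation N := (JH H a0).
Local Notation P := (partial y).

(** The error after l iterations is M^l Y, so nilpotency makes the Neumann iteration from 0 reach
    the fixed point exactly. *)
Lemma nilp_iter (M : 'M[C]_m) (q Y : 'cV[C]_m) : (exists k, M ^+ k = 0) ->
  Y = q + M *m Y -> exists K, iter K (fun w => q + M *m w) 0 = Y.
Proof.
move=> [K MK] YE; exists K; apply/eqP; rewrite eq_sym -subr_eq0; apply/eqP.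
suff h l : Y - iter l (fun w => q + M *m w) 0 = M ^+ l *m Y by rewrite h MK mul0mx.
elim: l => [|l IH]; first by rewrite subr0 expr0 mul1mx.
by rewrite /= {1}YE opprD addrACA subrr add0r -mulmxBr IH mulmxA exprS.
Qed.

Lemma step_eq n : (0 < n)%N -> (forall k, (k < n)%N -> forall b, 0 <= y b k) ->
  (\col_b y b n : 'cV[C]_m) = \col_a coefH H (P n) a n + N *m \col_b y b n.
Proof.
move=> n0 yk; have [_ rec] := recursion Hwf ysol n0 yk.
apply/colP => a; rewrite !mxE rec; congr (_ + _); apply: eq_bigr => b _.
by rewrite [X in _ = _ * X]mxE.
Qed.

Lemma coefH_partial_ge0 n a k : (0 < n)%N -> (forall k, (k < n)%N -> forall b, 0 <= y b k) ->
  0 <= coefH H (P n) a k.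
Proof.
move=> n0 yk; have Q0 := partial_pnn yk.
have [|x x0 Dx] := Qv_dom (H := H) Q0.
  by rewrite (partial0 ysol) //; exact: (U_dom Hwf (leqnn m)).
by apply: (coefH_ge0 (Hpos Hwf) k Q0 (_ : 0 < x%:C)); rewrite ?ltcR //; exact: dom_gsum.
Qed.

Lemma iter_ge0 (q : 'cV[C]_m) l : (forall b, 0 <= q b 0) ->
  forall b, 0 <= iter l (fun w => q + N *m w) 0 b 0.
Proof.
move=> q0; elim: l => [|l IH] b /=; first by rewrite mxE.
rewrite mxE addr_ge0 // mxE sumr_ge0 // => j _; rewrite mulr_ge0 //.
exact: (N_ge0 Hwf).
Qed.

(** The n-th coefficient is reached from 0 by finitely many iterations of w -> q + N w with q and N
    nonnegative; q involves the lower coefficients only. *)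
Lemma y_ge0 n b : 0 <= y b n.
Proof.
suff h l : forall k, (k < l)%N -> forall b, 0 <= y b k by exact: h (ltnSn n) b.
elim: l => [|l IH] k //; rewrite ltnS leq_eqVlt => /orP[/eqP ->|]; last exact: IH.
case: l IH => [|l] IH c; first by rewrite (y0E ysol); exact: (U_ge0 Hwf (leqnn m)).
have [K KE] := nilp_iter (N_nilp Hwf) (step_eq (ltn0Sn l) IH).
have := congr1 (fun v : 'cV_m => v c 0) KE; rewrite [RHS]mxE => <-.
by apply: iter_ge0 => a; rewrite mxE; exact: coefH_partial_ge0.
Qed.

Lemma P_pnn n b : pnn (P n b).
Proof. by apply: partial_pnn => k _ c; exact: y_ge0. Qed.

(** The induction principle behind minimality: what holds of 0 and survives every substitution below
    H holds of all truncations. The constant terms come from the iteration defining U, each further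
    degree from a finite Neumann iteration. *)
Lemma partial_ind (T : ('I_m -> {poly C}) -> Prop) :
  T (fun=> 0) ->
  (forall Q Q', T Q -> (forall b, pnn (Q b)) ->
     (forall a k, 0 <= (Q' a)`_k <= coefH H Q a k) -> T Q') ->
  forall n, T (P n).
Proof.
move=> T0 TS.
have TU k : (k <= m)%N -> T (fun b => (U_iter H k 0 b)%:P).
  elim: k => [|k IH] km.
    move: T0; congr T; apply/funext => b; by rewrite mxE.
  have Q0 b : pnn (U_iter H k 0 b)%:P.
    by move=> j; rewrite coefC; case: ifP => // _; exact: (U_ge0 Hwf (ltnW km)).
  have U0 : \row_b ((U_iter H k 0 b)%:P)`_0 = U_iter H k :> 'rV[C]_m.
    by apply/rowP => b; rewrite mxE coefC.
  have [|x x0 Dx] := Qv_dom (H := H) Q0; first by rewrite U0; exact: (U_dom Hwf (ltnW km)).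
  apply: (TS _ _ (IH (ltnW km)) Q0) => a j; rewrite coefC.
  have c0 : 0 <= coefH H (fun b => (U_iter H k 0 b)%:P) a j.
    by apply: (coefH_ge0 (Hpos Hwf) j Q0 (_ : 0 < x%:C)); rewrite ?ltcR //; exact: dom_gsum.
  case: eqP => [j0|_]; last by rewrite lexx c0.
  rewrite (U_ge0 Hwf km) /= j0.
  have -> : U_iter H k.+1 0 a = gs (H a) id (zY 0 (U_iter H k)).
    by rewrite {1}/U_iter iterS mxE ps_evalE.
  rewrite le_eqVlt; apply/orP; left.
  apply/eqP; rewrite /gs /coefH; congr Sum; apply/funext => e; congr (_ * _).
  rewrite -horner_coef0 mono_horner; congr (monomial (zY_point _ _) e).
  by apply/rowP => b; rewrite mxE hornerC.
elim => [|n IH].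
  move: T0; congr T; apply/funext => b; apply/polyP => k.
  by rewrite coef_poly coef0.
case: n IH => [|n] IH.
  move: (TU m (leqnn m)); congr T; apply/funext => b; apply/polyP => k.
  by rewrite coef_poly coefC ltnS leqn0; case: eqP => [->|//]; rewrite (y0E ysol).
have yk k : (k < n.+1)%N -> forall b, 0 <= y b k by move=> _ b; exact: y_ge0.
have [K KE] := nilp_iter (N_nilp Hwf) (step_eq (ltn0Sn n) yk).
set q := (\col_a _) in KE.
have q0 b : 0 <= q b 0 by rewrite mxE; exact: coefH_partial_ge0.
(* These iterates climb from 0 to the coefficients of degree n.+1, and by [coefH_shift] each is an
   admissible step from the previous one. *)
pose w l b : C := iter l (fun w => q + N *m w) 0 b 0.
pose Q l b := P n.+1 b + (w l b)%:P * 'X^(n.+1).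
have w0 l b : 0 <= w l b by exact: iter_ge0.
have Qp l b : pnn (Q l b).
  by move=> k; rewrite coefD coefCM coefXn addr_ge0 ?mulr_ge0 ?ler0n //; exact: P_pnn.
have TQ l : T (Q l).
  elim: l => [|l IHl].
    by move: IH; congr T; apply/funext => b; rewrite /Q /w /= mxE mul0r addr0.
  apply: (TS _ _ IHl (Qp l)) => a k; rewrite Qp /=.
  have [h1 h2] := coefH_shift Hwf ysol (ltn0Sn n) yk (w0 l).
  have [|x x0 Dx] := Qv_dom (H := H) (Qp l).
    rewrite (_ : \row_b _ = U); first exact: (U_dom Hwf (leqnn m)).
    apply/rowP => b; rewrite mxE coefD coefCM coefXn mulr0 addr0.
    by rewrite coef_poly /= (y0E ysol).
  rewrite coefD coefCM coefXn coef_poly.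
  case: (ltngtP k n.+1) => kn.
  - by rewrite mulr0 addr0 h1.
  - rewrite mulr0 addr0.
    by apply: (coefH_ge0 (Hpos Hwf) k (Qp l) (_ : 0 < x%:C)); rewrite ?ltcR //; exact: dom_gsum.
  - rewrite add0r mulr1 kn h2 /w /= mxE [q a 0]mxE [X in _ + X <= _]mxE.
    exact: lexx.
move: (TQ K); congr T; apply/funext => b; apply/polyP => k.
rewrite coefD coefCM coefXn !coef_poly /w KE mxE (ltnS k n.+1).
by case: (ltngtP k n.+1) => [kn|kn|->]; rewrite ?mulr0 ?addr0 ?add0r ?mulr1.
Qed.

Lemma P_horner n b (x : C) : (P n b).[x] = psum IS (fun k => y b k * x ^+ k) n.
Proof. by rewrite horner_poly psum_init. Qed.

(** Lying below Z at x is inherited along the steps of [partial_ind], so Z bounds the partial sums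
    of series with nonnegative terms. Convergence at x is a conclusion, which is what contradicts
    the choice of rho when x > rho. *)
Theorem supersolution S (x : C) Z : dep_closed H S -> 0 < x ->
  (forall a, S a -> gsum (H a) id (zY x Z)) ->
  (forall a, S a -> 0 <= Z 0 a /\ ps_eval (H a) (zY x Z) <= Z 0 a) ->
  forall a, S a -> summ IS (fun k => y a k * x ^+ k) /\
     Sum IS (fun k => y a k * x ^+ k) <= Z 0 a.
Proof.
move=> cS x0 sZ HZ.
have bound n a : S a -> (P n a).[x] <= Z 0 a.
  move: n a; apply: (partial_ind (T := fun Q => forall a, S a -> (Q a).[x] <= Z 0 a)).
    by move=> a Sa; rewrite horner0; have [] := HZ a Sa.
  move=> Q Q' IH Q0 QQ' a Sa; rewrite horner_coef.
  apply: (@le_trans _ _ (\sum_(k < size (Q' a)) coefH H Q a k * x ^+ k)).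
    apply: ler_sum => k _; rewrite ler_wpM2r ?exprn_ge0 ?(ltW x0) //.
    by have /andP[] := QQ' a k.
  have [_ h] := HZ a Sa; apply: le_trans h.
  by apply: (coefH_sum_le (Hpos Hwf) _ cS Sa Q0 x0 IH); exact: sZ.
move=> a Sa; have s : summ IS (fun k => y a k * x ^+ k).
  apply/summ_ge0P => [k|]; first by rewrite mulr_ge0 ?y_ge0 // exprn_ge0 // ltW.
  by exists (Z 0 a) => n; rewrite -P_horner bound.
split=> //; apply: Sum_le_bound => // n; by rewrite -P_horner bound.
Qed.

Lemma cvg_exp (u : nat -> C) (l : C) k : u @ \oo --> l -> (fun n => u n ^+ k) @ \oo --> l ^+ k.
Proof.
move=> ul; elim: k => [|k IH]; first exact: cvg_cst.
have -> : (fun n => u n ^+ k.+1) = (fun n => u n * u n ^+ k) by apply/funext => n; rewrite exprS.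
by rewrite exprS; exact: (cvgM ul IH).
Qed.

Lemma cvg_monomial (z : nat -> 'rV[C]_m) Z (x : C) e :
  (forall b, (fun n => z n 0 b) @ \oo --> Z 0 b) ->
  (fun n => monomial (zY x (z n)) e) @ \oo --> monomial (zY x Z) e.
Proof.
move=> zZ; rewrite monomialE.
have -> : (fun n => monomial (zY x (z n)) e) =
    (fun n => (\prod_b z n 0 b ^+ e (lshift 1 b)) * x ^+ e (rshift m 0)).
  by apply/funext => n; rewrite monomialE.
suff h : (fun n => \prod_b z n 0 b ^+ e (lshift 1 b)) @ \oo --> \prod_b Z 0 b ^+ e (lshift 1 b).
  exact: (cvgM h (cvg_cst _)).
elim: (index_enum _) => [|b r IH].
  have -> : (fun n => \prod_(b <- [::]) z n 0 b ^+ e (lshift 1 b)) = (fun=> 1).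
    by apply/funext => n; rewrite big_nil.
  by rewrite big_nil; exact: cvg_cst.
have -> : (fun n => \prod_(b <- b :: r) z n 0 b ^+ e (lshift 1 b)) =
   (fun n => z n 0 b ^+ e (lshift 1 b) * \prod_(b <- r) z n 0 b ^+ e (lshift 1 b)).
  by apply/funext => n; rewrite big_cons.
rewrite big_cons.
exact: (cvgM (cvg_exp (k := e (lshift 1 b)) (zZ b)) IH).
Qed.

(** A finite part of H_a composed with a truncation has coefficients at most those of y_a. Letting
    the truncation grow, then the finite part, gives the inequality together with the convergence of
    H_a at the point, which is not assumed. *)
Lemma solution_le S (x : C) Z : dep_closed H S -> 0 < x ->
  (forall b, 0 <= Z 0 b) ->
  (forall b, S b -> summ IS (fun k => y b k * x ^+ k)) ->
  (forall b, S b -> Z 0 b = Sum IS (fun k => y b k * x ^+ k)) ->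
  forall a, S a -> gsum (H a) id (zY x Z) /\ ps_eval (H a) (zY x Z) <= Z 0 a.
Proof.
move=> cS x0 Z0 sy ZE a Sa.
have yx0 b k : 0 <= y b k * x ^+ k by rewrite mulr_ge0 ?y_ge0 // exprn_ge0 // ltW.
(* The longer truncation [P n'] dominates [P n], and substituting it into H reproduces the
   coefficient of degree k of the solution. *)
have bnd n k : coefH H (P n) a k <= y a k.
  pose n' := (maxn n k).+1.
  have yk j : (j < n')%N -> forall b, 0 <= y b j by move=> _ b; exact: y_ge0.
  have [rec _] := recursion Hwf ysol (ltn0Sn (maxn n k)) yk.
  rewrite -(rec a k); last by rewrite ltnS leq_maxr.
  have [t t0 Dt] : exists2 t : R, 0 < t & D (zY t%:C (Qv (P n') t%:C)).
    apply: (Qv_dom (P_pnn n')); rewrite (partial0 ysol) //; exact: (U_dom Hwf (leqnn m)).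
  have t0C : 0 < t%:C :> C by rewrite ltcR.
  have s' := coefH_summ (Hpos Hwf) k (P_pnn n') t0C (dom_gsum a Dt).
  have le e : H a e * (mono (P n) e)`_k <= H a e * (mono (P n') e)`_k.
    rewrite ler_wpM2l ?(Hpos Hwf) //; apply: mono_mono => [b|b j]; first exact: P_pnn.
    rewrite !coef_poly; case: ifP => jn; last by case: ifP => // _; exact: y_ge0.
    by rewrite ifT // ltnS ltnW // (leq_trans jn) // leq_maxl.
  apply: Sum_le => //; apply: summ_dom s' => e.
  by rewrite ger0_norm //; apply: mulr_ge0; [exact: (Hpos Hwf)|apply: pnn_mono => b; exact: P_pnn].
have sgn e : 0 <= H a e * monomial (zY x Z) e.
  by apply: (gsum_ge0 (Hpos Hwf)); apply: zY_ge0 => //; exact: ltW.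
have psb M : psum (boxes (m + 1)) (fun e => H a e * monomial (zY x Z) e) M <= Z 0 a.
  pose z n : 'rV[C]_m := \row_b if S b then (P n b).[x] else Z 0 b.
  have zc : (fun n => psum (boxes (m + 1)) (fun e => H a e * monomial (zY x (z n)) e) M) @ \oo -->
      psum (boxes (m + 1)) (fun e => H a e * monomial (zY x Z) e) M.
    rewrite /psum; elim: (chunk _ _) => [|e r IH].
      have -> : (fun n => \sum_(e <- [::]) H a e * monomial (zY x (z n)) e) = (fun=> 0).
        by apply/funext => n; rewrite big_nil.
      by rewrite big_nil; exact: cvg_cst.
    have -> : (fun n => \sum_(e <- e :: r) H a e * monomial (zY x (z n)) e) =
      (fun n => H a e * monomial (zY x (z n)) e +
        \sum_(e <- r) H a e * monomial (zY x (z n)) e).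
      by apply/funext => n; rewrite big_cons.
    have mc : (fun n => monomial (zY x (z n)) e) @ \oo --> monomial (zY x Z) e.
      apply: cvg_monomial => b; have [Sb|Sb] := boolP (S b).
        have -> : (fun n => z n 0 b) = psum IS (fun k => y b k * x ^+ k).
          by apply/funext => n; rewrite mxE Sb P_horner.
        by rewrite (ZE _ Sb); exact: (Sum_cvg (sy _ Sb)).
      have -> : (fun n => z n 0 b) = (fun=> Z 0 b).
        by apply/funext => n; rewrite mxE (negbTE Sb).
      exact: cvg_cst.
    by rewrite big_cons; exact: (cvgD (cvgM (cvg_cst _) mc) IH).
  apply: (limn_le zc (cvg_cst _ : (fun=> Z 0 a) @ \oo --> Z 0 a)).
  (* [G] is a finite part of H_a composed with the truncation, so its value at x is at most a
     partial sum of y_a. *)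
  near=> n; pose G : {poly C} := \sum_(e <- chunk (boxes (m + 1)) M) H a e *: mono (P n) e.
  have -> : psum (boxes (m + 1)) (fun e => H a e * monomial (zY x (z n)) e) M = G.[x].
    rewrite /psum /G horner_sum; apply: eq_bigr => e _; rewrite hornerZ mono_horner.
    have [->|He] := eqVneq (H a e) 0; first by rewrite !mul0r.
    congr (_ * _); apply: (@monomial_dep _ _ H S a) => // b Sb.
    by rewrite !mxE Sb.
  rewrite horner_coef ZE //; apply: le_trans (psum_le_Sum (size G) (yx0 a) (sy a Sa)).
  rewrite psum_init; apply: ler_sum => k _; rewrite ler_wpM2r ?exprn_ge0 ?(ltW x0) //.
  apply: le_trans (bnd n k); rewrite /G coef_sum /coefH.
  have [t t0 Dt] : exists2 t : R, 0 < t & D (zY t%:C (Qv (P n.+1) t%:C)).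
    apply: (Qv_dom (P_pnn n.+1)); rewrite (partial0 ysol) //; exact: (U_dom Hwf (leqnn m)).
  have t0C : 0 < t%:C :> C by rewrite ltcR.
  have s1 := coefH_summ (Hpos Hwf) k (P_pnn n.+1) t0C (dom_gsum a Dt).
  have s' : summ (boxes (m + 1)) (fun e => H a e * (mono (P n) e)`_k).
    apply: summ_dom s1 => e; rewrite ger0_norm.
      rewrite ler_wpM2l ?(Hpos Hwf) //; apply: mono_mono => [b|b j]; first exact: P_pnn.
      rewrite !coef_poly; case: ifP => jn; last by case: ifP => // _; exact: y_ge0.
      by rewrite ifT // ltnW.
    by apply: mulr_ge0; [exact: (Hpos Hwf)|apply: pnn_mono => b; exact: P_pnn].
  apply: le_trans (psum_le_Sum M _ s').
    by rewrite /psum; under eq_bigr do rewrite coefZ.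
  by move=> e; apply: mulr_ge0; [exact: (Hpos Hwf)|apply: pnn_mono => b; exact: P_pnn].
have sg : gsum (H a) id (zY x Z) by apply/(summ_ge0P _ sgn); exists (Z 0 a).
by split=> //; rewrite ps_evalE; exact: Sum_le_bound.
Unshelve. all: by end_near. Qed.

(** Each partial sum of y_a is a truncated expansion of H_a along a truncation of the solution,
    hence at most H_a(x, Z) by positivity. *)
Lemma solution_ge (x : C) Z : 0 < x ->
  (forall b, summ IS (fun k => y b k * x ^+ k)) ->
  (forall b, Z 0 b = Sum IS (fun k => y b k * x ^+ k)) ->
  forall a, gsum (H a) id (zY x Z) -> Z 0 a <= ps_eval (H a) (zY x Z).
Proof.
move=> x0 sy ZE a sZ; rewrite ZE; apply: Sum_le_bound => // n.
have yx0 b k : 0 <= y b k * x ^+ k by rewrite mulr_ge0 ?y_ge0 // exprn_ge0 // ltW.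
apply: (@le_trans _ _ (\sum_(k < n) coefH H (P n) a k * x ^+ k)).
  rewrite psum_init; apply: ler_sum => k _; rewrite ler_wpM2r ?exprn_ge0 ?(ltW x0) //.
  have yk j : (j < n)%N -> forall b, 0 <= y b j by move=> _ b; exact: y_ge0.
  have [rec _] := recursion Hwf ysol (leq_ltn_trans (leq0n k) (ltn_ord k)) yk.
  by rewrite rec.
apply: (coefH_sum_le (Hpos Hwf) n (S := xpredT)) => // b.
  exact: P_pnn.
by move=> _; rewrite ZE P_horner; exact: psum_le_Sum.
Qed.

End Minimality.

(** * The critical point *)

Section CriticalPoint.
Variables (R : realType) (i p : nat).
Local Notation C := (Cplx R).
Local Notation m := (i + p)%N.
Variables (H : system R m) (y : 'I_m -> nat -> C) (rho : R).
Local Notation D := (cvg_domain H).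
Local Notation zY x Z := (zY_point x Z : 'rV[C]_(m + 1)).
Local Notation IS := initial_segments.
Hypothesis Hwf : wellfounded H.
Hypothesis ysol : gf_solution H y.
Hypothesis y_zf : zero_free y.
Hypothesis rho_def : sys_radius y = rho%:E.
Hypothesis y_cvg : gf_cvg y rho%:C.
Hypothesis rho_dom : D (zY_point rho%:C (gf_eval y rho%:C)).
Hypothesis rho_lt : (rho%:E < sys_radius (fun a : 'I_i => y (lshift p a)))%E.
Hypothesis H_comp : irreducible_component H.

Local Notation Y := (gf_eval y rho%:C).
Local Notation U := (U_iter H m).
Local Notation A0 := (zY (rho%:C : C) Y).
Local Notation a00 := (zY (0 : C) U).

Let H0 := Hpos Hwf.
Let y0 := y_ge0 Hwf ysol.

Lemma rho_gt0 : 0 < rho.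
Proof. by have [+ _ _] := ysol; rewrite rho_def lte_fin. Qed.

Lemma rhoC_gt0 : 0 < rho%:C :> C.
Proof. by rewrite ltcR; exact: rho_gt0. Qed.

Lemma yr_ge0 (r : R) b k : 0 <= r -> 0 <= y b k * r%:C ^+ k.
Proof. by move=> r0; rewrite mulr_ge0 ?y0 // exprn_ge0 // ler0c. Qed.

Lemma y_summ b : summ IS (fun k => y b k * rho%:C ^+ k).
Proof.
apply: cvg_summ => [k|]; first by apply: yr_ge0; exact: ltW rho_gt0.
by move: y_cvg; rewrite /gf_cvg => /(_ b); rewrite series_psum.
Qed.

Lemma YE b : Y 0 b = Sum IS (fun k => y b k * rho%:C ^+ k).
Proof. exact: gf_evalE. Qed.

Lemma Y_term b k : y b k * rho%:C ^+ k <= Y 0 b.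
Proof.
rewrite YE; apply: (Sum_ge1 k _ (y_summ b)) => l.
by apply: yr_ge0; exact: ltW rho_gt0.
Qed.

Lemma Y_gt0 b : 0 < Y 0 b.
Proof.
have [k yk] := y_zf b; apply: lt_le_trans (Y_term b k).
by rewrite mulr_gt0 ?exprn_gt0 ?rhoC_gt0 // lt0r yk y0.
Qed.

Lemma U_le_Y b : 0 <= U 0 b <= Y 0 b.
Proof.
rewrite (U_ge0 Hwf (leqnn m)) /=; apply: le_trans (Y_term b 0).
by rewrite (y0E ysol) expr0 mulr1.
Qed.

Lemma A0_gt0 j : 0 < A0 0 j.
Proof.
by move: j; apply: zY_ind => [b|]; rewrite ?zY_pointl ?zY_pointr ?Y_gt0 ?rhoC_gt0.
Qed.

Lemma A0_ge0 j : 0 <= A0 0 j.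
Proof. exact: ltW (A0_gt0 j). Qed.

Lemma a00_ge0 j : 0 <= a00 0 j.
Proof. by apply: zY_ge0 => // b; exact: (U_ge0 Hwf (leqnn m)). Qed.

Lemma a00_le j : 0 <= a00 0 j <= A0 0 j.
Proof.
rewrite a00_ge0 /=; move: j; apply: zY_ind => [b|].
  by rewrite !zY_pointl; have /andP[] := U_le_Y b.
by rewrite !zY_pointr ltW ?rhoC_gt0.
Qed.

Lemma full_closed : dep_closed H xpredT. Proof. by []. Qed.

(** The equation is given near 0 only; at rho it results from the two opposite inequalities, without
    analytic continuation. *)
Lemma fixA0 a : ps_eval (H a) A0 = Y 0 a.
Proof.
apply/eqP; rewrite eq_le.
have [_ ->] := solution_le Hwf ysol full_closed rhoC_gt0 (fun b => ltW (Y_gt0 b))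
  (fun b _ => y_summ b) (fun b _ => YE b) (isT : xpredT a).
by rewrite (solution_ge Hwf ysol rhoC_gt0 y_summ YE) //; exact: dom_gsum rho_dom.
Qed.

Lemma fix0 a : ps_eval (H a) a00 = U 0 a.
Proof.
have [_ _ /nbhs_singleton[_]] := ysol.
have -> : gf_eval y (0 : C) = U.
  apply/rowP => b; rewrite gf_evalE -(y0E ysol).
  have := @series_tail R (y b) rho%:C 0 1 _ rhoC_gt0 (y_summ b).
  rewrite lexx ltW ?rhoC_gt0 // mul0r expr1 mul0r big_ord1 expr0 mulr1 => /(_ isT).
  by rewrite normr_le0 subr_eq0 => /eqP.
by move=> /(congr1 (fun v : 'rV_m => v 0 a)) -> ; rewrite mxE.
Qed.

Lemma no_larger_radius (r : R) : rho < r ->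
  (forall b, summ IS (fun k => y b k * r%:C ^+ k)) -> False.
Proof.
move=> rr sy; have : (r%:E <= sys_radius y)%E.
  apply/bigmin_geP; split; first exact: leey.
  by move=> b _; apply: cvg_radius_ge => //; exact: ltW (lt_trans rho_gt0 rr).
by rewrite rho_def lee_fin leNgt rr.
Qed.

Definition S1 (a : 'I_m) := (a < i)%N.

Lemma S1l a : S1 (lshift p a). Proof. by rewrite /S1 /=. Qed.
Lemma S1r b : S1 (rshift i b) = false. Proof. by rewrite /S1 /= ltnNge leq_addr. Qed.

Lemma S1_closed : dep_closed H S1.
Proof.
have [h _ _] := H_comp; move=> a b; case: (split_ordP a) => a' ->; rewrite ?S1r // => _.
by case: (split_ordP b) => b' ->; [rewrite S1l|move=> /h].
Qed.

Lemma larger_radius1 : exists2 r : R, rho < r &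
  forall b, S1 b -> summ IS (fun k => y b k * r%:C ^+ k).
Proof.
have /(_ _)/cid2 rb (b : 'I_i) : exists2 t : R, rho < t &
    0 <= t /\ summ IS (fun k => y (lshift p b) k * t%:C ^+ k).
  by apply: cvg_radius_gt; apply: lt_le_trans rho_lt _; exact: bigmin_le.
pose r : R := \big[Num.min/(rho + 1)]_b sval (rb b).
have rr : rho < r.
  by apply: lt_bigmin => [|b _]; [rewrite ltrDl|case: (rb b)].
have r0 : 0 < r := lt_trans rho_gt0 rr.
exists r => // b; case: (split_ordP b) => b' ->; rewrite ?S1r // => _.
have [_ [tt st]] : rho < sval (rb b') /\ (0 <= sval (rb b') /\
    summ IS (fun k => y (lshift p b') k * (sval (rb b'))%:C ^+ k)) by case: (rb b').
apply: summ_dom_norm st => k; rewrite !normrM ler_wpM2l // !normrX lerXn2r ?nnegrE //.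
by rewrite !ger0_norm ?ler0c ?(ltW r0) // lecR; exact: bigmin_le.
Qed.

(** Strong connectedness as an induction principle: what passes from b to every a depending on it
    fills the second block as soon as it holds somewhere there. *)
Lemma irr_backward (Pr : pred 'I_m) b0 : ~~ S1 b0 -> Pr b0 ->
  (forall a b, ~~ S1 a -> ~~ S1 b -> depends H a b -> Pr b -> Pr a) ->
  forall a, ~~ S1 a -> Pr a.
Proof.
have [_ conn _] := H_comp.
case: (split_ordP b0) => b ->; rewrite ?S1l // => _ Pb st a.
case: (split_ordP a) => c ->; rewrite ?S1l // => _.
have /connectP[q] := conn c b; elim: q c => [|d q IH] c /= => [_ <- //|/andP[/asboolP cd dq] bE].
by apply: (st _ (rshift i d)); rewrite ?S1r //; exact: IH.
Qed.

Lemma irr_forward (Pr : pred 'I_m) b0 : ~~ S1 b0 -> Pr b0 ->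
  (forall a b, ~~ S1 a -> ~~ S1 b -> depends H a b -> Pr a -> Pr b) ->
  forall a, ~~ S1 a -> Pr a.
Proof.
have [_ conn _] := H_comp.
case: (split_ordP b0) => b ->; rewrite ?S1l // => _ Pb st a.
case: (split_ordP a) => c ->; rewrite ?S1l // => _.
have /connectP[q] := conn b c; elim: q b Pb => [|d q IH] b Pb /=; first by move=> _ ->.
move=> /andP[/asboolP cd dq] bE; apply: (IH d) => //.
by apply: (st (rshift i b)); rewrite ?S1r.
Qed.

Lemma gc_summ a j : summ (boxes (m + 1)) (fun e => H a e * dmon j A0 e).
Proof. by apply: summ_dom_norm (dom_gsum1 a j rho_dom) => e; rewrite gc_dmon. Qed.

Lemma pHE a j X : pH H a j X = Sum (boxes (m + 1)) (fun e => H a e * dmon j X e).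
Proof. by rewrite /pH /gs; congr Sum; apply/funext => e; rewrite gc_dmon. Qed.

Lemma term_ge0 a j e : 0 <= H a e * dmon j A0 e.
Proof. by rewrite mulr_ge0 ?H0 // dmon_ge0 //; exact: A0_ge0. Qed.

Lemma pH_ge0 a j : 0 <= pH H a j A0.
Proof. by rewrite pHE; apply: Sum_ge0 (gc_summ a j) => e; exact: term_ge0. Qed.

Lemma pH_gt0 a j e : H a e != 0 -> (0 < e j)%N -> 0 < pH H a j A0.
Proof.
move=> He ej; rewrite pHE.
apply: lt_le_trans (Sum_ge1 e (fun e => term_ge0 a j e) (gc_summ a j)).
apply: mulr_gt0; first by rewrite lt0r He H0.
by apply: mulr_gt0; [rewrite ltr0n|apply: monomial_gt0 => k; exact: A0_gt0].
Qed.

Lemma pH_indep a b X : ~ depends H a b -> pH H a (lshift 1 b) X = 0.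
Proof.
move=> nd; rewrite pHE; apply: Sum0 => e; have [->|He] := eqVneq (H a e) 0; first by rewrite mul0r.
have [eb|eb] := posnP (e (lshift 1 b)); first by rewrite /dmon eb mul0r mulr0.
by case: nd; exists e.
Qed.

(** The Jacobian at the critical point has real nonnegative entries; real parts move it to R, where
    the order is total. *)
Definition J a b : R := complex.Re (pH H a (lshift 1 b) A0).
Definition Jz a : R := complex.Re (pH H a (rshift m 0) A0).

Lemma real_ge0 (z : C) : 0 <= z -> (complex.Re z)%:C = z.
Proof. by move=> /ge0_real[r r0 ->]. Qed.

Lemma JE a b : pH H a (lshift 1 b) A0 = (J a b)%:C.
Proof. by rewrite real_ge0 // pH_ge0. Qed.

Lemma JzE a : pH H a (rshift m 0) A0 = (Jz a)%:C.
Proof. by rewrite real_ge0 // pH_ge0. Qed.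

Lemma J_ge0 a b : 0 <= J a b.
Proof. by rewrite -ler0c -JE pH_ge0. Qed.

Lemma Jz_ge0 a : 0 <= Jz a.
Proof. by rewrite -ler0c -JzE pH_ge0. Qed.

Lemma J_gt0 a b : depends H a b -> 0 < J a b.
Proof. by move=> [e [He eb]]; rewrite -ltcR -JE (pH_gt0 He). Qed.

Lemma J_S1 a b : S1 a -> ~~ S1 b -> J a b = 0.
Proof.
move=> Sa Sb; apply: complexI; rewrite -JE pH_indep // => /(S1_closed Sa).
by rewrite (negbTE Sb).
Qed.

(** * Rays from the critical point; singularity of 1 - J *)

Definition ray (t : R) (r : 'I_m -> R) (e : R) : 'rV[C]_(m + 1) :=
  zY_point (rho + e * t)%:C (\row_b (Y 0 b + (e * r b)%:C)).

Lemma rayE t r e : ray t r e - A0 = zY_point (e * t)%:C (\row_b (e * r b)%:C).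
Proof.
rewrite zY_pointB rmorphD /= addrAC subrr add0r; congr zY_point.
by apply/rowP => b; rewrite !mxE addrAC subrr add0r.
Qed.

Lemma ray_near t r : Opow 1 (fun e => `|ray t r e - A0|).
Proof.
apply: Opow_norm_rv => j; move: j; apply: zY_ind => [b|].
  apply: Opow_eq (Opow_cstM (r b)%:C (Opow_X R 1)); near=> e.
  by rewrite rayE zY_pointl mxE rmorphM /= mulrC.
apply: Opow_eq (Opow_cstM t%:C (Opow_X R 1)); near=> e.
by rewrite rayE zY_pointr rmorphM /= mulrC.
Unshelve. all: by end_near. Qed.

Lemma ray_dom t r : \forall e \near (0 : R)^'+, D (ray t r e).
Proof.
have [d d0 dD] : exists2 d : R, 0 < d & forall x : 'rV[C]_(m + 1), `|x - A0| <= d%:C -> D x.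
  apply: nbhs_has_ball; move: rho_dom; rewrite /cvg_domain => /nbhs_interior; exact.
apply: filterS (Opow1_small d0 (ray_near t r)) => e h; apply: dD.
by rewrite normr_id in h.
Qed.

Lemma ray_ge0 t r : \forall e \near (0 : R)^'+, forall j, 0 <= ray t r e 0 j.
Proof.
apply: filter_forall => j; have [c c0 cE] := gt0_real (A0_gt0 j).
apply: filterS (Opow1_small c0 (ray_near t r)) => e h; rewrite normr_id in h.
have := coord_le_norm (ray t r e - A0) j => /le_trans /(_ h).
have [s sE] : exists s : R, ray t r e 0 j = s%:C.
  move: {c c0 cE h} j; apply: zY_ind => [b|]; last by eexists; rewrite zY_pointr.
  have [u u0 uE] := gt0_real (Y_gt0 b).
  by exists (u + e * r b); rewrite zY_pointl mxE uE -rmorphD.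
have -> : (ray t r e - A0) 0 j = (s - c)%:C by rewrite mxE [X in _ + X]mxE sE cE rmorphB.
have nE : `|(s - c)%:C| = `|s - c|%:C :> C by rewrite normc_def /= expr0n addr0 sqrtr_sqr.
by rewrite nE lecR ler_norml sE ler0c => /andP[+ _]; lra.
Qed.

(** The strict gap g between the two linear parts contributes g e, which beats the O(e^2) Taylor
    remainder for small e. *)
Lemma ray_le t (r : 'I_m -> R) a : Jz a * t + \sum_b J a b * r b < r a ->
  \forall e \near (0 : R)^'+, ps_eval (H a) (ray t r e) <= Y 0 a + (e * r a)%:C.
Proof.
move=> gap; pose g := r a - (Jz a * t + \sum_b J a b * r b).
have g0 : 0 < g by rewrite subr_gt0.
have [d [K [d0 K0 HK]]] := C11_H a rho_dom.
have rn := ray_near t r.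
have small : Opow 1 (fun e => K * (`|ray t r e - A0| * `|ray t r e - A0|) * e%:C^-1).
  apply: Opow_div; apply: Opow_eq (Opow_cstM K (OpowM rn rn)).
  apply: filterS (near0_pos R) => e e0.
  by rewrite [RHS]mulrC divfK // gt_eqF // ltcR.
have h1 := Opow1_small d0 rn; have h2 := Opow1_small g0 small.
have h3 := ray_ge0 t r; have h4 := ray_dom t r; have h5 := near0_pos R.
apply: filterS (filterI h5 (filterI h1 (filterI h2 (filterI h3 h4)))).
move=> e [e0 [n1 [n2 [n3 n4]]]]; rewrite normr_id in n1.
have e0C : 0 < e%:C :> C by rewrite ltcR.
have [|_ _ T _] := HK A0 (ray t r e) _ n1; first by rewrite subrr normr0 ler0c ltW.
have lin : \sum_j (ray t r e - A0) 0 j * pH H a j A0 = (e * (r a - g))%:C.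
  rewrite rayE big_split_ord /= big_ord1 zY_pointr JzE -rmorphM.
  under eq_bigr do rewrite zY_pointl mxE JE -rmorphM.
  rewrite -rmorph_sum -rmorphD; congr _%:C; rewrite /g opprB addrCA subrr addr0.
  rewrite mulrDr mulr_sumr addrC; congr (_ + _); first by ring.
  by apply: eq_bigr => b _; ring.
have fr : 0 <= ps_eval (H a) (ray t r e).
  rewrite ps_evalE; apply: Sum_ge0 (dom_gsum a n4) => f.
  by rewrite mulr_ge0 ?H0 // monomial_ge0.
have [u u0 uE] := ge0_real fr; have [v v0 vE] := gt0_real (Y_gt0 a).
move: T; rewrite lin fixA0 uE vE -!rmorphB /=.
have nE (s : R) : `|s%:C| = `|s|%:C :> C by rewrite normc_def /= expr0n addr0 sqrtr_sqr.
rewrite nE => T; rewrite -rmorphD lecR.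
have : K * `|ray t r e - A0| ^+ 2 <= (g * e)%:C.
  have p0 : 0 <= K * (`|ray t r e - A0| * `|ray t r e - A0|) * e%:C^-1.
    by rewrite !mulr_ge0 // invr_ge0 ltW.
  by move: n2; rewrite ger0_norm // ler_pdivrMr // -rmorphM expr2.
move=> /(le_trans T); rewrite lecR ler_norml => /andP[_]; lra.
Qed.

(** If 1 - J were invertible, the system (1 - J) s = Jz + 1 would provide a direction in which H
    stays strictly below the ray to first order, hence a supersolution at rho + e. *)
Lemma det_A0 : \det (1%:M - JH H A0) = 0.
Proof.
apply/eqP; apply: contraT => d0.
have u1 : 1%:M - JH H A0 \in unitmx by rewrite unitmxE unitfE.
(* The summand 1 is the strict gap that [ray_le] asks for. *)
pose b : 'cV[C]_m := \col_a ((Jz a)%:C + 1).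
pose s := invmx (1%:M - JH H A0) *m b.
have sE a : s a 0 = \sum_c (J a c)%:C * s c 0 + ((Jz a)%:C + 1).
  have : ((1%:M - JH H A0) *m s) a 0 = (Jz a)%:C + 1 by rewrite mulKVmx // mxE.
  rewrite mulmxBl mul1mx mxE [X in _ + X]mxE => /eqP.
  rewrite subr_eq addrC => /eqP ->; congr (_ + _).
  by rewrite mxE; apply: eq_bigr => c _; rewrite [X in X * _]mxE JE.
pose r a := complex.Re (s a 0).
have rE a : r a = \sum_c J a c * r c + Jz a + 1.
  rewrite /r sE raddfD raddf_sum /= addrA; congr (_ + _ + _).
  by apply: eq_bigr => c _; case: (s c 0) => u v /=; rewrite mul0r subr0.
have h : \forall e \near (0 : R)^'+, forall a, ps_eval (H a) (ray 1 r e) <= Y 0 a + (e * r a)%:C.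
  apply: filter_forall => a; apply: ray_le; rewrite (rE a) mulr1; lra.
have [e [e0 [n1 [n2 n3]]]] := @filter_ex _ _ (at_right_proper_filter 0) _
  (filterI (near0_pos R) (filterI h (filterI (ray_ge0 1 r) (ray_dom 1 r)))).
have x0 : 0 < (rho + e * 1)%:C :> C by rewrite ltcR addr_gt0 ?mulr1 // rho_gt0.
have sup := supersolution Hwf ysol full_closed x0 (Z := \row_b (Y 0 b + (e * r b)%:C))
  (fun a _ => dom_gsum a n3).
exfalso; apply: (@no_larger_radius (rho + e * 1)); first by rewrite mulr1 ltrDl.
move=> a; have [|//] := sup _ a isT.
move=> c _; have := n2 (lshift 1 c); by rewrite zY_pointl mxE => ->.
Qed.

(** * Constant coordinates and the first block *)

Lemma monomial_eq_coord (x X : 'rV[C]_(m + 1)) e j : (forall k, 0 <= x 0 k <= X 0 k) ->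
  (forall k, 0 < X 0 k) -> monomial x e = monomial X e -> (0 < e j)%N -> x 0 j = X 0 j.
Proof.
move=> xX X0 xe ej; have /andP[xj0 xj] := xX j; apply/eqP; apply: contraT => ne.
have lt : x 0 j < X 0 j by rewrite lt_neqAle ne.
suff : monomial x e < monomial X e by rewrite xe ltxx.
rewrite /monomial (bigD1 j) //= [X in _ < X](bigD1 j) //=.
apply: (@le_lt_trans _ _ (x 0 j ^+ e j * \prod_(k < m + 1 | k != j) X 0 k ^+ e k)).
  rewrite ler_wpM2l ?exprn_ge0 //; apply: ler_prod => k _; have /andP[k0 k1] := xX k.
  by rewrite exprn_ge0 //= lerXn2r // nnegrE // (le_trans k0).
rewrite ltr_pM2r; last by apply: prodr_gt0 => k _; rewrite exprn_gt0.
by rewrite ltrXn2r // ?nnegrE // ?(ltW (X0 j)) // -lt0n.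
Qed.

Lemma term_summ a (x : 'rV[C]_(m + 1)) : D x -> summ (boxes (m + 1)) (fun e => H a e * monomial x e).
Proof. exact: dom_gsum. Qed.

(** When H_a takes the same value at both points, so does each of its monomials, by positivity; then
    so does every variable occurring in it. Hence a constant coordinate depends on constant
    coordinates only. *)
Lemma const_coord a e j : Y 0 a = U 0 a -> H a e != 0 -> (0 < e j)%N -> a00 0 j = A0 0 j.
Proof.
move=> YU He; apply: monomial_eq_coord => [k|k|].
- exact: a00_le.
- exact: A0_gt0.
have s1 := term_summ a rho_dom; have s2 := term_summ a (U_dom Hwf (leqnn m)).
have := @Sum_eq0 _ _ _ _ e _ (summB s1 s2).
rewrite SumB // -[X in X - _]ps_evalE -[X in _ - X]ps_evalE fixA0 fix0 YU subrr.
move=> h; apply/esym/(mulfI He)/eqP; rewrite -subr_eq0; apply/eqP; apply: h => // f.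
rewrite subr_ge0 ler_wpM2l ?H0 //; apply: monomial_le => k; exact: a00_le.
Qed.

Lemma const_J a b : Y 0 a = U 0 a -> JH H a00 a b = (J a b)%:C.
Proof.
move=> YU; rewrite -JE mxE !pHE; congr Sum; apply/funext => e.
have [->|He] := eqVneq (H a e) 0; first by rewrite !mul0r.
have [eb|eb] := posnP (e (lshift 1 b)); first by rewrite /dmon eb !mul0r.
congr (_ * (_ * _)); apply: eq_bigr => k _.
have [ek|ek] := posnP (e k); last by rewrite (const_coord YU He ek).
by rewrite ffunE ek; case: eqP => _; rewrite !expr0.
Qed.

(** Iterating v <= N v with N nonnegative gives v <= N^K v, which is 0 for large K. *)
Lemma nilp_sub (v : 'I_m -> R) : (forall b, 0 <= v b) ->
  (forall a, (v a)%:C <= \sum_b JH H a00 a b * (v b)%:C) -> forall a, v a = 0.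
Proof.
move=> v0 vN; have [K NK] := N_nilp Hwf.
have h k a : (v a)%:C <= (JH H a00 ^+ k *m \col_b (v b)%:C) a 0.
  elim: k a => [|k IH] a; first by rewrite expr0 mul1mx mxE.
  rewrite exprS -mulmxA mxE; apply: le_trans (vN a) _; apply: ler_sum => b _.
  by rewrite ler_wpM2l //; exact: (N_ge0 Hwf).
by move=> a; have := h K a; rewrite NK mul0mx mxE lecR => va; apply/eqP; rewrite eq_le va v0.
Qed.

Lemma Y_const b : (forall k, (0 < k)%N -> y b k = 0) -> Y 0 b = U 0 b.
Proof.
move=> yk; apply/eqP; rewrite eq_le; have /andP[u0 ->] := U_le_Y b; rewrite andbT YE.
apply: (Sum_le_bound (y_summ b)) => n; rewrite psum_init; case: n => [|n]; first by rewrite big_ord0.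
rewrite big_ord_recl big1 => [|k _]; last by rewrite yk ?mul0r.
by rewrite expr0 mulr1 addr0 (y0E ysol).
Qed.

(* A vector dominated by its image under the Jacobian of the first block is
   nonpositive: otherwise, beyond rho, where the first block still converges, a
   multiple of its positive part could be subtracted from the solution, giving
   a smaller supersolution.  Constant coordinates, which leave no room for
   this, are ruled out beforehand by nilpotency at 0. *)
Lemma noSub (z : 'I_m -> R) : (forall a, S1 a -> z a <= \sum_b J a b * z b) ->
  forall a, S1 a -> z a <= 0.
Proof.
move=> zJ; pose q b := if S1 b then Num.max (z b) 0 else 0.
have q0 b : 0 <= q b by rewrite /q; case: ifP => // _; rewrite le_max lexx orbT.
have sq0 a : 0 <= \sum_b J a b * q b by apply: sumr_ge0 => b _; rewrite mulr_ge0 // J_ge0.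
have qJ a : q a <= \sum_b J a b * q b.
  rewrite {1}/q; case: ifP => Sa //; rewrite ge_max sq0 andbT.
  apply: le_trans (zJ a Sa) _; apply: ler_sum => b _; case: (boolP (S1 b)) => Sb.
    by rewrite ler_wpM2l ?J_ge0 // /q Sb le_max lexx.
  by rewrite J_S1 // !mul0r.
(* On constant coordinates J is the nilpotent Jacobian at 0, and these coordinates are closed under
   dependence, so the restriction of [q] to them vanishes by [nilp_sub]. *)
have qT b : S1 b -> Y 0 b = U 0 b -> q b = 0.
  move=> Sb Eb; pose v b := if S1 b && (Y 0 b == U 0 b) then q b else 0.
  have v0 c : 0 <= v c by rewrite /v; case: ifP.
  suff : v b = 0 by rewrite /v Sb Eb eqxx.
  apply: nilp_sub => // a; rewrite {1}/v; case: ifP => [/andP[Sa /eqP Ea]|_]; last first.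
    by apply: sumr_ge0 => c _; rewrite mulr_ge0 ?ler0c //; exact: (N_ge0 Hwf).
  apply: (@le_trans _ _ (\sum_c (J a c * q c)%:C)); first by rewrite -rmorph_sum lecR qJ.
  apply: ler_sum => c _; rewrite rmorphM /= (const_J c Ea).
  have [->|Jn] := eqVneq (J a c) 0; first by rewrite !mul0r.
  have [e [He ec]] : depends H a c.
    by apply: contrapT => nd; move: Jn; rewrite /J pH_indep // eqxx.
  have := const_coord Ea He ec; rewrite !zY_pointl => UY.
  have Sc : S1 c by apply: (S1_closed Sa); exists e.
  by rewrite /v Sc UY eqxx.
have [r rr sr] := larger_radius1; have r0 : 0 < r := lt_trans rho_gt0 rr.
have r0C : 0 < r%:C :> C by rewrite ltcR.
pose Yr : 'rV[C]_m := \row_b if S1 b then Sum IS (fun k => y b k * r%:C ^+ k) else Y 0 b.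
have YrE b : S1 b -> Yr 0 b = Sum IS (fun k => y b k * r%:C ^+ k) by move=> Sb; rewrite mxE Sb.
have tle b k : y b k * rho%:C ^+ k <= y b k * r%:C ^+ k.
  rewrite ler_wpM2l ?y0 // lerXn2r ?nnegrE ?(ltW r0C) ?(ltW rhoC_gt0) // lecR; exact: ltW.
have Yle b : Y 0 b <= Yr 0 b.
  by rewrite [leRHS]mxE; case: ifP => // Sb; rewrite YE; apply: Sum_le (y_summ b) (sr b Sb) (tle b).
have Ylt b : 0 < q b -> Y 0 b < Yr 0 b.
  rewrite /q; case: ifP => Sb; rewrite ?ltxx // => qb; rewrite YrE // YE.
  have [k k0 yk] : exists2 k, (0 < k)%N & y b k != 0.
    apply: contrapT => nk; have Eb : Y 0 b = U 0 b.
      apply: Y_const => k k0; apply/eqP; apply: contraT => yk; by case: nk; exists k.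
    by move: (qT b Sb Eb); rewrite /q Sb => q00; rewrite q00 ltxx in qb.
  apply: (Sum_lt (e := k)) (y_summ b) (sr b Sb) (tle b) _.
  rewrite ltr_pM2l; last by rewrite lt0r yk y0.
  by rewrite ltrXn2r ?nnegrE ?(ltW r0C) ?(ltW rhoC_gt0) -?lt0n // ltcR.
have Yr0 b : 0 <= Yr 0 b by apply: le_trans (Yle b); exact: ltW (Y_gt0 b).
have near_q : \forall e \near (0 : R)^'+, forall b, (e * q b)%:C <= Yr 0 b - Y 0 b.
  apply: filter_forall => b; case: (ltP 0 (q b)) => qb; last first.
    have -> : q b = 0 by apply/eqP; rewrite eq_le qb q0.
    by near=> e; rewrite mulr0 subr_ge0.
  have [g g0 gE] : exists2 g : R, 0 < g & Yr 0 b - Y 0 b = g%:C.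
    by apply: gt0_real; rewrite subr_gt0 Ylt.
  rewrite gE; apply: filterS (near0_le (divr_gt0 g0 qb)) => e.
  by rewrite lecR ler_pdivlMr.
have [e [e0 he]] := @filter_ex _ _ (at_right_proper_filter 0) _ (filterI (near0_pos R) near_q).
(* For this e, Z lies between Y(rho) and the values [Yr] at r: below [Yr] so that H converges there,
   above Y(rho) so that its derivatives at (r, Z) dominate J. *)
pose Z : 'rV[C]_m := \row_b (Yr 0 b - (e * q b)%:C).
have eq0 b : 0 <= (e * q b)%:C :> C by rewrite ler0c mulr_ge0 // ltW.
have ZE b : Z 0 b = Yr 0 b - (e * q b)%:C by rewrite mxE.
have YZ b : Y 0 b <= Z 0 b by rewrite ZE lerBrDr addrC -lerBrDr he.
have ZYr b : Z 0 b <= Yr 0 b by rewrite ZE lerBlDr lerDl.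
have Z0 b : 0 <= Z 0 b by apply: le_trans (YZ b); exact: ltW (Y_gt0 b).
have sol := solution_le Hwf ysol S1_closed r0C Yr0 sr YrE.
have gZ a : S1 a -> gsum (H a) id (zY r%:C Z).
  move=> Sa; have [h _] := sol a Sa.
  by apply: (gsum_dep_le H0 S1_closed Sa (ltW r0C)) h => b _; rewrite Z0 ZYr.
have sup := supersolution Hwf ysol S1_closed r0C gZ.
move=> a Sa; case: (leP (z a) 0) => // za.
have qa : 0 < q a by rewrite /q Sa lt_max za.
have [|_] := sup _ a Sa; last first.
  by rewrite -YrE // ZE lerBrDr gerDl lecR leNgt mulr_gt0.
move=> c Sc; split=> //; have [h1 h2] := sol c Sc.
pose h : 'rV[C]_(m + 1) := zY 0 (\row_b (e * q b)%:C).
have Zh : zY r%:C Z + h = zY r%:C Yr.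
  apply/rowP; apply: zY_ind => [b|]; rewrite mxE.
    by rewrite !zY_pointl ZE [X in _ + X]mxE subrK.
  by rewrite !zY_pointr addr0.
have X0 j : 0 <= zY r%:C Z 0 j by apply: zY_ge0 => //; exact: ltW.
have AX j : 0 <= A0 0 j <= zY r%:C Z 0 j.
  rewrite A0_ge0 /=; move: j; apply: zY_ind => [b|]; first by rewrite !zY_pointl YZ.
  by rewrite !zY_pointr lecR ltW.
have h0 j : 0 <= h 0 j by apply: zY_ge0 => // b; rewrite mxE.
(* By convexity the increment from Z to [Yr] is at least its linear part at Z, hence at least the
   one computed with J. Summed over f, this bounds the drop of H_c below by e (J q)_c, hence by e
   q_c, so Z is again a supersolution. *)
have tm f : H c f * \sum_b (e * q b)%:C * dmon (lshift 1 b) A0 f <=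
    H c f * monomial (zY r%:C Yr) f - H c f * monomial (zY r%:C Z) f.
  rewrite -mulrBr ler_wpM2l ?H0 // -Zh.
  apply: (le_trans _ (@monomial_cvx R _ false (zY r%:C Z) h f X0 _ _)).
  - rewrite [leRHS]big_split_ord /= big_ord1 [X in _ <= _ + _ * X]zY_pointr mulr0 addr0.
    apply: ler_sum => b _; rewrite mulrC zY_pointl mxE ler_wpM2r //.
    exact: dmon_le.
  - by move=> j; rewrite addr_ge0.
  - by move=> j; rewrite expr0 mul1r.
have sl b : summ (boxes (m + 1)) (fun f => (e * q b)%:C * (H c f * dmon (lshift 1 b) A0 f)).
  by apply: summZ; exact: gc_summ.
have sE : (fun f => H c f * \sum_b (e * q b)%:C * dmon (lshift 1 b) A0 f) =
   (fun f => \sum_b (e * q b)%:C * (H c f * dmon (lshift 1 b) A0 f)).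
  by apply/funext => f; rewrite mulr_sumr; apply: eq_bigr => b _; rewrite mulrCA.
have := Sum_le _ (summB h1 (gZ c Sc)) tm; rewrite sE => /(_ (summ_sum _ _ sl)).
rewrite (Sum_sum _ _ sl) SumB //; last exact: gZ.
rewrite -[X in _ <= X - _]ps_evalE -[X in _ <= _ - X]ps_evalE.
have SE b : Sum (boxes (m + 1)) (fun f => (e * q b)%:C * (H c f * dmon (lshift 1 b) A0 f)) =
    (e * q b * J c b)%:C.
  by rewrite (SumZ _ (gc_summ c (lshift 1 b))) -pHE JE -rmorphM.
rewrite (eq_bigr _ (fun b _ => SE b)) -rmorph_sum => le1; rewrite ZE.
have le2 : (e * q c)%:C <= (\sum_b e * q b * J c b)%:C :> C.
  rewrite lecR; apply: le_trans (ler_wpM2l (ltW e0) (qJ c)) _.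
  by rewrite mulr_sumr; apply: ler_sum => b _; rewrite -mulrA [q b * _]mulrC.
have := le_trans le2 le1; rewrite lerBrDr => le3.
by rewrite lerBrDr; apply: le_trans h2; rewrite addrC.
Unshelve. all: by end_near. Qed.

(** * Perron theory of the second block *)

Lemma ps_le (x : 'rV[C]_(m + 1)) a : (forall j, 0 <= x 0 j <= A0 0 j) ->
  gsum (H a) id x /\ ps_eval (H a) x <= Y 0 a.
Proof.
move=> xA; have gx : gsum (H a) id x.
  apply: gsum_le (dom_gsum a rho_dom) => j; have /andP[x0 xj] := xA j.
  by rewrite !ger0_norm // A0_ge0.
split=> //; rewrite -fixA0 !ps_evalE; apply: Sum_le gx (dom_gsum a rho_dom) _ => e.
by rewrite ler_wpM2l ?H0 //; exact: monomial_le.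
Qed.

(** Then Y - e q would be a supersolution at rho, smaller than Y at [a1]: on the second block by the
    strict gap, on the first by monotonicity, since q vanishes there. *)
Lemma noStrict (q : 'I_m -> R) a1 : (forall a, 0 <= q a) -> (forall a, S1 a -> q a = 0) ->
  (forall a, ~~ S1 a -> q a < \sum_b J a b * q b) -> 0 < q a1 -> False.
Proof.
move=> q0 q1 q2 qa1.
have h : \forall e \near (0 : R)^'+, forall a, ~~ S1 a ->
    ps_eval (H a) (ray 0 (fun b => - q b) e) <= Y 0 a + (e * - q a)%:C.
  apply: filter_forall => a; case: (boolP (S1 a)) => Sa; first by near=> e.
  have : Jz a * 0 + \sum_b J a b * - q b < - q a.
    by under eq_bigr do rewrite mulrN; rewrite sumrN mulr0 add0r ltrN2 q2.
  by move=> /ray_le; apply: filterS => e + _.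
have [e [e0 [n1 [n2 n3]]]] := @filter_ex _ _ (at_right_proper_filter 0) _
  (filterI (near0_pos R) (filterI h (filterI (ray_ge0 0 (fun b => - q b)) (ray_dom 0 (fun b => - q b))))).
have n4 j : 0 <= ray 0 (fun b => - q b) e 0 j <= A0 0 j.
  rewrite n2 /=; move: j; apply: zY_ind => [b|].
    rewrite !zY_pointl [leLHS]mxE gerDl (_ : 0 = (0 : R)%:C) // lecR mulrN oppr_le0 mulr_ge0 //.
    exact: ltW.
  by rewrite !zY_pointr mulr0 addr0.
have x0 : 0 < (rho + e * 0)%:C :> C by rewrite ltcR mulr0 addr0 rho_gt0.
have sup := supersolution Hwf ysol full_closed x0 (Z := \row_b (Y 0 b + (e * - q b)%:C))
  (fun a _ => dom_gsum a n3).
have [|_] := sup _ a1 isT.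
  move=> a _; split; first by have := n2 (lshift 1 a); rewrite zY_pointl.
  rewrite mxE; case: (boolP (S1 a)) => Sa; last exact: n1.
  have [_ n5] := ps_le a n4.
  have -> : Y 0 a + (e * - q a)%:C = Y 0 a by rewrite (q1 a Sa) oppr0 mulr0 addr0.
  exact: n5.
by rewrite mulr0 addr0 -YE [X in _ <= X]mxE lerDl ler0c mulrN oppr_ge0 leNgt mulr_gt0.
Unshelve. all: by end_near. Qed.

Lemma sum_S2 (F : 'I_m -> R) : (forall b, S1 b -> F b = 0) ->
  \sum_b F b = \sum_(b | ~~ S1 b) F b.
Proof. by move=> F0; rewrite (bigID S1) /= big1 ?add0r. Qed.

(** If the inequality were strict somewhere, applying 1 + J repeatedly would spread the defect J q -
    q over the whole strongly connected block, against [noStrict]. The identity summand keeps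
    positive entries positive, which takes care of periodic graphs. *)
Lemma growth (q : 'I_m -> R) : (forall a, 0 <= q a) -> (forall a, S1 a -> q a = 0) ->
  (forall a, ~~ S1 a -> q a <= \sum_b J a b * q b) ->
  forall a, ~~ S1 a -> q a = \sum_b J a b * q b.
Proof.
move=> q0 q1 q2 a1 Sa1; apply/eqP; apply: contraT => ne.
have lt1 : q a1 < \sum_b J a1 b * q b by rewrite lt_neqAle ne q2.
pose B (u : 'I_m -> R) a := if S1 a then 0 else u a + \sum_b J a b * u b.
pose qk k := iter k B q; pose d k a := \sum_b J a b * qk k b - qk k a.
have qS k a : S1 a -> qk k a = 0 by case: k => [|k] Sa; [exact: q1|rewrite /qk /= /B Sa].
have dS k a : ~~ S1 a -> d k.+1 a = d k a + \sum_(b | ~~ S1 b) J a b * d k b.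
  move=> Sa; rewrite /d (_ : qk k.+1 a = qk k a + \sum_b J a b * qk k b); last first.
    by rewrite /qk /= /B (negbTE Sa).
  have E1 : \sum_b J a b * qk k.+1 b =
      \sum_(b | ~~ S1 b) J a b * (qk k b + \sum_c J b c * qk k c).
    rewrite sum_S2 => [|b Sb]; last by rewrite qS ?mulr0.
    by apply: eq_bigr => b Sb; rewrite /qk /= /B (negbTE Sb).
  have E2 : \sum_b J a b * qk k b = \sum_(b | ~~ S1 b) J a b * qk k b.
    by apply: sum_S2 => b Sb; rewrite qS ?mulr0.
  have E3 : \sum_(b | ~~ S1 b) J a b * (\sum_c J b c * qk k c - qk k b) =
      \sum_(b | ~~ S1 b) J a b * (qk k b + \sum_c J b c * qk k c) -
      (\sum_(b | ~~ S1 b) J a b * qk k b + \sum_(b | ~~ S1 b) J a b * qk k b).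
    by rewrite -big_split /= -sumrB; apply: eq_bigr => b _; ring.
  rewrite E1 E3 E2; ring.
have d0 k a : ~~ S1 a -> 0 <= d k a.
  elim: k a => [|k IH] a Sa; first by rewrite subr_ge0 q2.
  rewrite dS // addr_ge0 ?IH // sumr_ge0 // => b Sb; by rewrite mulr_ge0 ?J_ge0 ?IH.
have dle k a : ~~ S1 a -> d k a <= d k.+1 a.
  move=> Sa; rewrite dS // lerDl sumr_ge0 // => b Sb; by rewrite mulr_ge0 ?J_ge0 ?d0.
have dmono k l a : ~~ S1 a -> (k <= l)%N -> d k a <= d l a.
  move=> Sa /subnK <-; elim: (l - k)%N => [|j IH]; first by rewrite add0n.
  by apply: le_trans IH _; exact: dle.
have qk0 k a : 0 <= qk k a.
  elim: k a => [|k IH] a; first exact: q0.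
  rewrite /qk /= -/(qk k) /B; case: ifP => // _.
  by rewrite addr_ge0 ?IH // sumr_ge0 // => b _; rewrite mulr_ge0 ?J_ge0.
have ex a : exists k, ~~ S1 a -> 0 < d k a.
  have [Sa|Sa] := boolP (S1 a); first by exists 0%N.
  suff /asboolP[k dk] : `[< exists k, 0 < d k a >] by exists k.
  apply: (irr_backward (Pr := fun a => `[< exists k, 0 < d k a >]) Sa1) => //.
    by apply/asboolP; exists 0%N; rewrite subr_gt0.
  move=> b c Sb Sc dep /asboolP[k dk]; apply/asboolP; exists k.+1.
  rewrite dS // ltr_wpDl ?d0 // (bigD1 c) //= ltr_pwDl ?mulr_gt0 ?J_gt0 //.
  by apply: sumr_ge0 => f /andP[Sf _]; rewrite mulr_ge0 ?J_ge0 ?d0.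
pose K := \max_a sval (cid (ex a)).
have dK a : ~~ S1 a -> 0 < d K a.
  move=> Sa; apply: lt_le_trans (dmono (sval (cid (ex a))) K a Sa _).
    by case: (cid (ex a)) => k hk /=; exact: hk.
  exact: (leq_bigmax (F := fun a => sval (cid (ex a)))).
have [c qc] : exists c, 0 < qk K c.
  apply: contrapT => nc; have z c : qk K c = 0.
    by apply/eqP; rewrite eq_le qk0 andbT leNgt; apply/negP => h; apply: nc; exists c.
  have := dK a1 Sa1; rewrite /d z subr0 big1 ?ltxx // => b _; by rewrite z mulr0.
exfalso; apply: (noStrict (qk0 K) (qS K)) qc => a Sa.
by rewrite -subr_gt0; exact: dK.
Qed.

Lemma right_pos (q : 'I_m -> R) : (forall a, 0 <= q a) -> (exists a, ~~ S1 a /\ q a != 0) ->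
  (forall a, ~~ S1 a -> q a = \sum_b J a b * q b) -> forall a, ~~ S1 a -> 0 < q a.
Proof.
move=> q0 [a1 [Sa1 qa1]] q2; apply: (irr_backward (Pr := fun a => 0 < q a) Sa1).
  by rewrite lt0r qa1 q0.
move=> a b Sa Sb dep qb; rewrite q2 // (bigD1 b) //= ltr_pwDl ?mulr_gt0 ?J_gt0 //.
by apply: sumr_ge0 => f _; rewrite mulr_ge0 ?J_ge0.
Qed.

Definition nrm (z : C) : R := complex.Re `|z|.

Lemma nrmE z : (nrm z)%:C = `|z|. Proof. by rewrite /nrm real_ge0. Qed.

Lemma nrm_ge0 z : 0 <= nrm z. Proof. by rewrite -ler0c nrmE. Qed.

Lemma nrm_eq0 z : nrm z = 0 -> z = 0.
Proof. by move=> h; apply/eqP; rewrite -normr_eq0 -nrmE h. Qed.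

Lemma nrm_sum (P : pred 'I_m) (c : 'I_m -> R) (u : 'I_m -> C) : (forall b, 0 <= c b) ->
  nrm (\sum_(b | P b) (c b)%:C * u b) <= \sum_(b | P b) c b * nrm (u b).
Proof.
move=> c0; rewrite -lecR nrmE rmorph_sum; apply: le_trans (ler_norm_sum _ _ _) _.
apply: ler_sum => b _; rewrite normrM rmorphM /= nrmE ger0_norm //.
by rewrite ler0c.
Qed.

(** The moduli satisfy |u| <= J |u|: [noSub] kills the first block and [growth] yields equality on
    the second. As no entry of the second block can vanish, the right kernel is a line. *)
Lemma right_null (u : 'I_m -> C) : (forall a, u a = \sum_b (J a b)%:C * u b) ->
  (exists a, u a != 0) ->
  [/\ forall a, S1 a -> u a = 0, forall a, ~~ S1 a -> 0 < nrm (u a) &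
      forall a, nrm (u a) = \sum_b J a b * nrm (u b)].
Proof.
move=> uE [c uc].
have le a : nrm (u a) <= \sum_b J a b * nrm (u b) by rewrite {1}uE; apply: nrm_sum => b; exact: J_ge0.
have z1 a : S1 a -> nrm (u a) = 0.
  move=> Sa; apply/eqP; rewrite eq_le nrm_ge0 andbT.
  by apply: (noSub (z := fun a => nrm (u a))) Sa => b _; exact: le.
have E := growth (fun a => nrm_ge0 (u a)) z1 (fun a _ => le a).
have Sc : ~~ S1 c by apply/negP => /z1/nrm_eq0 h; rewrite h eqxx in uc.
split=> [a /z1/nrm_eq0 //||a].
  apply: right_pos => // [a|]; first exact: nrm_ge0.
  by exists c; split=> //; apply: contra_neq uc => /nrm_eq0.
case: (boolP (S1 a)) => Sa; last exact: E.
rewrite z1 // big1 // => b _; case: (boolP (S1 b)) => Sb; first by rewrite z1 ?mulr0.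
by rewrite J_S1 ?mul0r.
Qed.

Lemma right_vec : exists q : 'I_m -> R, [/\ forall a, S1 a -> q a = 0,
  forall a, ~~ S1 a -> 0 < q a, forall a, q a = \sum_b J a b * q b & exists a, ~~ S1 a].
Proof.
have : \det (1%:M - JH H A0)^T == 0 by rewrite det_tr det_A0.
move=> /det0P[u u0 uJ].
have uE a : u 0 a = \sum_b (J a b)%:C * u 0 b.
  have := congr1 (fun v : 'rV_m => v 0 a) uJ; rewrite /= linearB /= trmx1 mulmxBr mulmx1 mxE.
  rewrite [X in _ + X]mxE [RHS]mxE => /eqP; rewrite subr_eq0 => /eqP ->.
  by rewrite mxE; apply: eq_bigr => b _; rewrite !mxE JE mulrC.
have [c uc] : exists a, u 0 a != 0.
  apply: contrapT => nu; case/eqP: u0; apply/rowP => a; rewrite mxE.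
  by apply/eqP; apply: contraT => ua; case: nu; exists a.
have [h1 h2 h3] := right_null uE (ex_intro _ c uc).
exists (fun a => nrm (u 0 a)); split=> // [a /h1 ->|].
  by rewrite /nrm normr0.
by exists c; apply/negP => /h1 h; rewrite h eqxx in uc.
Qed.

Definition J11 : 'M[C]_i := \matrix_(a, b) (J (lshift p a) (lshift p b))%:C.

(** The moduli of a null vector, extended by 0 to the second block, are nonpositive by [noSub]. *)
Lemma J11_unit : 1%:M - J11 \in unitmx.
Proof.
rewrite -unitmx_tr unitmxE unitfE; apply/negP => /det0P[u u0 uJ].
pose v (a : 'I_m) : C := match fintype.split a with inl a' => u 0 a' | inr _ => 0 end.
have vl a : v (lshift p a) = u 0 a by rewrite /v (unsplitK (inl a)).
have vr a : v (rshift i a) = 0 by rewrite /v (unsplitK (inr a)).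
have uE a : u 0 a = \sum_b (J (lshift p a) (lshift p b))%:C * u 0 b.
  have := congr1 (fun v : 'rV_i => v 0 a) uJ; rewrite /= linearB /= trmx1 mulmxBr mulmx1 mxE.
  rewrite [X in _ + X]mxE [RHS]mxE => /eqP; rewrite subr_eq0 => /eqP ->.
  by rewrite mxE; apply: eq_bigr => b _; rewrite !mxE mulrC.
case/eqP: u0; apply/rowP => a; rewrite [RHS]mxE -vl; apply: nrm_eq0.
apply/eqP; rewrite eq_le nrm_ge0 andbT.
apply: (noSub (z := fun a => nrm (v a))) (S1l a) => c.
case: (split_ordP c) => c' ->; rewrite ?S1r // => _.
rewrite {1}vl uE big_split_ord /= [X in _ <= _ + X]big1 ?addr0; last first.
  by move=> b _; rewrite vr /nrm normr0 mulr0.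
rewrite -lecR nrmE rmorph_sum; apply: le_trans (ler_norm_sum _ _ _) _.
apply: ler_sum => b _; rewrite normrM rmorphM /= nrmE vl ger0_norm //.
by rewrite ler0c J_ge0.
Qed.

(** On the second block |v| is at most its image under the transpose of J; pairing the defect with
    the positive right null vector gives 0, so there is equality. A vector v supported on the first
    block would be a left null vector of the invertible 1 - J11. *)
Lemma left_null (v : 'I_m -> C) : (forall b, v b = \sum_a v a * (J a b)%:C) ->
  (exists b, v b != 0) -> (forall b, ~~ S1 b -> 0 < nrm (v b)) /\
  (forall b, ~~ S1 b -> nrm (v b) = \sum_(a | ~~ S1 a) J a b * nrm (v a)).
Proof.
move=> vE [c vc]; have [q [q1 q2 qE _]] := right_vec.
have q0 a : 0 <= q a by case: (boolP (S1 a)) => Sa; [rewrite q1|exact: ltW (q2 a Sa)].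
have le b : ~~ S1 b -> nrm (v b) <= \sum_(a | ~~ S1 a) J a b * nrm (v a).
  move=> Sb; rewrite {1}vE (bigID S1) /= big1 ?add0r => [|a Sa]; last by rewrite J_S1 // mulr0.
  under eq_bigr do rewrite mulrC.
  by apply: nrm_sum => a; exact: J_ge0.
have E b : ~~ S1 b -> nrm (v b) = \sum_(a | ~~ S1 a) J a b * nrm (v a).
  have h : \sum_(b | ~~ S1 b) (\sum_(a | ~~ S1 a) J a b * nrm (v a) - nrm (v b)) * q b = 0.
    under eq_bigr do rewrite mulrBl mulr_suml.
    rewrite sumrB exchange_big /= -sumrB big1 // => a Sa.
    rewrite qE sum_S2 => [|b' Sb']; last by rewrite q1 ?mulr0.
    by rewrite mulr_sumr -sumrB big1 // => b' _; ring.
  move=> Sb; apply/eqP; rewrite eq_sym -subr_eq0; apply/eqP.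
  have t0 c' : ~~ S1 c' -> 0 <= (\sum_(a | ~~ S1 a) J a c' * nrm (v a) - nrm (v c')) * q c'.
    by move=> Sc'; rewrite mulr_ge0 // subr_ge0 le.
  have /eqP := h; rewrite psumr_eq0 // => /allP /(_ b (mem_index_enum b)).
  by rewrite Sb /= mulf_eq0 (gt_eqF (q2 b Sb)) orbF => /eqP.
have [b1 [Sb1 vb1]] : exists b, ~~ S1 b /\ v b != 0.
  apply: contrapT => nb.
  have v2 b : ~~ S1 b -> v b = 0.
    by move=> Sb; apply/eqP; apply: contraT => h; case: nb; exists b.
  have h : (\row_a v (lshift p a)) *m (1%:M - J11) = 0.
    apply/rowP => b; rewrite mulmxBr mulmx1 mxE [X in X + _]mxE [X in _ + X]mxE [RHS]mxE.
    rewrite vE big_split_ord /= [X in _ + X - _]big1 => [|a _]; last by rewrite v2 ?mul0r // S1r.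
    by rewrite addr0 mxE -sumrB big1 // => a _; rewrite !mxE subrr.
  have v1 : \row_a v (lshift p a) = 0 :> 'rV_i.
    by rewrite -[LHS](mulmxK J11_unit) h mul0mx.
  move: vc; case: (split_ordP c) => c' ->; last by rewrite v2 ?eqxx // S1r.
  by have := congr1 (fun w : 'rV_i => w 0 c') v1; rewrite !mxE => ->; rewrite eqxx.
split=> //; apply: (irr_forward (Pr := fun b => 0 < nrm (v b)) Sb1).
  by rewrite lt0r nrm_ge0 andbT; apply: contra_neq vb1 => /nrm_eq0.
move=> a b Sa Sb dep va; rewrite E // (bigD1 a) //= ltr_pwDl ?mulr_gt0 ?J_gt0 //.
by apply: sumr_ge0 => f _; rewrite mulr_ge0 ?J_ge0 ?nrm_ge0.
Qed.

Lemma sum_S2r (V : nmodType) (F : 'I_m -> V) : \sum_(a | ~~ S1 a) F a = \sum_(a < p) F (rshift i a).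
Proof.
rewrite big_mkcond big_split_ord /= big1 ?add0r => [|a _]; last by rewrite S1l.
by apply: eq_bigr => a _; rewrite S1r.
Qed.

Lemma noSub_i (f : 'I_i -> R) :
  (forall a, f a <= \sum_b J (lshift p a) (lshift p b) * f b) -> forall a, f a <= 0.
Proof.
move=> fJ; pose z (a : 'I_m) : R := match fintype.split a with inl a' => f a' | inr _ => 0 end.
have zl a : z (lshift p a) = f a by rewrite /z (unsplitK (inl a)).
have zr a : z (rshift i a) = 0 by rewrite /z (unsplitK (inr a)).
move=> a; rewrite -zl; apply: noSub (S1l a) => c; case: (split_ordP c) => c' ->; rewrite ?S1r // => _.
rewrite zl big_split_ord /= [X in _ <= _ + X]big1 ?addr0 => [|b _]; last by rewrite zr mulr0.
by apply: le_trans (fJ c') _; apply: ler_sum => b _; rewrite zl.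
Qed.

(** * The left null vector and the dependence on z *)

Definition dl b : R := complex.Re (Y 0 b - U 0 b).

Lemma dlE b : (dl b)%:C = Y 0 b - U 0 b.
Proof. by rewrite /dl real_ge0 // subr_ge0; have /andP[] := U_le_Y b. Qed.

Lemma dl_ge0 b : 0 <= dl b.
Proof. by rewrite -ler0c dlE subr_ge0; have /andP[] := U_le_Y b. Qed.

(** The tangent inequality at the critical point, evaluated at (0, U): all increments are
    nonpositive there, so monomials lie above their linear parts. *)
Lemma concave a : dl a <= rho * Jz a + \sum_b J a b * dl b.
Proof.
pose h : 'rV[C]_(m + 1) := a00 - A0.
have A0h : A0 + h = a00 by rewrite /h addrC subrK.
have hl b : h 0 (lshift 1 b) = - (dl b)%:C.
  by rewrite /h mxE [X in _ + X]mxE !zY_pointl dlE opprB.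
have hr : h 0 (rshift m 0) = - rho%:C by rewrite /h mxE [X in _ + X]mxE !zY_pointr sub0r.
have tm e : H a e * \sum_j dmon j A0 e * h 0 j <= H a e * monomial a00 e - H a e * monomial A0 e.
  rewrite -mulrBr ler_wpM2l ?H0 // -A0h.
  apply: (@monomial_cvx _ _ true) => j; first exact: A0_ge0.
    by have := a00_ge0 j; rewrite -A0h mxE.
  have hj : h 0 j = a00 0 j - A0 0 j by rewrite [LHS]mxE [X in _ + X]mxE.
  by rewrite expr1 mulN1r oppr_ge0 hj subr_le0; have /andP[] := a00_le j.
have sl j : summ (boxes (m + 1)) (fun e => h 0 j * (H a e * dmon j A0 e)).
  by apply: summZ; exact: gc_summ.
have sE : (fun e => H a e * \sum_j dmon j A0 e * h 0 j) =
    (fun e => \sum_j h 0 j * (H a e * dmon j A0 e)).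
  by apply/funext => e; rewrite mulr_sumr; apply: eq_bigr => j _; rewrite mulrA mulrC.
have s1 := term_summ a rho_dom; have s2 := term_summ a (U_dom Hwf (leqnn m)).
have := Sum_le _ (summB s2 s1) tm; rewrite sE => /(_ (summ_sum _ _ sl)).
rewrite (Sum_sum _ _ sl) SumB // -[X in _ <= X - _]ps_evalE -[X in _ <= _ - X]ps_evalE.
have SE j : Sum (boxes (m + 1)) (fun e => h 0 j * (H a e * dmon j A0 e)) = h 0 j * pH H a j A0.
  by rewrite (SumZ _ (gc_summ a j)) -pHE.
rewrite (eq_bigr _ (fun j _ => SE j)) fixA0 fix0 big_split_ord /= big_ord1 hr JzE.
have -> : \sum_b h 0 (lshift 1 b) * pH H a (lshift 1 b) A0 = - (\sum_b J a b * dl b)%:C.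
  rewrite rmorph_sum -sumrN; apply: eq_bigr => b _.
  by rewrite hl JE rmorphM /= mulNr mulrC.
rewrite -[U 0 a - _]opprB -dlE mulNr -opprD lerN2 -rmorphM -rmorphD lecR.
by rewrite [X in _ <= X]addrC.
Qed.

Lemma Y_const_inv b : Y 0 b = U 0 b -> forall k, (0 < k)%N -> y b k = 0.
Proof.
move=> YU k k0; apply/eqP; apply: contraT => yk.
pose u0 j : C := if j == 0%N then y b j * rho%:C ^+ j else 0.
have yj j := yr_ge0 b j (ltW rho_gt0).
have u00 j : 0 <= u0 j by rewrite /u0; case: ifP.
have u0y j : u0 j <= y b j * rho%:C ^+ j by rewrite /u0; case: ifP.
have s0 : summ IS u0 by apply: summ_dom (y_summ b) => j; rewrite ger0_norm.
have : Sum IS u0 < Sum IS (fun k => y b k * rho%:C ^+ k).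
  apply: (Sum_lt (e := k)) s0 (y_summ b) u0y _; rewrite /u0 gtn_eqF //.
  by rewrite mulr_gt0 ?exprn_gt0 ?rhoC_gt0 // lt0r yk y0.
rewrite -YE YU; have := Sum_ge1 0%N u00 s0.
by rewrite /u0 eqxx expr0 mulr1 (y0E ysol) => /le_lt_trans h /h; rewrite ltxx.
Qed.

(** Minimality for the second block alone: the first one is kept at its solution values, where
    monotonicity supplies the supersolution inequality. *)
Lemma block2_min (Z2 : 'I_m -> C) : (forall b, ~~ S1 b -> 0 <= Z2 b <= Y 0 b) ->
  (forall c, ~~ S1 c ->
     ps_eval (H c) (zY rho%:C (\row_b if S1 b then Y 0 b else Z2 b)) <= Z2 c) ->
  forall c, ~~ S1 c -> Y 0 c <= Z2 c.
Proof.
set Z := \row_b _ => Z2Y HZ.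
have ZE b : Z 0 b = if S1 b then Y 0 b else Z2 b by rewrite [LHS]mxE.
have ZY b : 0 <= Z 0 b <= Y 0 b.
  by rewrite ZE; case: ifPn => Sb; [rewrite lexx ltW ?Y_gt0|exact: Z2Y].
have le j : 0 <= zY rho%:C Z 0 j <= A0 0 j.
  move: j; apply: zY_ind => [b|]; first by rewrite !zY_pointl.
  by rewrite !zY_pointr lexx ltW ?rhoC_gt0.
have sup := supersolution Hwf ysol full_closed rhoC_gt0 (fun a _ => proj1 (ps_le a le)).
move=> c Sc; have [|_] := sup _ c isT; last by rewrite -YE ZE (negbTE Sc).
move=> d _; have /andP[Zd _] := ZY d; split=> //; rewrite [leRHS]ZE.
by case: ifPn => Sd; [have [_] := ps_le d le|exact: HZ].
Qed.

(** If v Jz vanished, the second block would see neither z nor any nonconstant coordinate of the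
    first block. It would then be constant, and the whole solution would converge as far as its
    first block does, beyond rho. *)
Lemma left_vec : exists (v : 'I_m -> C) (w : 'I_m -> R),
  [/\ forall b, v b = \sum_a v a * (J a b)%:C,
      forall a, ~~ S1 a -> v a = (w a)%:C /\ 0 < w a,
      forall b, ~~ S1 b -> w b = \sum_(a | ~~ S1 a) J a b * w a &
      \sum_a v a * (Jz a)%:C != 0].
Proof.
have /det0P[u u0 uJ] : \det (1%:M - JH H A0) == 0 by rewrite det_A0.
have uE b : u 0 b = \sum_a u 0 a * (J a b)%:C.
  have := congr1 (fun v : 'rV_m => v 0 b) uJ; rewrite /= mulmxBr mulmx1 mxE.
  rewrite [X in _ + X]mxE [RHS]mxE => /eqP; rewrite subr_eq0 => /eqP ->.
  by rewrite mxE; apply: eq_bigr => a _; rewrite mxE JE.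
have [d ud] : exists a, u 0 a != 0.
  apply: contrapT => nu; case/eqP: u0; apply/rowP => a; rewrite mxE.
  by apply/eqP; apply: contraT => ua; case: nu; exists a.
have [wp wE] := left_null uE (ex_intro _ d ud).
pose w a := nrm (u 0 a).
(* The second block of v consists of the moduli w; its first block v1 is then forced by v1 = v1 J11
   + g. *)
pose g : 'rV[C]_i := \row_b \sum_a (J (rshift i a) (lshift p b) * w (rshift i a))%:C.
pose v1 := g *m invmx (1%:M - J11).
pose v (a : 'I_m) : C := match fintype.split a with inl a' => v1 0 a' | inr _ => (w a)%:C end.
have vl a : v (lshift p a) = v1 0 a by rewrite /v (unsplitK (inl a)).
have vr a : v (rshift i a) = (w (rshift i a))%:C by rewrite /v (unsplitK (inr a)).
have vg b : v1 0 b = \sum_a v1 0 a * J11 a b + g 0 b.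
  have := congr1 (fun x : 'rV_i => x 0 b) (mulmxKV J11_unit g).
  rewrite -/v1 mulmxBr mulmx1 mxE [X in _ + X]mxE => /eqP.
  by rewrite subr_eq addrC => /eqP ->; congr (_ + _); rewrite mxE.
exists v, w; split.
- move=> b; rewrite big_split_ord /=; case: (split_ordP b) => b' ->.
    rewrite vl vg [g 0 b']mxE; congr (_ + _); apply: eq_bigr => a _.
      by rewrite vl [J11 _ _]mxE.
    by rewrite vr -rmorphM mulrC.
  rewrite big1 ?add0r => [|a _]; last by rewrite J_S1 ?mulr0 // ?S1l ?S1r.
  rewrite vr /w wE ?S1r // sum_S2r rmorph_sum; apply: eq_bigr => a _.
  by rewrite vr mulrC rmorphM.
- move=> a; case: (split_ordP a) => a' ->; rewrite ?S1l // => Sa.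
  by split; [exact: vr|exact: wp].
- exact: wE.
(* [s0] solves the equation that differentiating Y = H(z, Y) gives for the derivative of the first
   block at rho. Once [noSub_i] has shown it real and nonnegative, v Jz becomes the sum X of
   nonnegative terms. *)
pose s0 := invmx (1%:M - J11) *m \col_a (Jz (lshift p a))%:C.
have s0E a : s0 a 0 = \sum_b (J (lshift p a) (lshift p b))%:C * s0 b 0 + (Jz (lshift p a))%:C.
  have := congr1 (fun x : 'cV_i => x a 0) (mulKVmx J11_unit (\col_a (Jz (lshift p a))%:C)).
  rewrite -/s0 mulmxBl mul1mx mxE [X in _ + X]mxE [RHS]mxE => /eqP.
  rewrite subr_eq addrC => /eqP ->; congr (_ + _).
  by rewrite mxE; apply: eq_bigr => b _; rewrite [X in X * _]mxE.
pose t a := complex.Re (s0 a 0).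
have ReE (c : R) (z : C) : complex.Re (c%:C * z) = c * complex.Re z.
  by case: z => z1 z2 /=; rewrite mul0r subr0.
have ImE (c : R) (z : C) : complex.Im (c%:C * z) = c * complex.Im z.
  by case: z => z1 z2 /=; rewrite mul0r addr0.
have tE a : t a = \sum_b J (lshift p a) (lshift p b) * t b + Jz (lshift p a).
  rewrite /t s0E raddfD raddf_sum /=; congr (_ + _).
  by apply: eq_bigr => b _; rewrite ReE.
have iE a : complex.Im (s0 a 0) = \sum_b J (lshift p a) (lshift p b) * complex.Im (s0 b 0).
  rewrite {1}s0E raddfD raddf_sum /= addr0.
  by apply: eq_bigr => b _; rewrite ImE.
have i0 a : complex.Im (s0 a 0) = 0.
  apply/eqP; rewrite eq_le; apply/andP; split.
    by apply: (noSub_i (f := fun a => complex.Im (s0 a 0))) => b; rewrite {1}iE.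
  rewrite -oppr_le0; apply: (noSub_i (f := fun a => - complex.Im (s0 a 0))) => b.
  by rewrite {1}iE -sumrN; apply: ler_sum => c _; rewrite mulrN.
have st a : s0 a 0 = (t a)%:C.
  by have := i0 a; rewrite /t; case: (s0 a 0) => z1 z2 /= ->.
have t0 a : 0 <= t a.
  rewrite -oppr_le0; apply: (noSub_i (f := fun a => - t a)) => b.
  rewrite {1}tE opprD -sumrN; under [leRHS]eq_bigr do rewrite mulrN.
  by rewrite gerDl oppr_le0 Jz_ge0.
pose X := \sum_a w (rshift i a) * (Jz (rshift i a) +
  \sum_b J (rshift i a) (lshift p b) * t b).
have XE : \sum_a v a * (Jz a)%:C = X%:C.
  rewrite big_split_ord /=.
  have -> : \sum_a v (lshift p a) * (Jz (lshift p a))%:C = \sum_b g 0 b * s0 b 0.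
    transitivity ((v1 *m \col_a (Jz (lshift p a))%:C) 0 0).
      by rewrite mxE; apply: eq_bigr => a _; rewrite vl; congr (_ * _); rewrite mxE.
    by rewrite /v1 -mulmxA -/s0 mxE.
  rewrite /X; under [X in _ = X%:C]eq_bigr do rewrite mulrDr.
  rewrite big_split /= rmorphD /= addrC; congr (_ + _).
    by rewrite rmorph_sum; apply: eq_bigr => a _; rewrite vr -rmorphM.
  under [X in _ = X%:C]eq_bigr do rewrite mulr_sumr.
  rewrite exchange_big rmorph_sum /=; apply: eq_bigr => b _.
  rewrite mxE mulr_suml rmorph_sum; apply: eq_bigr => a _.
  by rewrite st -rmorphM; congr _%:C; ring.
apply/negP; rewrite XE => /eqP X0; have {}X0 : X = 0 by exact: complexI X0.
have wr a : 0 < w (rshift i a) by apply: wp; rewrite S1r.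
have sum0 a : 0 <= \sum_b J (rshift i a) (lshift p b) * t b.
  by apply: sumr_ge0 => b _; rewrite mulr_ge0 ?J_ge0.
have za a : Jz (rshift i a) + \sum_b J (rshift i a) (lshift p b) * t b = 0.
  have : X == 0 by rewrite X0.
  rewrite psumr_eq0 => [/allP /(_ a (mem_index_enum a))|b _].
    by rewrite mulf_eq0 (gt_eqF (wr a)) => /eqP.
  by rewrite mulr_ge0 ?(ltW (wr b)) // addr_ge0 ?Jz_ge0.
have Jz2 a : Jz (rshift i a) = 0.
  by apply/eqP; rewrite eq_le Jz_ge0 andbT; have := za a; have := sum0 a; lra.
have Jt a b : J (rshift i a) (lshift p b) * t b = 0.
  have : \sum_b J (rshift i a) (lshift p b) * t b == 0 by have := za a; rewrite Jz2 add0r => ->.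
  rewrite psumr_eq0 => [/allP /(_ b (mem_index_enum b)) /eqP //|c _].
  by rewrite mulr_ge0 ?J_ge0.
(* By [concave], dl - rho t is at most its image under J11, so [noSub_i] applies. A coordinate with
   t = 0 is therefore constant between 0 and rho. *)
have dt b : dl (lshift p b) <= rho * t b.
  rewrite -subr_le0; apply: (noSub_i (f := fun b => dl (lshift p b) - rho * t b)) => a.
  have := concave (lshift p a); rewrite big_split_ord /= [X in _ + (_ + X)]big1 => [|c _]; last first.
    by rewrite J_S1 ?mul0r // ?S1l ?S1r.
  rewrite addr0; under [X in _ -> _ <= X]eq_bigr do rewrite mulrBr.
  rewrite sumrB; set s1 := \sum_b _ * dl _; set s2 := \sum_b _ * (rho * _).
  have -> : s2 = rho * (t a - Jz (lshift p a)).
    rewrite {1}tE addrK mulr_sumr; apply: eq_bigr => c _; ring.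
  by move=> h; rewrite mulrBr; lra.
(* Every variable occurring in the second block keeps its value at (0, U), so U solves that block
   over the first block at rho, and minimality gives Y <= U. *)
have UY2 c : ~~ S1 c -> Y 0 c <= U 0 c.
  move: c; apply: (block2_min (Z2 := fun b => U 0 b)) => [b _|c]; first exact: U_le_Y.
  case: (split_ordP c) => c' ->; rewrite ?S1l // => _.
  rewrite -[leRHS]fix0 !ps_evalE le_eqVlt; apply/orP; left; apply/eqP.
  congr Sum; apply/funext => e.
  have [->|He] := eqVneq (H (rshift i c') e) 0; first by rewrite !mul0r.
  congr (_ * _); apply: eq_bigr => j _; have [->|ej] := posnP (e j); first by rewrite !expr0.
  congr (_ ^+ _); move: j ej; apply: zY_ind => [b|] ej.
    rewrite !zY_pointl [LHS]mxE; case: (split_ordP b) ej => b' -> ej; rewrite ?S1r // S1l.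
    have Jp : 0 < J (rshift i c') (lshift p b') by apply: J_gt0; exists e.
    have tb : t b' = 0 by have /eqP := Jt c' b'; rewrite mulf_eq0 (gt_eqF Jp) => /eqP.
    have d0 : dl (lshift p b') = 0.
      by apply/eqP; rewrite eq_le dl_ge0 andbT; have := dt b'; rewrite tb mulr0.
    by apply/eqP; rewrite -subr_eq0 -dlE d0.
  have := pH_gt0 He ej; by rewrite JzE Jz2 ltxx.
have [r rr sr] := larger_radius1.
apply: (@no_larger_radius r rr) => b; have [Sb|Sb] := boolP (S1 b); first exact: sr.
have Eb : Y 0 b = U 0 b.
  by apply/eqP; rewrite eq_le UY2 //; have /andP[] := U_le_Y b.
apply: summ_dom_norm (y_summ b) => k; case: k => [|k]; first by rewrite !expr0.
by rewrite (Y_const_inv Eb) // !mul0r.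
Qed.

(** * Nonlinearity of the second block *)

Lemma Y_dmon b e : Y 0 b * dmon (lshift 1 b) A0 e = (e (lshift 1 b))%:R * monomial A0 e.
Proof.
rewrite dmonE /monomial [in RHS](bigD1 (lshift 1 b)) //= zY_pointl.
case: (e (lshift 1 b)) => [|k] /=; first by rewrite !mul0r mulr0.
by rewrite exprS; set P := \prod_(_ | _) _; ring.
Qed.

(* Were the second block affine in its own unknowns, pairing it with the left
   Perron vector would make its free term vanish, and with it the block. *)
Lemma nonlinear (w : 'I_m -> R) : (forall a, ~~ S1 a -> 0 < w a) ->
  (forall b, ~~ S1 b -> w b = \sum_(a | ~~ S1 a) J a b * w a) -> (exists a, ~~ S1 a) ->
  exists a b c e, [/\ ~~ S1 a, ~~ S1 b, ~~ S1 c, H a e != 0 &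
    (0 < e (lshift 1 b))%N /\ (0 < dec (lshift 1 b) e (lshift 1 c))%N].
Proof.
move=> w0 wE [c Sc]; apply: contrapT => nl.
have deg a e b : ~~ S1 a -> ~~ S1 b -> H a e != 0 -> (0 < e (lshift 1 b))%N ->
    e (lshift 1 b) = 1%N /\ forall b', ~~ S1 b' -> b' != b -> e (lshift 1 b') = 0%N.
  move=> Sa Sb He eb; split=> [|b' Sb' nb].
    apply/eqP; rewrite eqn_leq eb andbT leqNgt; apply/negP => e2; case: nl; exists a, b, b, e.
    by split=> //; split=> //; rewrite ffunE eqxx -subn1 subn_gt0.
  apply/eqP; rewrite -leqn0 leqNgt; apply/negP => e1; case: nl; exists a, b, b', e.
  by split=> //; split=> //; rewrite ffunE eq_lshift (negbTE nb).
have sE a e : ~~ S1 a -> H a e != 0 -> (exists b, ~~ S1 b /\ (0 < e (lshift 1 b))%N) ->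
    \sum_(b | ~~ S1 b) Y 0 b * dmon (lshift 1 b) A0 e = monomial A0 e.
  move=> Sa He [b [Sb eb]]; have [e1 e0] := deg a e b Sa Sb He eb.
  rewrite (bigD1 b) //= big1 ?addr0 => [|b' /andP[Sb' nb]]; first by rewrite Y_dmon e1 mul1r.
  by rewrite Y_dmon e0 // mul0r.
have sE0 (e : {ffun 'I_(m + 1) -> nat}) : ~ (exists b, ~~ S1 b /\ (0 < e (lshift 1 b))%N) ->
    \sum_(b | ~~ S1 b) Y 0 b * dmon (lshift 1 b) A0 e = 0.
  move=> ne; rewrite big1 // => b Sb; rewrite Y_dmon.
  by have [->|eb] := posnP (e (lshift 1 b)); [rewrite mul0r|case: ne; exists b].
(* By Euler's relation [Y_dmon], the sum subtracted is the monomial times its degree in the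
   second-block unknowns. For the monomials present in that block this degree is now 0 or 1, so f
   sums to the free term. *)
pose f a e := H a e * monomial A0 e - \sum_(b | ~~ S1 b) Y 0 b * (H a e * dmon (lshift 1 b) A0 e).
have fE a e : f a e = H a e * (monomial A0 e - \sum_(b | ~~ S1 b) Y 0 b * dmon (lshift 1 b) A0 e).
  by rewrite mulrBr mulr_sumr; congr (_ - _); apply: eq_bigr => b _; rewrite mulrCA.
have f0 a e : ~~ S1 a -> 0 <= f a e.
  move=> Sa; rewrite fE; have [->|He] := eqVneq (H a e) 0; first by rewrite mul0r.
  case: (pselect (exists b, ~~ S1 b /\ (0 < e (lshift 1 b))%N)) => [h|h].
    by rewrite (sE a e Sa He h) subrr mulr0.
  rewrite (sE0 e h) subr0; apply: mulr_ge0; first exact: H0.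
  by apply: monomial_ge0; exact: A0_ge0.
have sY a b : summ (boxes (m + 1)) (fun e => Y 0 b * (H a e * dmon (lshift 1 b) A0 e)).
  by apply: summZ; exact: gc_summ.
have tS a : summ (boxes (m + 1)) (fun e => H a e * monomial A0 e) by exact: term_summ.
have fS a : summ (boxes (m + 1)) (f a) by exact: summB (tS a) (summ_sum _ _ (sY a)).
have fT a : Sum (boxes (m + 1)) (f a) = Y 0 a - \sum_(b | ~~ S1 b) Y 0 b * (J a b)%:C.
  rewrite /f (SumB (tS a) (summ_sum _ _ (sY a))).
  rewrite -[X in X - _]ps_evalE fixA0 (Sum_sum _ _ (sY a)); congr (_ - _); apply: eq_bigr => b _.
  by rewrite (SumZ _ (gc_summ a _)) -pHE JE.
have T0 a : ~~ S1 a -> 0 <= Sum (boxes (m + 1)) (f a).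
  by move=> Sa; apply: Sum_ge0 (fS a) => e; exact: f0.
(* Since w is invariant under the transpose of J on the block, the two totals of w_a Y_a cancel. *)
have h : \sum_(a | ~~ S1 a) (w a)%:C * Sum (boxes (m + 1)) (f a) = 0.
  under eq_bigr do rewrite fT mulrBr mulr_sumr.
  rewrite sumrB exchange_big /= -sumrB big1 // => b Sb.
  rewrite {1}(wE b Sb) rmorph_sum mulr_suml -sumrB big1 // => a _.
  by rewrite rmorphM /= -mulrA mulrCA [(J a b)%:C * _]mulrC subrr.
have TE a : ~~ S1 a -> Sum (boxes (m + 1)) (f a) = 0.
  move=> Sa; have wa : (w a)%:C != 0 :> C by rewrite gt_eqF // ltcR w0.
  have /eqP := h; rewrite psumr_eq0 => [/allP /(_ a (mem_index_enum a))|d Sd].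
    by rewrite Sa /= mulf_eq0 (negbTE wa) => /eqP.
  by rewrite mulr_ge0 ?T0 // ler0c ltW ?w0.
(* All free terms vanish, so 0 is a supersolution of the second block over the first one; minimality
   then contradicts Y > 0. *)
have := Y_gt0 c; rewrite lt_neqAle => /andP[/negP nY _]; apply: nY.
rewrite eq_le ltW ?Y_gt0 //=; move: c Sc; apply: (block2_min (Z2 := fun=> 0)) => [b _|d Sd].
  by rewrite lexx ltW ?Y_gt0.
rewrite ps_evalE le_eqVlt; apply/orP; left; apply/eqP; apply: Sum0 => e; have [->|He] := eqVneq (H d e) 0; first by rewrite mul0r.
have fz := Sum_eq0 e (fun e => f0 d e Sd) (fS d) (TE d Sd).
have [b [Sb eb]] : exists b, ~~ S1 b /\ (0 < e (lshift 1 b))%N.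
  apply: contrapT => nb; move/eqP: fz; rewrite fE (sE0 e nb) subr0 mulf_eq0 (negbTE He).
  by rewrite gt_eqF // monomial_gt0 // => j; exact: A0_gt0.
rewrite monomialE (bigD1 b) //=; set X := (\row_b0 _) 0 b.
have -> : X = 0 by rewrite [LHS]mxE (negbTE Sb).
by rewrite expr0n gtn_eqF // !mul0r mulr0.
Qed.

(** * The Jacobian of the characteristic system at the critical point *)

Lemma gc2_ge0 a j l e : 0 <= gc (gc (H a) id j) (gsh id j) l e *
  monomial A0 (gsh (gsh id j) l e).
Proof.
apply: mulr_ge0; last by apply: monomial_ge0; exact: A0_ge0.
by rewrite /gc !mulr_ge0 ?ler0n ?H0.
Qed.

Lemma ppH_ge0 a j l : 0 <= ppH H a j l A0.
Proof. exact: Sum_ge0 (gc2_ge0 a j l) (dom_gsum2 a j l rho_dom). Qed.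

Lemma ppH_gt0 a j l e : H a e != 0 -> (0 < e j)%N -> (0 < dec j e l)%N -> 0 < ppH H a j l A0.
Proof.
move=> He ej el; apply: lt_le_trans (Sum_ge1 e (gc2_ge0 a j l) (dom_gsum2 a j l rho_dom)).
apply: mulr_gt0; last by apply: monomial_gt0; exact: A0_gt0.
by rewrite /gc !mulr_gt0 ?ltr0n // lt0r He H0.
Qed.

Lemma ppH_S1 a b l : S1 a -> ~~ S1 b -> ppH H a (lshift 1 b) l A0 = 0.
Proof.
move=> Sa Sb; apply: Sum0 => e; rewrite /gc; have [->|He] := eqVneq (H a e) 0; first by rewrite !mul0r.
have [->|eb] := posnP (e (lshift 1 b)); first by rewrite mulr0 !mul0r.
by case/negP: Sb; apply: (S1_closed Sa); exists e.
Qed.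

Lemma critical_newton :
  exists2 V : set 'rV[C]_(m + 1), nbhs A0 V & newton_cvg_quadratic D (char_system H) A0 V.
Proof.
have [q [q1 q2 qE [a2 Sa2]]] := right_vec.
have [v [w [vE v2 wE vz]]] := left_vec.
have [a [b [c [e [Sa Sb Sc He [eb ec]]]]]] :=
  nonlinear (fun a Sa => proj2 (v2 a Sa)) wE (ex_intro _ a2 Sa2).
have [gd Cd] : smooth (fun x => \det (1%:M - JH H x)) A0.
  by apply: smooth_det => k l; eexists; exact: C11_oneBJH.
have q0 k : 0 <= (q k)%:C :> C.
  by rewrite ler0c; case: (boolP (S1 k)) => Sk; [rewrite q1|exact: ltW (q2 k Sk)].
have qp k : ~~ S1 k -> 0 < (q k)%:C :> C by move=> Sk; rewrite ltcR q2.
have vp k : ~~ S1 k -> 0 < v k by move=> /v2[-> wk]; rewrite ltcR.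
pose hh : 'rV[C]_(m + 1) := zY_point 0 (\row_b (q b)%:C).
have hl k : hh 0 (lshift 1 k) = (q k)%:C by rewrite zY_pointl mxE.
have hr : hh 0 (rshift m 0) = 0 by rewrite zY_pointr.
have hh0 j : 0 <= hh 0 j by move: j; apply: zY_ind => [k|]; rewrite ?hl ?hr.
have nz : \sum_j hh 0 j * gd A0 j != 0.
  pose ww : 'cV[C]_m :=
    \col_k \sum_l (\sum_j hh 0 j * - ppH H k (lshift 1 l) j A0) * (q l)%:C.
  apply: (det_direction (u := \col_k (q k)%:C) (w := ww) (v := \row_k v k) (j0 := a2)
    (fun k l => C11_oneBJH k l rho_dom) Cd).
  - apply/colP => k; rewrite mulmxBl mul1mx !mxE (qE k) rmorph_sum -sumrB big1 // => l _.
    by rewrite !mxE JE rmorphM subrr.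
  - by rewrite mxE gt_eqF // qp.
  - by move=> k; rewrite [LHS]mxE; apply: eq_bigr => l _; congr (_ * _); rewrite mxE.
  - apply/rowP => l; rewrite mulmxBr mulmx1 !mxE (vE l) -sumrB big1 // => k _.
    by rewrite !mxE JE subrr.
  - move=> x xM.
    have xE l : x 0 l = \sum_k x 0 k * (J k l)%:C.
      have := congr1 (fun z : 'rV_m => z 0 l) xM; rewrite /= mulmxBr mulmx1 mxE.
      rewrite [X in _ + X]mxE [RHS]mxE => /eqP; rewrite subr_eq0 => /eqP ->.
      by rewrite mxE; apply: eq_bigr => k _; rewrite mxE JE.
    (* The multiple of v is chosen to cancel the coordinate [a2] of the second block; a null vector
       with a zero there vanishes. *)
    pose c0 := x 0 a2 / v a2; exists c0; apply/rowP => l; rewrite [RHS]mxE [X in _ * X]mxE.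
    apply/eqP; rewrite -subr_eq0; apply: contraT => ne; pose x' l := x 0 l - c0 * v l.
    have x'E l' : x' l' = \sum_k x' k * (J k l')%:C.
      rewrite /x' {1}xE {1}(vE l') mulr_sumr -sumrB.
      by apply: eq_bigr => k _; rewrite mulrBl mulrA.
    have x'a : x' a2 = 0 by rewrite /x' /c0 divfK ?subrr // gt_eqF // vp.
    have [/(_ a2 Sa2) + _] := left_null x'E (ex_intro _ l ne).
    by rewrite x'a /nrm normr0 ltxx.
  pose G k l := \sum_j hh 0 j * ppH H k (lshift 1 l) j A0.
  have G0 k l : 0 <= G k l.
    by apply: sumr_ge0 => j _; apply: mulr_ge0; [exact: hh0|exact: ppH_ge0].
  (* The entries of v on the first block have no known sign, but their rows contribute nothing: q
     vanishes on the first block, whose equations do not involve the second. The monomial given by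
     [nonlinear] makes one of the remaining nonnegative terms positive. *)
  have pos : 0 < \sum_k v k * \sum_l G k l * (q l)%:C.
    rewrite (bigD1 a) //= ltr_pwDl //.
      rewrite mulr_gt0 ?vp // (bigD1 b) //= ltr_pwDl //; last first.
        by apply: sumr_ge0 => l _; rewrite mulr_ge0.
      rewrite mulr_gt0 ?qp // /G (bigD1 (lshift 1 c)) //= ltr_pwDl //.
        by rewrite hl mulr_gt0 ?qp // (ppH_gt0 He).
      by apply: sumr_ge0 => j _; rewrite mulr_ge0 ?ppH_ge0.
    apply: sumr_ge0 => k _; case: (boolP (S1 k)) => Sk; last first.
      by apply: mulr_ge0; [exact: ltW (vp k Sk)|]; apply: sumr_ge0 => l _; rewrite mulr_ge0.
    rewrite big1 ?mulr0 // => l _; case: (boolP (S1 l)) => Sl; first by rewrite q1 ?mulr0.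
    by rewrite /G big1 ?mul0r // => j _; rewrite ppH_S1 ?mulr0.
  have vwE : (\row_k v k *m ww) 0 0 = - \sum_k v k * \sum_l G k l * (q l)%:C.
    rewrite mxE -sumrN; apply: eq_bigr => k _; rewrite [X in X * _]mxE [ww k 0]mxE.
    rewrite -mulrN -sumrN; congr (_ * _); apply: eq_bigr => l _; rewrite -mulNr; congr (_ * _).
    by rewrite /G -sumrN; apply: eq_bigr => j _; rewrite mulrN.
  apply/eqP => h; move: vwE; rewrite h mxE => /esym/eqP.
  by rewrite oppr_eq0 (gt_eqF pos).
have F0 : char_system H A0 = 0.
  have lE : lsubmx A0 = Y by exact: row_mxKl.
  have rE : rsubmx A0 0 0 = rho%:C by rewrite /zY_point row_mxKr mxE eqxx mulr1n.
  rewrite /char_system lE rE (dHdY_JH rho_dom) det_A0.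
  have -> : Y - sys_eval H rho%:C Y = 0.
    apply/rowP => k; rewrite mxE [X in _ + X]mxE [X in _ - X]mxE fixA0 subrr.
    by rewrite [RHS]mxE.
  by rewrite raddf0 row_mx0.
apply: (char_system_newton rho_dom F0 Cd) => h hk hd.
pose t := h 0 (rshift m 0).
have hE k : h 0 (lshift 1 k) = \sum_l (J k l)%:C * h 0 (lshift 1 l) + t * (Jz k)%:C.
  rewrite {1}hk big_split_ord /= big_ord1 JzE; congr (_ + _).
  by apply: eq_bigr => l _; rewrite JE mulrC.
(* Pairing the linearised equations with the left null vector v leaves t * (v Jz) = 0. *)
have t0 : t = 0.
  have : \sum_k v k * h 0 (lshift 1 k) =
      \sum_k v k * h 0 (lshift 1 k) + t * \sum_k v k * (Jz k)%:C.
    transitivity (\sum_k (\sum_l v k * (J k l)%:C * h 0 (lshift 1 l) + v k * (t * (Jz k)%:C))).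
      apply: eq_bigr => k _; rewrite {1}hE mulrDr mulr_sumr; congr (_ + _).
      by apply: eq_bigr => l _; rewrite mulrA.
    rewrite big_split exchange_big /=; congr (_ + _).
      by apply: eq_bigr => l _; rewrite -mulr_suml -vE.
    by rewrite mulr_sumr; apply: eq_bigr => k _; rewrite mulrCA.
  move=> /eqP; rewrite -subr_eq0 opprD addrA subrr sub0r oppr_eq0 mulf_eq0 (negbTE vz) orbF.
  by move=> /eqP.
pose c0 := h 0 (lshift 1 a2) / (q a2)%:C.
pose u k := h 0 (lshift 1 k) - c0 * (q k)%:C.
have uE k : u k = \sum_l (J k l)%:C * u l.
  rewrite /u {1}hE t0 mul0r addr0 (qE k) rmorph_sum mulr_sumr -sumrB.
  by apply: eq_bigr => l _; rewrite rmorphM /= mulrBr; congr (_ - _); exact: mulrCA.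
have ua2 : u a2 = 0 by rewrite /u /c0 divfK ?subrr // gt_eqF // qp.
(* With t = 0 the remaining part of h is a right null vector; after removal of a multiple of q it
   vanishes at [a2], hence everywhere. So h is a multiple of [hh], along which the determinant has
   nonzero derivative. *)
have u0 k : u k = 0.
  apply/eqP; apply: contraT => uk.
  have [_ /(_ a2 Sa2) + _] := right_null uE (ex_intro _ k uk).
  by rewrite ua2 /nrm normr0 ltxx.
have hc : h = c0 *: hh.
  apply/rowP; apply: zY_ind => [k|]; rewrite [RHS]mxE ?hl ?hr.
    by apply/eqP; rewrite -subr_eq0; apply/eqP; exact: u0.
  by rewrite -/t t0 mulr0.
have : c0 * \sum_j hh 0 j * gd A0 j = 0.
  rewrite -[RHS]hd mulr_sumr; apply: eq_bigr => j _.
  by rewrite [in RHS]hc [X in _ = X * _]mxE mulrA.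
move=> /eqP; rewrite mulf_eq0 (negbTE nz) orbF => /eqP c00.
by rewrite hc c00 scale0r.
Qed.

End CriticalPoint.

Theorem theorem4p7 (R : realType) (i p : nat) (H : system R (i + p))
    (y : 'I_(i + p) -> nat -> Cplx R) (rho : R)
    (i_gt0 : (0 < i)%N) (p_gt0 : (0 < p)%N)
    (H_analytic : analytic_near0 H)
    (H_wf : wellfounded H)
    (H_nirr : ~ irreducible_sys H)
    (H_comp : irreducible_component H)
    (y_sol : gf_solution H y)
    (y_zf : zero_free y)
    (rho_def : sys_radius y = rho%:E)
    (rho_lt : (rho%:E < sys_radius (fun a : 'I_i => y (lshift p a)))%E)
    (y_cvg : gf_cvg y rho%:C)
    (rho_dom : cvg_domain H (zY_point rho%:C (gf_eval y rho%:C))) :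
  exists2 V : set 'rV[Cplx R]_(i + p + 1),
    nbhs (zY_point rho%:C (gf_eval y rho%:C)) V &
    newton_cvg_quadratic (cvg_domain H) (char_system H)
      (zY_point rho%:C (gf_eval y rho%:C)) V.
Proof.
exact: (critical_newton H_wf y_sol y_zf rho_def y_cvg rho_dom rho_lt H_comp).
Qed.
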